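(* Let $f\in \mathcal{S}_{\mathcal{AP}}^{*}$, with inverse logarithmic coefficients $\Gamma_1,\Gamma_2,\Gamma_3$, and let $H_{2,1}\left(F_{f^{-1}}/2\right)=\Gamma_1\Gamma_3-\Gamma_2^2$ be the second-order inverse logarithmic Hankel determinant. Then $$\left| H_{2,1}\left(F_{f^{-1}} / 2\right)\right| \le \frac{1177}{3072}.$$ The inequality is sharp, i.e. equality holds for some function in $\mathcal{S}_{\mathcal{AP}}^{*}$.
   Context: Let $\mathbb{D}=\{z\in\mathbb{C}:|z|<1\}$, and let $\mathcal{A}$ be the class of analytic functions $f$ on $\mathbb{D}$ normalized by $f(0)=0$, $f'(0)=1$, written $f(z)=z+\sum_{n=2}^{\infty}a_nz^n$. For analytic $f,g$ on $\mathbb{D}$, $f\prec g$ (subordination) means that there is an analytic function $\omega$ on $\mathbb{D}$ with $\omega(0)=0$ and $|\omega(z)|<1$ (a Schwarz function) such that $f(z)=g(\omega(z))$ for $z\in\mathbb{D}$. The class $\mathcal{S}_{\mathcal{AP}}^{*}$ consists of all $f\in\mathcal{A}$ with $$\frac{zf'(z)}{f(z)}\prec\psi_{\mathcal{AP}}(z):=e^{z}\sqrt{1+z},\quad z\in\mathbb{D},$$ where the square root is the principal branch (value $1$ at $z=0$). It is a subclass of the univalent functions. The inverse logarithmic coefficients $\Gamma_n$ of $f$ are defined by $$F_{f^{-1}}(w):=\log\frac{f^{-1}(w)}{w}=2\sum_{n=1}^{\infty}\Gamma_n w^n,\qquad |w|<\tfrac14,$$ where the logarithm vanishes at $w=0$;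 explicitly, $\Gamma_1=-\frac12a_2$, $\Gamma_2=-\frac12a_3+\frac34a_2^2$, $\Gamma_3=-\frac12\left(a_4-4a_2a_3+\frac{10}{3}a_2^3\right)$. The Hankel determinant $H_{2,1}(F_{f^{-1}}/2)$ is the determinant of the $2\times2$ matrix with rows $(\Gamma_1,\Gamma_2)$ and $(\Gamma_2,\Gamma_3)$. *)

(* Defs.v *)
From Stdlib Require Import Reals Lra Psatz.
From Coquelicot Require Export Coquelicot.

Open Scope R_scope.

(* The derivative is the complex one: [ex_derive] is inferred over
   [C_AbsRing], so analytic means holomorphic. *)
Definition analytic_disc (r : R) (f : C -> C) : Prop :=
  forall z : C, Cmod z < r -> ex_derive (K := C_AbsRing) (V := C_NormedModule) f z.

Definition Cexp (z : C) : C :=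
  (exp (Re z) * cos (Im z), exp (Re z) * sin (Im z)).

(* Principal square root, cut along the negative real axis; see
   [Csqrt_sqr] and [Csqrt_Re]. *)
Definition Csqrt (z : C) : C :=
  let s := sqrt ((Cmod z - Re z) / 2) in
  (sqrt ((Cmod z + Re z) / 2), if Rle_dec 0 (Im z) then s else - s).

Lemma Csqrt_sqr (z : C) : (Csqrt z * Csqrt z)%C = z.
Proof.
destruct z as [x y].
pose proof (Cmod_ge_0 (x, y)) as H0.
assert (Hm : Cmod (x, y) * Cmod (x, y) = x * x + y * y).
{ unfold Cmod; simpl; rewrite sqrt_sqrt; [ring | nra]. }
unfold Csqrt; simpl; set (m := Cmod (x, y)) in *.
assert (H1 : 0 <= (m + x) / 2) by nra.
assert (H2 : 0 <= (m - x) / 2) by nra.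
assert (H3 : sqrt ((m + x) / 2) * sqrt ((m - x) / 2) = Rabs y / 2).
{ rewrite <- sqrt_mult by assumption.
  replace ((m + x) / 2 * ((m - x) / 2)) with (Rsqr (y / 2)) by (unfold Rsqr; nra).
  rewrite sqrt_Rsqr_abs; unfold Rdiv.
  now rewrite Rabs_mult, (Rabs_pos_eq (/ 2)) by lra. }
pose proof (sqrt_sqrt _ H1); pose proof (sqrt_sqrt _ H2).
unfold Cmult; simpl.
destruct (Rle_dec 0 y) as [Hy | Hy]; f_equal; try nra.
- rewrite Rabs_pos_eq in H3 by assumption; nra.
- rewrite Rabs_left in H3 by lra; nra.
Qed.

Lemma Csqrt_Re (z : C) : 0 <= Re (Csqrt z).
Proof. apply sqrt_pos. Qed.

Definition psi_AP (z : C) : C := (Cexp z * Csqrt (1 + z))%C.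

Definition schwarz_function (om : C -> C) : Prop :=
  analytic_disc 1 om /\ om (RtoC 0) = RtoC 0 /\
  forall z : C, Cmod z < 1 -> Cmod (om z) < 1.

Definition subordinate (f g : C -> C) : Prop :=
  exists om : C -> C, schwarz_function om /\
    forall z : C, Cmod z < 1 -> f z = g (om z).

Definition class_A (f : C -> C) : Prop :=
  analytic_disc 1 f /\ f (RtoC 0) = RtoC 0 /\ C_derive f (RtoC 0) = RtoC 1.

(* The quotient z f'(z) / f(z), with its removable singularity at 0 filled in
   for f in [class_A]. *)
Definition starlike_quotient (f : C -> C) (z : C) : C :=
  if Ceq_dec z (RtoC 0) then RtoC 1 else (z * C_derive f z / f z)%C.

(* The nonvanishing clause makes the quotient a genuine one, since Coquelicot
   sets the inverse of 0 to 0. *)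
Definition class_S_AP (f : C -> C) : Prop :=
  class_A f /\
  (forall z : C, Cmod z < 1 -> z <> RtoC 0 -> f z <> RtoC 0) /\
  subordinate (starlike_quotient f) psi_AP.

Definition is_inverse_disc (r : R) (f g : C -> C) : Prop :=
  analytic_disc r g /\ g (RtoC 0) = RtoC 0 /\
  forall w : C, Cmod w < r -> Cmod (g w) < 1 /\ f (g w) = w.

(* [F] is the branch of log (g(w) / w) with F(0) = 0. *)
Definition is_log_quotient_disc (r : R) (g F : C -> C) : Prop :=
  analytic_disc r F /\ F (RtoC 0) = RtoC 0 /\
  forall w : C, Cmod w < r -> w <> RtoC 0 -> Cexp (F w) = (g w / w)%C.

(* The coefficients depend only on the germs at 0 of the inverse and of the
   logarithm, so any disc around 0 on which these exist may be used (for
   univalent f, radius 1/4 is always possible).  The value [Gam 0] is not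
   used. *)
Definition inverse_log_coeffs (f : C -> C) (Gam : nat -> C) : Prop :=
  exists (r : R) (g F : C -> C),
    0 < r /\ is_inverse_disc r f g /\ is_log_quotient_disc r g F /\
    forall w : C, Cmod w < r ->
      is_pseries (K := C_AbsRing) (V := C_NormedModule)
        (fun n : nat => match n with O => RtoC 0 | S _ => (2 * Gam n)%C end)
        w (F w).

Definition hankel21 (Gam : nat -> C) : C :=
  (Gam 1%nat * Gam 3%nat - Gam 2%nat * Gam 2%nat)%C.

(* Main.v *)
Require Import Defs.
From Stdlib Require Import Reals Lra Psatz Lia ClassicalEpsilon.
From Coquelicot Require Import Coquelicot.
Open Scope R_scope.

(** Write w g'(w)/g(w) = 1 + w F'(w) for the inverse g = w exp F of f.  Differentiating
    f(g(w)) = w turns the subordination z f'/f = psi(om) into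
    psi(om(w exp F(w))) (1 + w F'(w)) = 1.  Comparing Taylor coefficients up to order 3,
    with om = c1 z + c2 z^2 + c3 z^3 + ..., gives
      H = 3/16 c1 c3 - 47/128 c1^2 c2 + 1177/3072 c1^4 - 9/64 c2^2,
    and the bound follows from |c2|, |c3| <= 1 - |c1|^2 alone.  These two inequalities come from
    taking the circular mean of om(u)/u against a trigonometric kernel of the form
    (1 + a^* v)^2 / v with |v| = 1.  Equality holds for om(z) = z, i.e. for
    f = z exp(P) with P' = (psi - 1)/z.

    Holomorphic means pointwise complex differentiable, so the Taylor coefficients rest on
    Goursat's lemma for rectangles, transported to annuli by the exponential. *)

(** * Continuity and complex differentiability *)

(** The power series of f never enters: the chain rule eliminates f', and what remains relates om,
    psi and F, each expanded at 0. The coefficient of order k contains Gamma_k only through the term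
    2k Gamma_k, so the Gamma_k come out one after the other. Bounding c2 and c3 separately is
    affordable. With x = |c1|, the gap between 1177/3072 and the resulting estimate is (1 - x^2)(745
    + 481 x^2 - 576 x)/3072, where the quadratic has negative discriminant. The gap closes only at x
    = 1, which forces c2 = c3 = 0 and points to om(z) = z. Integrals are estimated through real and
    imaginary parts, at the cost of a factor 2. This does not matter for remainders, but the
    coefficients of om need the exact constant; it comes from the positivity of the real part of a
    mean. Sharpness requires an actual inverse of the extremal function. The equation f(z) = w reads
    z = w exp(-P(z)), a contraction for small w, and the logarithm F = -P(g) comes with it. *)

Lemma locally_Cmod (z : C) (P : C -> Prop) :
  locally z P <->
  exists d, 0 < d /\ forall y, Cmod (y - z) < d -> P y.
Proof.
split.
- intros [d Hd]; exists d; split; [apply cond_pos |].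
  intros y Hy; apply Hd, C_NormedModule_mixin_compat1, Hy.
- intros [d [Hd H]].
  assert (H2 : 0 < sqrt 2) by (apply sqrt_lt_R0; lra).
  (* Balls of the uniform structure on C are squares; the one of half-side d / sqrt 2 fits into the
     disc of radius d. *)
  assert (Hp : 0 < d / sqrt 2) by (apply Rdiv_lt_0_compat; assumption).
  exists (mkposreal _ Hp); intros y Hy; apply H.
  apply C_NormedModule_mixin_compat2 in Hy; simpl in Hy.
  replace (sqrt 2 * (d / sqrt 2)) with d in Hy by (field; lra).
  exact Hy.
Qed.

(** The domain is left general so that the same rules serve functions on C and curves R -> C. *)
Definition ccont {T : UniformSpace} (f : T -> C) (x : T) : Prop :=
  forall eps, 0 < eps -> locally x (fun y => Cmod (f y - f x) < eps).

Section Continuity.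
Context {T : UniformSpace}.
Implicit Types (f g : T -> C) (x : T).

Lemma ccont_const (c : C) x : ccont (fun _ : T => c) x.
Proof.
intros e He; apply filter_forall; intros y.
replace (c - c)%C with (RtoC 0) by ring; rewrite Cmod_0; exact He.
Qed.

Lemma ccont_ext_loc f g x :
  locally x (fun y => f y = g y) -> ccont f x -> ccont g x.
Proof.
intros H Hf e He; specialize (Hf e He).
pose proof (locally_singleton _ _ H) as H0.
generalize (filter_and _ _ H Hf); apply filter_imp.
intros y [E L]; rewrite <- E, <- H0; exact L.
Qed.

Lemma ccont_plus f g x : ccont f x -> ccont g x -> ccont (fun y => f y + g y)%C x.
Proof.
intros Hf Hg e He.
assert (He2 : 0 < e / 2) by lra.
generalize (filter_and _ _ (Hf _ He2) (Hg _ He2)).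
apply filter_imp; intros y [A B].
replace (f y + g y - (f x + g x))%C with ((f y - f x) + (g y - g x))%C by ring.
eapply Rle_lt_trans; [apply Cmod_triangle | lra].
Qed.

Lemma ccont_mult f g x : ccont f x -> ccont g x -> ccont (fun y => f y * g y)%C x.
Proof.
intros Hf Hg e He.
set (a := Cmod (f x)); set (b := Cmod (g x)).
assert (Ha : 0 <= a) by apply Cmod_ge_0.
assert (Hb : 0 <= b) by apply Cmod_ge_0.
set (n := Rmin 1 (e / (1 + a + b))).
assert (Hn : 0 < n).
{ apply Rmin_glb_lt; [lra | apply Rdiv_lt_0_compat; lra]. }
assert (Hn1 : n <= 1) by apply Rmin_l.
assert (Hn2 : n * (1 + a + b) <= e).
{ apply Rle_trans with (e / (1 + a + b) * (1 + a + b)).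
  - apply Rmult_le_compat_r; [lra | apply Rmin_r].
  - right; field; lra. }
generalize (filter_and _ _ (Hf n Hn) (Hg n Hn)).
apply filter_imp; intros y [A B].
replace (f y * g y - f x * g x)%C
  with ((f y - f x) * (g y - g x) + (f x * (g y - g x) + (f y - f x) * g x))%C by ring.
pose proof (Cmod_ge_0 (f y - f x)); pose proof (Cmod_ge_0 (g y - g x)).
eapply Rle_lt_trans; [apply Cmod_triangle |].
eapply Rle_lt_trans; [apply Rplus_le_compat_l, Cmod_triangle |].
rewrite !Cmod_mult; fold a b; nra.
Qed.

Lemma ccont_opp f x : ccont f x -> ccont (fun y => - f y)%C x.
Proof.
intros Hf e He; generalize (Hf e He); apply filter_imp; intros y.
replace (- f y - - f x)%C with (- (f y - f x))%C by ring.
now rewrite Cmod_opp.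
Qed.

Lemma ccont_minus f g x : ccont f x -> ccont g x -> ccont (fun y => f y - g y)%C x.
Proof. intros Hf Hg; apply ccont_plus; [exact Hf | apply ccont_opp, Hg]. Qed.

Lemma ccont_inv f x : f x <> RtoC 0 -> ccont f x -> ccont (fun y => / f y)%C x.
Proof.
intros H0 Hf e He.
set (a := Cmod (f x)).
assert (Ha : 0 < a) by (apply Cmod_gt_0, H0).
assert (Hp : 0 < e * (a * a) / 2) 
  by (apply Rdiv_lt_0_compat; [repeat apply Rmult_lt_0_compat; assumption | lra]).
assert (Ha2 : 0 < a / 2) by lra.
generalize (filter_and _ _ (Hf _ Ha2) (Hf _ Hp)).
apply filter_imp; intros y [A B].
assert (Hy : a / 2 < Cmod (f y)).
{ assert (T1 : a <= Cmod (f y) + Cmod (- (f y - f x))).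
  { unfold a; replace (f x) with (f y + - (f y - f x))%C at 1 by ring; apply Cmod_triangle. }
  rewrite Cmod_opp in T1; lra. }
assert (Hy0 : f y <> RtoC 0) by (apply Cmod_gt_0; lra).
replace (/ f y - / f x)%C with (- (f y - f x) / (f y * f x))%C by (field; now split).
rewrite Cmod_div by now apply Cmult_neq_0.
rewrite Cmod_opp, Cmod_mult; fold a.
apply Rmult_lt_reg_r with (Cmod (f y) * a); [nra |].
unfold Rdiv; rewrite Rmult_assoc, Rinv_l, Rmult_1_r by nra.
nra.
Qed.

Lemma ccont_div f g x : g x <> RtoC 0 -> ccont f x -> ccont g x -> ccont (fun y => f y / g y)%C x.
Proof. intros H0 Hf Hg; apply ccont_mult; [exact Hf | now apply ccont_inv]. Qed.

Lemma ccont_comp (h : C -> C) f x :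
  ccont f x -> ccont (T := C_UniformSpace) h (f x) -> ccont (fun y => h (f y)) x.
Proof.
intros Hf Hh e He.
destruct (proj1 (locally_Cmod _ _) (Hh e He)) as [d [Hd H]].
generalize (Hf d Hd); apply filter_imp; intros y; apply H.
Qed.

Lemma ccont_pow f n x : ccont f x -> ccont (fun y => f y ^ n)%C x.
Proof.
intros Hf; induction n as [| n IH]; [exact (ccont_const (RtoC 1) x) |].
exact (ccont_mult f (fun y => f y ^ n)%C x Hf IH).
Qed.

Lemma ccont_Re f x : ccont f x -> continuous (fun y => Re (f y)) x.
Proof.
intros Hf; apply filterlim_locally; intros e.
generalize (Hf e (cond_pos e)); apply filter_imp; intros y Hy.
eapply Rle_lt_trans; [| exact Hy].
eapply Rle_trans; [| apply re_le_Cmod]; apply Req_le; reflexivity.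
Qed.

Lemma im_le_Cmod (c : C) : Rabs (Im c) <= Cmod c.
Proof. eapply Rle_trans; [apply Rmax_r | apply Rmax_Cmod]. Qed.

Lemma ccont_Im f x : ccont f x -> continuous (fun y => Im (f y)) x.
Proof.
intros Hf; apply filterlim_locally; intros e.
generalize (Hf e (cond_pos e)); apply filter_imp; intros y Hy.
eapply Rle_lt_trans; [| exact Hy].
eapply Rle_trans; [| apply im_le_Cmod]; apply Req_le; reflexivity.
Qed.

Lemma Cmod_le_abs (c : C) : Cmod c <= Rabs (Re c) + Rabs (Im c).
Proof.
destruct c as [a b]; simpl.
replace (a, b) with (RtoC a + Ci * RtoC b)%C.
- eapply Rle_trans; [apply Cmod_triangle |].
  rewrite Cmod_mult, Cmod_Ci, !Cmod_R; lra.
- unfold RtoC, Ci, Cmult, Cplus; simpl; f_equal; ring.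
Qed.

Lemma ccont_pair (u v : T -> R) x :
  continuous u x -> continuous v x -> ccont (fun y => (u y, v y) : C) x.
Proof.
intros Hu Hv e He.
assert (He2 : 0 < e / 2) by lra.
generalize (filter_and _ _ (proj1 (filterlim_locally _ _) Hu (mkposreal _ He2))
                           (proj1 (filterlim_locally _ _) Hv (mkposreal _ He2))).
apply filter_imp; intros y [A B].
eapply Rle_lt_trans; [apply Cmod_le_abs |].
change (Rabs (u y - u x) < e / 2) in A; change (Rabs (v y - v x) < e / 2) in B.
unfold Re, Im; simpl; unfold Rminus in *; lra.
Qed.

Lemma ccont_RtoC (u : T -> R) x : continuous u x -> ccont (fun y => RtoC (u y)) x.
Proof. intros Hu; apply ccont_pair; [exact Hu | apply continuous_const]. Qed.

Lemma ccont_Cmod f x : ccont f x -> continuous (fun y => Cmod (f y)) x.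
Proof.
intros Hf; apply filterlim_locally; intros e.
generalize (Hf e (cond_pos e)); apply filter_imp; intros y Hy.
change (Rabs (Cmod (f y) - Cmod (f x)) < e).
assert (A : Cmod (f y) <= Cmod (f x) + Cmod (f y - f x)).
{ replace (f y) with (f x + (f y - f x))%C at 1 by ring; apply Cmod_triangle. }
assert (B : Cmod (f x) <= Cmod (f y) + Cmod (- (f y - f x))).
{ replace (f x) with (f y + - (f y - f x))%C at 1 by ring; apply Cmod_triangle. }
rewrite Cmod_opp in B; apply Rabs_def1; lra.
Qed.

End Continuity.

Lemma ccont_id (z : C_UniformSpace) : ccont (fun y : C_UniformSpace => y : C) z.
Proof. intros e He; apply locally_Cmod; exists e; auto. Qed.

Definition cderiv (f : C -> C) (z l : C) : Prop :=
  forall eps, 0 < eps ->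
    locally z (fun y => Cmod (f y - f z - l * (y - z)) <= eps * Cmod (y - z)).

(** Caratheodory's form of the derivative: a slope continuous at z with value l there. The product
    and chain rules become algebra, and the slope is later the function with removed singularity to
    which the mean value theorem is applied. *)
Lemma cderiv_slope (f : C -> C) (z l : C) :
  cderiv f z l <->
  exists phi : C -> C, ccont (T := C_UniformSpace) phi z /\ phi z = l /\
    forall y, f y = (f z + phi y * (y - z))%C.
Proof.
split.
- intros H.
  exists (fun y => if Ceq_dec y z then l else ((f y - f z) / (y - z))%C).
  split; [| split].
  + intros e He.
    assert (He2 : 0 < e / 2) by lra.
  destruct (proj1 (locally_Cmod _ _) (H _ He2)) as [d [Hd L]].
    apply locally_Cmod; exists d; split; [exact Hd |]; intros y Hy.
    destruct (Ceq_dec z z) as [_ | N]; [| now destruct N].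
    destruct (Ceq_dec y z) as [E | N].
    * replace (l - l)%C with (RtoC 0) by ring; rewrite Cmod_0; exact He.
    * specialize (L y Hy).
      assert (N' : (y - z)%C <> RtoC 0).
      { intros E; apply N; replace y with (y - z + z)%C by ring; rewrite E; ring. }
      replace ((f y - f z) / (y - z) - l)%C with ((f y - f z - l * (y - z)) / (y - z))%C
        by (field; exact N').
      rewrite Cmod_div by exact N'.
      apply Cmod_gt_0 in N'.
      apply Rle_lt_trans with (e / 2); [| lra].
      apply Rmult_le_reg_r with (Cmod (y - z)); [exact N' |].
      unfold Rdiv at 1; rewrite Rmult_assoc, Rinv_l, Rmult_1_r by lra; exact L.
  + destruct (Ceq_dec z z) as [_ | N]; [reflexivity | now destruct N].
  + intros y; destruct (Ceq_dec y z) as [E | N]; [rewrite E; ring |].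
    field; intros E; apply N; replace y with (y - z + z)%C by ring; rewrite E; ring.
- intros [phi [H1 [H2 H3]]] e He.
  generalize (H1 e He); apply filter_imp; intros y Hy.
  rewrite (H3 y), <- H2.
  replace (f z + phi y * (y - z) - f z - phi z * (y - z))%C
    with ((phi y - phi z) * (y - z))%C by ring.
  rewrite Cmod_mult; apply Rmult_le_compat_r; [apply Cmod_ge_0 | now apply Rlt_le].
Qed.

Lemma cderiv_is_derive (f : C -> C) (z l : C) :
  cderiv f z l <-> is_derive (K := C_AbsRing) (V := C_NormedModule) f z l.
Proof.
assert (E : forall y, minus (G := C_NormedModule) (minus (G := C_NormedModule) (f y) (f z))
   (scal (V := C_NormedModule) (minus (G := C_NormedModule) y z) l) = (f y - f z - l * (y - z))%C).
{ intros y; unfold minus, plus, opp, scal; simpl; unfold mult; simpl; ring. }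
split.
- intros H; split; [apply is_linear_scal_l |].
  intros x Hx e.
  assert (Exz : z = x).
  { exact (is_filter_lim_locally_unique (K := C_AbsRing) (V := AbsRing_NormedModule C_AbsRing) _ _ Hx). }
  subst x.
  apply locally_C.
  generalize (H e (cond_pos e)); apply filter_imp; intros y Hy.
  rewrite E; exact Hy.
- intros [_ H] e He.
  specialize (H z (fun P HP => HP) (mkposreal e He)).
  apply locally_C in H; revert H; apply filter_imp; intros y Hy.
  rewrite E in Hy; exact Hy.
Qed.

Lemma cderiv_unique f z l1 l2 : cderiv f z l1 -> cderiv f z l2 -> l1 = l2.
Proof.
intros H1 H2; apply cderiv_is_derive, is_C_derive_unique in H1.
apply cderiv_is_derive, is_C_derive_unique in H2; congruence.
Qed.

Lemma cderiv_ext_loc f g z l :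
  locally (T := C_UniformSpace) z (fun y => f y = g y) -> cderiv f z l -> cderiv g z l.
Proof.
intros H Hf e He; specialize (Hf e He).
pose proof (locally_singleton _ _ H) as H0; simpl in H0.
generalize (filter_and _ _ H Hf); apply filter_imp.
intros y [E L]; rewrite <- E, <- H0; exact L.
Qed.

Lemma cderiv_ccont f z l : cderiv f z l -> ccont (T := C_UniformSpace) f z.
Proof.
intros H; apply cderiv_slope in H; destruct H as [phi [H1 [H2 H3]]].
apply ccont_ext_loc with (fun y : C_UniformSpace => f z + phi y * (y - z))%C.
{ apply filter_forall; intros y; symmetry; apply H3. }
apply ccont_plus; [apply ccont_const | apply ccont_mult; [exact H1 |]].
apply ccont_minus; [apply ccont_id | apply ccont_const].
Qed.

Lemma cderiv_eq f z l1 l2 : cderiv f z l1 -> l1 = l2 -> cderiv f z l2.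
Proof. intros H <-; exact H. Qed.

Lemma cderiv_const (c z : C) : cderiv (fun _ => c) z 0.
Proof.
apply cderiv_slope; exists (fun _ => RtoC 0); split; [apply ccont_const |].
split; [reflexivity | intros y; ring].
Qed.

Lemma cderiv_id (z : C) : cderiv (fun y => y) z 1.
Proof.
apply cderiv_slope; exists (fun _ => RtoC 1); split; [apply ccont_const |].
split; [reflexivity | intros y; ring].
Qed.

Lemma cderiv_plus f g z l m :
  cderiv f z l -> cderiv g z m -> cderiv (fun y => f y + g y)%C z (l + m).
Proof.
intros Hf Hg; apply cderiv_slope in Hf; apply cderiv_slope in Hg; apply cderiv_slope.
destruct Hf as [p [P1 [P2 P3]]]; destruct Hg as [q [Q1 [Q2 Q3]]].
exists (fun y => p y + q y)%C; split; [now apply ccont_plus | split].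
- now rewrite P2, Q2.
- intros y; rewrite (P3 y), (Q3 y); ring.
Qed.

Lemma cderiv_mult f g z l m :
  cderiv f z l -> cderiv g z m -> cderiv (fun y => f y * g y)%C z (l * g z + f z * m).
Proof.
intros Hf Hg; pose proof (cderiv_ccont _ _ _ Hg) as Cg.
apply cderiv_slope in Hf; apply cderiv_slope in Hg; apply cderiv_slope.
destruct Hf as [p [P1 [P2 P3]]]; destruct Hg as [q [Q1 [Q2 Q3]]].
exists (fun y => p y * g y + f z * q y)%C; split; [| split].
- apply ccont_plus; apply ccont_mult; trivial; apply ccont_const.
- now rewrite P2, Q2.
- intros y; rewrite (P3 y), (Q3 y); ring.
Qed.

Lemma cderiv_opp f z l : cderiv f z l -> cderiv (fun y => - f y)%C z (- l).
Proof.
intros Hf; apply cderiv_slope in Hf; apply cderiv_slope.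
destruct Hf as [p [P1 [P2 P3]]].
exists (fun y => - p y)%C; split; [now apply ccont_opp | split].
- now rewrite P2.
- intros y; rewrite (P3 y); ring.
Qed.

Lemma cderiv_minus f g z l m :
  cderiv f z l -> cderiv g z m -> cderiv (fun y => f y - g y)%C z (l - m).
Proof. intros Hf Hg; apply cderiv_plus; [exact Hf | now apply cderiv_opp]. Qed.

Lemma cderiv_comp f g z l m :
  cderiv g z m -> cderiv f (g z) l -> cderiv (fun y => f (g y)) z (l * m).
Proof.
intros Hg Hf; pose proof (cderiv_ccont _ _ _ Hg) as Cg.
apply cderiv_slope in Hf; apply cderiv_slope in Hg; apply cderiv_slope.
destruct Hf as [p [P1 [P2 P3]]]; destruct Hg as [q [Q1 [Q2 Q3]]].
exists (fun y => p (g y) * q y)%C; split; [| split].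
- apply ccont_mult; [| exact Q1].
  exact (ccont_comp p (T := C_UniformSpace) g z Cg P1).
- now rewrite P2, Q2.
- intros y; rewrite (P3 (g y)), (Q3 y); ring.
Qed.

Lemma Cdist_neq (y z : C) : y <> z -> (y - z)%C <> RtoC 0.
Proof. intros H E; apply H; replace y with (y - z + z)%C by ring; rewrite E; ring. Qed.

Lemma cderiv_Cinv z : z <> RtoC 0 -> cderiv Cinv z (- (/ z * / z)).
Proof.
intros Hz.
(* The identity 1/y = 1/z - (y - z)/(z y) exhibits the slope; it fails at y = 0, hence the passage
   to a neighbourhood of z. *)
apply cderiv_ext_loc with (fun y => / z + - (/ z * / y) * (y - z))%C.
- apply locally_Cmod; exists (Cmod z); split; [now apply Cmod_gt_0 |].
  intros y Hy.
  assert (y <> RtoC 0).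
  { intros E; rewrite E in Hy; replace (RtoC 0 - z)%C with (- z)%C in Hy by ring.
    rewrite Cmod_opp in Hy; lra. }
  now field.
- apply cderiv_slope; exists (fun y => - (/ z * / y))%C; split; [| split].
  + apply ccont_opp, ccont_mult; [apply ccont_const |].
    apply ccont_inv; [exact Hz | apply ccont_id].
  + reflexivity.
  + intros y; ring.
Qed.

Lemma cderiv_inv g z m : g z <> RtoC 0 -> cderiv g z m ->
  cderiv (fun y => / g y)%C z (- (m / (g z * g z))).
Proof.
intros H0 Hg; eapply cderiv_eq.
- exact (cderiv_comp Cinv g z _ m Hg (cderiv_Cinv _ H0)).
- now field.
Qed.

Lemma cderiv_div f g z l m : g z <> RtoC 0 -> cderiv f z l -> cderiv g z m ->
  cderiv (fun y => f y / g y)%C z ((l * g z - f z * m) / (g z * g z)).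
Proof.
intros H0 Hf Hg; eapply cderiv_eq.
- apply cderiv_mult; [exact Hf | apply (cderiv_inv g z m H0 Hg)].
- cbv beta; now field.
Qed.

Lemma cderiv_pow (n : nat) (z : C) :
  cderiv (fun y => y ^ n)%C z (match n with O => 0 | S m => INR n * z ^ m end)%C.
Proof.
induction n as [| n IH]; [exact (cderiv_const 1 z) |].
eapply cderiv_eq; [exact (cderiv_mult _ _ z _ _ (cderiv_id z) IH) |].
destruct n as [| n].
- simpl; ring.
- rewrite (S_INR (S n)), RtoC_plus; simpl (z ^ S n)%C; ring.
Qed.

Lemma cderiv_shift f a z l : cderiv f (a + z) l -> cderiv (fun y => f (a + y)%C) z l.
Proof.
intros H; eapply cderiv_eq.
- apply (cderiv_comp f (fun y => a + y)%C z l (0 + 1)); [| exact H].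
  apply cderiv_plus; [apply cderiv_const | apply cderiv_id].
- ring.
Qed.

(** * Goursat's lemma for rectangles *)

Definition CInt (f : R -> C) (a b : R) : C :=
  (RInt (fun t => Re (f t)) a b, RInt (fun t => Im (f t)) a b).

Definition cont_on (f : R -> C) (a b : R) : Prop :=
  forall t, a <= t <= b -> ccont (T := R_UniformSpace) f t.

Lemma cont_on_Re f a b : a <= b -> cont_on f a b -> ex_RInt (fun t => Re (f t)) a b.
Proof.
intros Hab H; apply (ex_RInt_continuous (V := R_CompleteNormedModule)).
intros t; rewrite Rmin_left, Rmax_right by exact Hab; intros Ht.
apply (ccont_Re (T := R_UniformSpace)), H, Ht.
Qed.

Lemma cont_on_Im f a b : a <= b -> cont_on f a b -> ex_RInt (fun t => Im (f t)) a b.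
Proof.
intros Hab H; apply (ex_RInt_continuous (V := R_CompleteNormedModule)).
intros t; rewrite Rmin_left, Rmax_right by exact Hab; intros Ht.
apply (ccont_Im (T := R_UniformSpace)), H, Ht.
Qed.

Lemma CInt_ext f g a b : a <= b -> (forall t, a <= t <= b -> f t = g t) -> CInt f a b = CInt g a b.
Proof.
intros Hab H; unfold CInt; f_equal; apply RInt_ext;
  rewrite Rmin_left, Rmax_right by exact Hab; intros t Ht; rewrite H by lra; reflexivity.
Qed.

Lemma CInt_plus f g a b : a <= b -> cont_on f a b -> cont_on g a b ->
  CInt (fun t => f t + g t)%C a b = (CInt f a b + CInt g a b)%C.
Proof.
intros Hab Hf Hg; unfold CInt, Cplus; simpl; f_equal.
- apply (RInt_plus (V := R_CompleteNormedModule)); now apply cont_on_Re.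
- apply (RInt_plus (V := R_CompleteNormedModule)); now apply cont_on_Im.
Qed.

Lemma CInt_scal (c : C) f a b : a <= b -> cont_on f a b ->
  CInt (fun t => c * f t)%C a b = (c * CInt f a b)%C.
Proof.
intros Hab Hf.
pose proof (cont_on_Re f a b Hab Hf) as H1; pose proof (cont_on_Im f a b Hab Hf) as H2.
unfold CInt, Cmult; simpl; f_equal.
- transitivity (minus (scal (fst c) (RInt (fun t => Re (f t)) a b))
                      (scal (snd c) (RInt (fun t => Im (f t)) a b))); [| reflexivity].
  rewrite <- !(RInt_scal (V := R_CompleteNormedModule)) by assumption.
  rewrite <- (RInt_minus (V := R_CompleteNormedModule))
    by (apply (ex_RInt_scal (V := R_NormedModule)); assumption).
  reflexivity.
- transitivity (plus (scal (fst c) (RInt (fun t => Im (f t)) a b))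
                      (scal (snd c) (RInt (fun t => Re (f t)) a b))); [| reflexivity].
  rewrite <- !(RInt_scal (V := R_CompleteNormedModule)) by assumption.
  rewrite <- (RInt_plus (V := R_CompleteNormedModule))
    by (apply (ex_RInt_scal (V := R_NormedModule)); assumption).
  reflexivity.
Qed.

Lemma CInt_minus f g a b : a <= b -> cont_on f a b -> cont_on g a b ->
  CInt (fun t => f t - g t)%C a b = (CInt f a b - CInt g a b)%C.
Proof.
intros Hab Hf Hg; unfold CInt, Cminus, Cplus, Copp; simpl; f_equal.
- apply (RInt_minus (V := R_CompleteNormedModule)); now apply cont_on_Re.
- apply (RInt_minus (V := R_CompleteNormedModule)); now apply cont_on_Im.
Qed.

Lemma CInt_const (c : C) a b : CInt (fun _ => c) a b = (c * RtoC (b - a))%C.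
Proof.
unfold CInt; rewrite !RInt_const.
unfold scal, Cmult, RtoC; simpl; unfold mult; simpl; f_equal; unfold Re, Im; ring.
Qed.

Lemma CInt_Chasles f a m b : a <= m <= b -> cont_on f a b ->
  CInt f a b = (CInt f a m + CInt f m b)%C.
Proof.
intros Hm Hf.
assert (H1 : cont_on f a m) by (intros t Ht; apply Hf; lra).
assert (H2 : cont_on f m b) by (intros t Ht; apply Hf; lra).
unfold CInt, Cplus; simpl; f_equal; symmetry; apply (RInt_Chasles (V := R_CompleteNormedModule)).
- apply cont_on_Re; [lra | exact H1].
- apply cont_on_Re; [lra | exact H2].
- apply cont_on_Im; [lra | exact H1].
- apply cont_on_Im; [lra | exact H2].
Qed.

(** The factor 2 comes from estimating the real and imaginary parts separately. It is harmless
    wherever only the order of magnitude counts. *)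
Lemma CInt_bound f a b M : a <= b -> cont_on f a b -> (forall t, a <= t <= b -> Cmod (f t) <= M) ->
  Cmod (CInt f a b) <= 2 * M * (b - a).
Proof.
intros Hab Hf HM; eapply Rle_trans; [apply Cmod_le_abs |].
unfold CInt; simpl.
assert (H1 : Rabs (RInt (fun t => Re (f t)) a b) <= (b - a) * M).
{ apply abs_RInt_le_const; [exact Hab | now apply cont_on_Re |].
  intros t Ht; eapply Rle_trans; [apply re_le_Cmod | now apply HM]. }
assert (H2 : Rabs (RInt (fun t => Im (f t)) a b) <= (b - a) * M).
{ apply abs_RInt_le_const; [exact Hab | now apply cont_on_Im |].
  intros t Ht; eapply Rle_trans; [apply im_le_Cmod | now apply HM]. }
lra.
Qed.

Lemma CInt_RtoC a b : CInt RtoC a b = RtoC ((b * b - a * a) / 2).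
Proof.
unfold CInt, RtoC; simpl; f_equal.
- apply is_RInt_unique.
  replace ((b * b - a * a) / 2) with (minus (b * b / 2) (a * a / 2))
    by (unfold minus, plus, opp; simpl; field).
  apply (is_RInt_derive (fun x => x * x / 2) (fun x => x)).
  + intros x _; auto_derive; [trivial | field].
  + intros x _; apply continuous_id.
- rewrite RInt_const; unfold scal; simpl; unfold mult; simpl; ring.
Qed.

(** The contour integral of G dz along the boundary of [a, b] x [c, d], counterclockwise; dz = i dy
    accounts for [Ci] on the vertical sides. *)
Definition rect_int (G : C -> C) (a b c d : R) : C :=
  (CInt (fun x => G (x, c)) a b - CInt (fun x => G (x, d)) a b
   + Ci * (CInt (fun y => G (b, y)) c d - CInt (fun y => G (a, y)) c d))%C.

(** The combinatorial half of Goursat's argument. Some quarter always carries a quarter of the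
    modulus; iterating, the rectangles shrink to a point (p, q) with |J| <= 4^n |J_n|. The local
    hypothesis at (p, q) gives |J_n| <= eps (w / 2^n)^2, with w half the perimeter, so the powers of
    4 cancel and |J| <= eps w^2. *)
Lemma bisection_zero (J : R -> R -> R -> R -> C) (a b c d : R) :
  a <= b -> c <= d ->
  (forall a' b' c' d', a <= a' <= b' -> b' <= b -> c <= c' <= d' -> d' <= d ->
     let m := (a' + b') / 2 in let n := (c' + d') / 2 in
     J a' b' c' d' = (J a' m c' n + J m b' c' n + (J a' m n d' + J m b' n d'))%C) ->
  (forall p q, a <= p <= b -> c <= q <= d -> forall eps, 0 < eps ->
     exists del, 0 < del /\ forall a' b' c' d',
       a <= a' <= p -> p <= b' <= b -> c <= c' <= q -> q <= d' <= d ->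
       b' - a' < del -> d' - c' < del ->
       Cmod (J a' b' c' d') <= eps * (b' - a' + (d' - c')) ^ 2) ->
  J a b c d = RtoC 0.
Proof.
intros Hab Hcd Hadd Hloc.
(* The last quarter needs no test: if the first three fall short, the triangle inequality gives it
   the required share. *)
set (step := fun R : (R * R) * (R * R) =>
  let '((a', b'), (c', d')) := R in
  let m := (a' + b') / 2 in let n := (c' + d') / 2 in
  let t := Cmod (J a' b' c' d') / 4 in
  if Rle_dec t (Cmod (J a' m c' n)) then ((a', m), (c', n))
  else if Rle_dec t (Cmod (J m b' c' n)) then ((m, b'), (c', n))
  else if Rle_dec t (Cmod (J a' m n d')) then ((a', m), (n, d'))
  else ((m, b'), (n, d'))).
set (Q := fix Q n := match n with O => ((a, b), (c, d)) | S k => step (Q k) end).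
set (A := fun n => fst (fst (Q n))); set (B := fun n => snd (fst (Q n))).
set (X := fun n => fst (snd (Q n))); set (Y := fun n => snd (snd (Q n))).
assert (HS : forall n, a <= A n <= B n -> B n <= b -> c <= X n <= Y n -> Y n <= d ->
   (A n <= A (S n) /\ B (S n) <= B n /\ B (S n) - A (S n) = (B n - A n) / 2 /\
    X n <= X (S n) /\ Y (S n) <= Y n /\ Y (S n) - X (S n) = (Y n - X n) / 2) /\
    Cmod (J (A n) (B n) (X n) (Y n)) <= 4 * Cmod (J (A (S n)) (B (S n)) (X (S n)) (Y (S n)))).
{ intros n; unfold A, B, X, Y; change (Q (S n)) with (step (Q n)).
  destruct (Q n) as [[a' b'] [c' d']]; simpl; intros H1 H2 H3 H4.
  specialize (Hadd a' b' c' d' H1 H2 H3 H4); simpl in Hadd.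
  repeat match goal with |- context [Rle_dec ?u ?v] => destruct (Rle_dec u v) end;
    simpl; split; try (repeat split; lra); try lra.
  rewrite Hadd at 1.
  assert (T : Cmod (J a' b' c' d') <=
    Cmod (J a' ((a' + b') / 2) c' ((c' + d') / 2)) + Cmod (J ((a' + b') / 2) b' c' ((c' + d') / 2)) +
    (Cmod (J a' ((a' + b') / 2) ((c' + d') / 2) d') + Cmod (J ((a' + b') / 2) b' ((c' + d') / 2) d'))).
  { rewrite Hadd at 1; eapply Rle_trans; [apply Cmod_triangle |].
    apply Rplus_le_compat; apply Cmod_triangle. }
  rewrite <- Hadd; lra. }
assert (HI : forall n, a <= A n <= B n /\ B n <= b /\ c <= X n <= Y n /\ Y n <= d).
{ induction n as [| n [H1 [H2 [H3 H4]]]].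
  - unfold A, B, X, Y; simpl; lra.
  - destruct (HS n H1 H2 H3 H4) as [H5 _]; lra. }
assert (HW : forall n, B n - A n = (b - a) * (/ 2) ^ n /\ Y n - X n = (d - c) * (/ 2) ^ n /\
   Cmod (J a b c d) <= 4 ^ n * Cmod (J (A n) (B n) (X n) (Y n))).
{ induction n as [| n [I1 [I2 I3]]].
  - unfold A, B, X, Y; simpl; lra.
  - destruct (HI n) as [H1 [H2 [H3 H4]]]; destruct (HS n H1 H2 H3 H4) as [H5 H6].
    assert (0 < 4 ^ n) by (apply pow_lt; lra).
    simpl; repeat split; [lra | lra |]. nra. }
assert (Hmon : forall (U V : nat -> R),
   (forall n, U n <= U (S n) /\ V (S n) <= V n /\ U n <= V n) ->
   exists p, forall n, U n <= p <= V n).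
{ intros U V H.
  assert (Hu : forall n k, U n <= U (n + k)%nat).
  { intros n k; induction k as [| k IH]; [rewrite Nat.add_0_r; lra |].
    rewrite Nat.add_succ_r; destruct (H (n + k)%nat); lra. }
  assert (Hv : forall n k, V (n + k)%nat <= V n).
  { intros n k; induction k as [| k IH]; [rewrite Nat.add_0_r; lra |].
    rewrite Nat.add_succ_r; destruct (H (n + k)%nat); lra. }
  assert (Huv : forall n k, U n <= V k).
  { intros n k; specialize (Hu n k); specialize (Hv k n); rewrite Nat.add_comm in Hv.
    destruct (H (n + k)%nat); lra. }
  destruct (completeness (fun x => exists n, x = U n)) as [p [P1 P2]].
  - exists (V O); intros x [n ->]; apply Huv.
  - exists (U O); now exists O.
  - exists p; intros n; split; [apply P1; now exists n |].
    apply P2; intros x [k ->]; apply Huv. }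
destruct (Hmon A B) as [p Hp].
{ intros n; destruct (HI n) as [H1 [H2 [H3 H4]]]; destruct (HS n H1 H2 H3 H4) as [H5 _]; lra. }
destruct (Hmon X Y) as [q Hq].
{ intros n; destruct (HI n) as [H1 [H2 [H3 H4]]]; destruct (HS n H1 H2 H3 H4) as [H5 _]; lra. }
apply Cmod_eq_0.
destruct (Rle_lt_or_eq_dec 0 _ (Cmod_ge_0 (J a b c d))) as [Hpos | E]; [exfalso | now symmetry].
set (w := b - a + (d - c)).
assert (Hw : 0 <= w) by (unfold w; lra).
(* Chosen so that eps w^2 < |J|; adding 1 to w^2 covers the degenerate rectangle w = 0. *)
set (eps := Cmod (J a b c d) / (2 * (1 + w ^ 2))).
assert (Hw2 : 0 <= w ^ 2) by (apply pow2_ge_0).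
assert (Heps : 0 < eps) by (apply Rdiv_lt_0_compat; lra).
destruct (Hloc p q) with (eps := eps) as [del [Hdel Hl]]; [| | exact Heps |].
{ specialize (Hp O); unfold A, B in Hp; simpl in Hp; lra. }
{ specialize (Hq O); unfold X, Y in Hq; simpl in Hq; lra. }
destruct (pow_lt_1_zero (/ 2) ltac:(rewrite Rabs_pos_eq; lra) (del / (1 + w))) as [N HN].
{ apply Rdiv_lt_0_compat; lra. }
specialize (HN N (le_n N)).
assert (H2N : 0 < (/ 2) ^ N) by (apply pow_lt; lra).
rewrite Rabs_pos_eq in HN by lra.
assert (HN' : (1 + w) * (/ 2) ^ N < del).
{ apply Rmult_lt_reg_r with (/ (1 + w)); [apply Rinv_0_lt_compat; lra |].
  replace ((1 + w) * (/ 2) ^ N * / (1 + w)) with ((/ 2) ^ N) by (field; lra).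
  exact HN. }
destruct (HI N) as [H1 [H2 [H3 H4]]]; destruct (HW N) as [W1 [W2 W3]].
specialize (Hp N); specialize (Hq N).
assert (L : Cmod (J (A N) (B N) (X N) (Y N)) <= eps * (B N - A N + (Y N - X N)) ^ 2).
{ apply Hl; try lra; unfold w in HN'; nra. }
assert (E4 : 4 ^ N * (B N - A N + (Y N - X N)) ^ 2 = w ^ 2).
{ rewrite W1, W2.
  replace ((b - a) * (/ 2) ^ N + (d - c) * (/ 2) ^ N) with (w * (/ 2) ^ N) by (unfold w; ring).
  rewrite Rpow_mult_distr, <- (pow_mult (/ 2)), (Nat.mul_comm N), pow_mult.
  replace (4 ^ N * (w ^ 2 * ((/ 2) ^ 2) ^ N)) with (w ^ 2 * (4 ^ N * ((/ 2) ^ 2) ^ N)) by ring.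
  rewrite <- Rpow_mult_distr; replace (4 * (/ 2) ^ 2) with 1 by field.
  rewrite pow1; ring. }
assert (P4 : 0 < 4 ^ N) by (apply pow_lt; lra).
assert (F : Cmod (J a b c d) <= eps * w ^ 2).
{ rewrite <- E4; apply Rle_trans with (1 := W3); nra. }
assert (G : eps * (2 * (1 + w ^ 2)) = Cmod (J a b c d)) by (unfold eps; field; lra).
nra.
Qed.

Lemma ccont_horizontal (G : C -> C) (x y : R) : ccont (T := C_UniformSpace) G (x, y) ->
  ccont (T := R_UniformSpace) (fun t => G (t, y)) x.
Proof.
intros H; apply (ccont_comp G (T := R_UniformSpace) (fun t => (t, y)) x); [| exact H].
apply (ccont_pair (T := R_UniformSpace)); [apply continuous_id | apply continuous_const].
Qed.

Lemma ccont_vertical (G : C -> C) (x y : R) : ccont (T := C_UniformSpace) G (x, y) ->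
  ccont (T := R_UniformSpace) (fun t => G (x, t)) y.
Proof.
intros H; apply (ccont_comp G (T := R_UniformSpace) (fun t => (x, t)) y); [| exact H].
apply (ccont_pair (T := R_UniformSpace)); [apply continuous_const | apply continuous_id].
Qed.

Definition cont_rect (G : C -> C) (a b c d : R) : Prop :=
  forall x y, a <= x <= b -> c <= y <= d -> ccont (T := C_UniformSpace) G (x, y).

Lemma cont_rect_horizontal G a b c d y : cont_rect G a b c d -> c <= y <= d ->
  cont_on (fun x => G (x, y)) a b.
Proof. intros H Hy x Hx; apply ccont_horizontal; auto. Qed.

Lemma cont_rect_vertical G a b c d x : cont_rect G a b c d -> a <= x <= b ->
  cont_on (fun y => G (x, y)) c d.
Proof. intros H Hy y Hx; apply ccont_vertical; auto. Qed.

Lemma rect_int_split G a m b c n d : cont_rect G a b c d ->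
  a <= m <= b -> c <= n <= d ->
  rect_int G a b c d = (rect_int G a m c n + rect_int G m b c n
    + (rect_int G a m n d + rect_int G m b n d))%C.
Proof.
intros H Hm Hn; unfold rect_int.
rewrite (CInt_Chasles (fun x => G (x, c)) a m b), (CInt_Chasles (fun x => G (x, d)) a m b),
  (CInt_Chasles (fun y => G (a, y)) c n d), (CInt_Chasles (fun y => G (b, y)) c n d);
  try assumption;
  try (apply (cont_rect_horizontal G a b c d); [exact H | lra]);
  try (apply (cont_rect_vertical G a b c d); [exact H | lra]).
ring.
Qed.

Lemma rect_int_minus F G a b c d : a <= b -> c <= d -> cont_rect F a b c d -> cont_rect G a b c d ->
  rect_int (fun z => F z - G z)%C a b c d = (rect_int F a b c d - rect_int G a b c d)%C.
Proof.
intros Hab Hcd HF HG; unfold rect_int.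
rewrite (CInt_minus (fun x => F (x, c)) (fun x => G (x, c))),
  (CInt_minus (fun x => F (x, d)) (fun x => G (x, d))),
  (CInt_minus (fun y => F (a, y)) (fun y => G (a, y))),
  (CInt_minus (fun y => F (b, y)) (fun y => G (b, y))); try assumption;
  try (apply (cont_rect_horizontal _ a b c d); [assumption | lra]);
  try (apply (cont_rect_vertical _ a b c d); [assumption | lra]).
ring.
Qed.

Lemma pair_C (x y : R) : ((x, y) : C) = (RtoC x + Ci * RtoC y)%C.
Proof. unfold RtoC, Ci, Cmult, Cplus; simpl; f_equal; ring. Qed.

Lemma Ci_mult_Ci : (Ci * Ci)%C = (- (1))%C.
Proof. unfold Ci, Cmult, Copp, RtoC; simpl; f_equal; ring. Qed.

Lemma rect_int_affine (A B : C) a b c d : a <= b -> c <= d ->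
  rect_int (fun z => A + B * z)%C a b c d = RtoC 0.
Proof.
intros Hab Hcd.
assert (HR : forall u v, cont_on RtoC u v).
{ intros u v t _; apply (ccont_RtoC (T := R_UniformSpace)), continuous_id. }
assert (Hh : forall (K L : C) u v, u <= v ->
   CInt (fun t => K + L * RtoC t)%C u v = (K * RtoC (v - u) + L * RtoC ((v * v - u * u) / 2))%C).
{ intros K L u v Huv.
  rewrite CInt_plus, CInt_const, CInt_scal, CInt_RtoC; trivial.
  - intros t _; apply ccont_const.
  - intros t Ht; apply ccont_mult; [apply ccont_const | now apply (HR u v)]. }
unfold rect_int.
rewrite (CInt_ext (fun x => A + B * (x, c))%C (fun x => (A + B * Ci * RtoC c) + B * RtoC x)%C),
 (CInt_ext (fun x => A + B * (x, d))%C (fun x => (A + B * Ci * RtoC d) + B * RtoC x)%C),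
 (CInt_ext (fun y => A + B * (a, y))%C (fun y => (A + B * RtoC a) + B * Ci * RtoC y)%C),
 (CInt_ext (fun y => A + B * (b, y))%C (fun y => (A + B * RtoC b) + B * Ci * RtoC y)%C);
 try assumption; try (intros t _; rewrite pair_C; ring).
rewrite !Hh by assumption.
rewrite !RtoC_minus.
ring.
Qed.

Lemma rect_int_bound G a b c d M : a <= b -> c <= d -> cont_rect G a b c d ->
  (forall x y, a <= x <= b -> c <= y <= d -> Cmod (G (x, y)) <= M) ->
  Cmod (rect_int G a b c d) <= 4 * M * (b - a + (d - c)).
Proof.
intros Hab Hcd HG HM; unfold rect_int.
assert (H1 : forall y, c <= y <= d -> Cmod (CInt (fun x => G (x, y)) a b) <= 2 * M * (b - a)).
{ intros y Hy; apply CInt_bound; [exact Hab | now apply (cont_rect_horizontal G a b c d) |].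
  intros t Ht; now apply HM. }
assert (H2 : forall x, a <= x <= b -> Cmod (CInt (fun y => G (x, y)) c d) <= 2 * M * (d - c)).
{ intros y Hy; apply CInt_bound; [exact Hcd | now apply (cont_rect_vertical G a b c d) |].
  intros t Ht; now apply HM. }
pose proof (H1 c ltac:(lra)); pose proof (H1 d ltac:(lra)).
pose proof (H2 a ltac:(lra)); pose proof (H2 b ltac:(lra)).
eapply Rle_trans; [apply Cmod_triangle |].
rewrite Cmod_mult, Cmod_Ci; unfold Cminus.
pose proof (Cmod_triangle (CInt (fun x => G (x, c)) a b) (- CInt (fun x => G (x, d)) a b)) as T1.
pose proof (Cmod_triangle (CInt (fun y => G (b, y)) c d) (- CInt (fun y => G (a, y)) c d)) as T2.
rewrite Cmod_opp in T1, T2; lra.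
Qed.

Theorem goursat (G : C -> C) (a b c d : R) : a <= b -> c <= d ->
  (forall x y, a <= x <= b -> c <= y <= d -> exists l, cderiv G (x, y) l) ->
  rect_int G a b c d = RtoC 0.
Proof.
intros Hab Hcd HG.
assert (Hc : cont_rect G a b c d).
{ intros x y Hx Hy; destruct (HG x y Hx Hy) as [l Hl]; exact (cderiv_ccont _ _ _ Hl). }
apply (bisection_zero (rect_int G) a b c d Hab Hcd).
- intros a' b' c' d' H1 H2 H3 H4 m n; apply rect_int_split; try (unfold m, n; lra).
  intros x y Hx Hy; apply Hc; lra.
- intros p q Hp Hq eps Heps.
  destruct (HG p q Hp Hq) as [l Hl].
  assert (He : 0 < eps / 4) by lra.
  destruct (proj1 (locally_Cmod _ _) (Hl _ He)) as [del [Hdel Hd]].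
  exists (del / 2); split; [lra |].
  intros a' b' c' d' Ha' Hb' Hc' Hd' Hab' Hcd'.
  set (z := (p, q) : C).
  assert (Hin : cont_rect G a' b' c' d') by (intros x y Hx Hy; apply Hc; lra).
  assert (Haff : cont_rect (fun w => G z - l * z + l * w)%C a' b' c' d').
  { intros x y _ _; apply ccont_plus; [apply ccont_const |].
    apply ccont_mult; [apply ccont_const | apply ccont_id]. }
  (* The first-order Taylor polynomial at z integrates to 0. What is left is at most (eps / 4) |w -
     z|, and |w - z| is at most half the perimeter; the 4 cancels against the constant of
     [rect_int_bound]. *)
  replace (rect_int G a' b' c' d')
    with (rect_int (fun w => G w - (G z - l * z + l * w))%C a' b' c' d').
  2:{ rewrite rect_int_minus, rect_int_affine by (assumption || lra); ring. }
  replace (eps * (b' - a' + (d' - c')) ^ 2)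
    with (4 * (eps / 4 * (b' - a' + (d' - c'))) * (b' - a' + (d' - c'))) by field.
  apply rect_int_bound; try lra.
  + intros x y Hx Hy; apply ccont_minus; [now apply Hin | now apply Haff].
  + intros x y Hx Hy.
    assert (D : Cmod ((x, y) - z)%C <= b' - a' + (d' - c')).
    { eapply Rle_trans; [apply Cmod_le_abs |]; unfold z; simpl.
      apply Rplus_le_compat; apply Rabs_le; lra. }
    replace (G (x, y) - (G z - l * z + l * (x, y)))%C
      with (G (x, y) - G z - l * ((x, y) - z))%C by ring.
    eapply Rle_trans; [apply Hd; fold z; lra |]; fold z.
    apply Rmult_le_compat_l; lra.
Qed.

(** * Circular means *)

Lemma exp_le_mono (x y : R) : x <= y -> exp x <= exp y.
Proof. intros [H | ->]; [apply Rlt_le, exp_increasing, H | apply Rle_refl]. Qed.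

Lemma Cexp_plus (z w : C) : Cexp (z + w) = (Cexp z * Cexp w)%C.
Proof.
destruct z as [a b], w as [c d]; unfold Cexp, Cmult; simpl.
rewrite exp_plus, cos_plus, sin_plus; f_equal; ring.
Qed.

Lemma Cexp_0 : Cexp 0 = RtoC 1.
Proof. unfold Cexp, RtoC; simpl; rewrite exp_0, cos_0, sin_0; f_equal; ring. Qed.

Lemma Cmod_Cexp (z : C) : Cmod (Cexp z) = exp (Re z).
Proof.
unfold Cmod, Cexp; simpl.
replace (_ + _) with (Rsqr (exp (Re z)) * (Rsqr (sin (Im z)) + Rsqr (cos (Im z))))
  by (unfold Rsqr; ring).
rewrite sin2_cos2, Rmult_1_r; apply sqrt_Rsqr, Rlt_le, exp_pos.
Qed.

Lemma Cexp_neq_0 (z : C) : Cexp z <> RtoC 0.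
Proof. apply Cmod_gt_0; rewrite Cmod_Cexp; apply exp_pos. Qed.

Lemma cderiv_Cexp_0 : cderiv Cexp 0 1.
Proof.
assert (D : forall (f : R -> R) l, is_derive f 0 l -> forall eps, 0 < eps ->
   exists d, 0 < d /\ forall x, Rabs x < d -> Rabs (f x - f 0 - l * x) <= eps * Rabs x).
{ intros f l Hf eps He; apply is_derive_Reals in Hf.
  destruct (Hf eps He) as [d Hd]; exists d; split; [apply cond_pos |]; intros x Hx.
  destruct (Req_dec x 0) as [-> | N].
  - replace (f 0 - f 0 - l * 0) with 0 by ring; rewrite Rabs_R0; lra.
  - specialize (Hd x N Hx); rewrite Rplus_0_l in Hd.
    replace (f x - f 0 - l * x) with (((f x - f 0) / x - l) * x) by (field; exact N).
    rewrite Rabs_mult; apply Rmult_le_compat_r; [apply Rabs_pos | lra]. }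
intros eps He.
(* The errors add up to 9 e m: e m + 3 e m in the real part and 3 e m + 2 e m in the imaginary part,
   using |exp x| <= 3 and |exp x - 1| <= 2 m. *)
set (e := Rmin 1 (eps / 9)).
assert (He0 : 0 < e) by (apply Rmin_glb_lt; lra).
assert (He1 : e <= 1) by apply Rmin_l.
assert (He2 : e <= eps / 9) by apply Rmin_r.
destruct (D exp 1 ltac:(auto_derive; [trivial | rewrite exp_0; ring]) e He0) as [d1 [P1 D1]].
destruct (D cos 0 ltac:(auto_derive; [trivial | rewrite sin_0; ring]) e He0) as [d2 [P2 D2]].
destruct (D sin 1 ltac:(auto_derive; [trivial | rewrite cos_0; ring]) e He0) as [d3 [P3 D3]].
apply locally_Cmod; exists (Rmin (Rmin d1 d2) (Rmin d3 e)); split.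
{ apply Rmin_glb_lt; apply Rmin_glb_lt; assumption. }
intros z; replace (z - 0)%C with z by ring; destruct z as [x y]; intros H.
apply Rmin_Rgt in H; destruct H as [H H']; apply Rmin_Rgt in H; apply Rmin_Rgt in H'.
destruct H as [M1 M2], H' as [M3 M4].
set (m := Cmod (x, y)) in *.
assert (Hx : Rabs x <= m) by exact (re_le_Cmod (x, y)).
assert (Hy : Rabs y <= m) by exact (im_le_Cmod (x, y)).
specialize (D1 x ltac:(lra)); specialize (D2 y ltac:(lra)); specialize (D3 y ltac:(lra)).
rewrite exp_0 in D1; rewrite cos_0 in D2; rewrite sin_0 in D3.
eapply Rle_trans; [apply Cmod_le_abs |].
unfold Cexp, RtoC; simpl.
replace (exp x * cos y + - (exp 0 * cos 0) + - (1 * x - 0 * y))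
  with ((exp x - 1 - 1 * x) + exp x * (cos y - 1 - 0 * y)) by (rewrite exp_0, cos_0; ring).
replace (exp x * sin y + - (exp 0 * sin 0) + - (1 * y + 0 * x))
  with (exp x * (sin y - 0 - 1 * y) + (exp x - 1) * y) by (rewrite sin_0; ring).
assert (Hex : e * Rabs x <= 1 * Rabs x) by (apply Rmult_le_compat_r; [apply Rabs_pos | lra]).
assert (E1 : Rabs (exp x - 1) <= 2 * m).
{ replace (exp x - 1) with ((exp x - 1 - 1 * x) + x) by ring.
  eapply Rle_trans; [apply Rabs_triang |]; lra. }
assert (E2 : Rabs (exp x) <= 3).
{ replace (exp x) with ((exp x - 1) + 1) by ring.
  eapply Rle_trans; [apply Rabs_triang |]; rewrite Rabs_R1; lra. }
assert (Hm : 0 <= m) by apply Cmod_ge_0.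
pose proof (Rabs_pos (exp x)); pose proof (Rabs_pos y); pose proof (Rabs_pos (exp x - 1)).
pose proof (Rabs_pos (cos y - 1 - 0 * y)); pose proof (Rabs_pos (sin y - 0 - 1 * y)).
assert (F1 : Rabs (exp x - 1 - 1 * x) <= e * m)
  by (eapply Rle_trans; [eassumption | apply Rmult_le_compat_l; lra]).
assert (F2 : Rabs (cos y - 1 - 0 * y) <= e * m)
  by (eapply Rle_trans; [eassumption | apply Rmult_le_compat_l; lra]).
assert (F3 : Rabs (sin y - 0 - 1 * y) <= e * m)
  by (eapply Rle_trans; [eassumption | apply Rmult_le_compat_l; lra]).
pose proof (Rabs_triang (exp x - 1 - 1 * x) (exp x * (cos y - 1 - 0 * y))) as T1.
pose proof (Rabs_triang (exp x * (sin y - 0 - 1 * y)) ((exp x - 1) * y)) as T2.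
rewrite Rabs_mult in T1; rewrite !Rabs_mult in T2.
assert (G1 : Rabs (exp x) * Rabs (cos y - 1 - 0 * y) <= 3 * (e * m))
  by (apply Rmult_le_compat; lra).
assert (G2 : Rabs (exp x) * Rabs (sin y - 0 - 1 * y) <= 3 * (e * m))
  by (apply Rmult_le_compat; lra).
assert (G3 : Rabs (exp x - 1) * Rabs y <= 2 * m * e) by (apply Rmult_le_compat; lra).
assert (G4 : e * m <= eps / 9 * m) by (apply Rmult_le_compat_r; assumption).
lra.
Qed.

Lemma cderiv_Cexp (z : C) : cderiv Cexp z (Cexp z).
Proof.
apply cderiv_ext_loc with (fun y => Cexp z * Cexp (- z + y))%C.
{ apply filter_forall; intros y; rewrite <- Cexp_plus; f_equal; ring. }
eapply cderiv_eq.
- apply cderiv_mult; [apply cderiv_const |].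
  apply cderiv_shift; replace (- z + z)%C with (RtoC 0) by ring; apply cderiv_Cexp_0.
- simpl; ring.
Qed.

Definition circ (r t : R) : C := (r * cos t, r * sin t).

Lemma Cmod_circ r t : 0 <= r -> Cmod (circ r t) = r.
Proof.
intros Hr; unfold Cmod, circ; simpl.
replace (_ + _) with (Rsqr r * (Rsqr (sin t) + Rsqr (cos t))) by (unfold Rsqr; ring).
rewrite sin2_cos2, Rmult_1_r; now apply sqrt_Rsqr.
Qed.

Lemma circ_exp r t : 0 < r -> circ r t = Cexp (ln r, t).
Proof. intros Hr; unfold circ, Cexp; simpl; now rewrite exp_ln. Qed.

Lemma circ_scal r t : circ r t = (RtoC r * circ 1 t)%C.
Proof. unfold circ, Cmult; simpl; f_equal; ring. Qed.

Lemma ccont_circ r t : ccont (T := R_UniformSpace) (circ r) t.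
Proof.
apply (ccont_pair (T := R_UniformSpace)).
- apply (ex_derive_continuous (V := R_NormedModule)); auto_derive; trivial.
- apply (ex_derive_continuous (V := R_NormedModule)); auto_derive; trivial.
Qed.

Lemma cont_on_circ (k : C -> C) r a b :
  (forall u, Cmod u = Rabs r -> ccont (T := C_UniformSpace) k u) ->
  cont_on (fun t => k (circ r t)) a b.
Proof.
intros H t _; apply (ccont_comp k (T := R_UniformSpace) (circ r) t (ccont_circ r t)), H.
rewrite circ_scal, Cmod_mult, Cmod_circ, Cmod_R by lra; ring.
Qed.

(** Since du = i u dt on the circle, this is the contour integral of k(u) du / (2 pi i u). Cauchy's
    kernel therefore appears as u / (u - z), and the k-th Taylor coefficient as the mean of h(u) /
    u^k. *)
Definition Cmean (k : C -> C) (r : R) : C :=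
  (RtoC (/ (2 * PI)) * CInt (fun t => k (circ r t)) 0 (2 * PI))%C.

Lemma two_PI_pos : 0 < 2 * PI.
Proof. pose proof PI_RGT_0; lra. Qed.

Definition cont_circle (k : C -> C) (r : R) : Prop :=
  forall u, Cmod u = r -> ccont (T := C_UniformSpace) k u.

Section Mean.
Context (r : R) (Hr : 0 <= r).

Lemma cont_circle_on k : cont_circle k r -> cont_on (fun t => k (circ r t)) 0 (2 * PI).
Proof. intros H; apply cont_on_circ; rewrite Rabs_pos_eq by exact Hr; exact H. Qed.

Lemma Cmean_ext k l : (forall u, Cmod u = r -> k u = l u) -> Cmean k r = Cmean l r.
Proof.
intros H; unfold Cmean; f_equal; apply CInt_ext; [apply Rlt_le, two_PI_pos |].
intros t _; apply H, Cmod_circ, Hr.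
Qed.

Lemma Cmean_plus k l : cont_circle k r -> cont_circle l r ->
  Cmean (fun u => k u + l u)%C r = (Cmean k r + Cmean l r)%C.
Proof.
intros Hk Hl; unfold Cmean; rewrite CInt_plus; [ring | apply Rlt_le, two_PI_pos | |];
  now apply cont_circle_on.
Qed.

Lemma Cmean_minus k l : cont_circle k r -> cont_circle l r ->
  Cmean (fun u => k u - l u)%C r = (Cmean k r - Cmean l r)%C.
Proof.
intros Hk Hl; unfold Cmean; rewrite CInt_minus; [ring | apply Rlt_le, two_PI_pos | |];
  now apply cont_circle_on.
Qed.

Lemma Cmean_scal c k : cont_circle k r -> Cmean (fun u => c * k u)%C r = (c * Cmean k r)%C.
Proof.
intros Hk; unfold Cmean; rewrite CInt_scal; [ring | apply Rlt_le, two_PI_pos |];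
  now apply cont_circle_on.
Qed.

Lemma Cmean_const c : Cmean (fun _ => c) r = c.
Proof.
unfold Cmean; rewrite CInt_const, Rminus_0_r.
transitivity (c * (RtoC (/ (2 * PI)) * RtoC (2 * PI)))%C; [ring |].
rewrite <- RtoC_mult, Rinv_l; [ring | pose proof two_PI_pos; lra].
Qed.

Lemma Cmean_bound_circ k M : cont_circle k r ->
  (forall t, 0 <= t <= 2 * PI -> Cmod (k (circ r t)) <= M) -> Cmod (Cmean k r) <= 2 * M.
Proof.
intros Hk HM; pose proof two_PI_pos as HP; unfold Cmean.
rewrite Cmod_mult, Cmod_R, Rabs_pos_eq by (apply Rlt_le, Rinv_0_lt_compat, HP).
apply Rmult_le_reg_l with (2 * PI); [exact HP |].
rewrite <- Rmult_assoc, Rinv_r, Rmult_1_l by lra.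
replace (2 * PI * (2 * M)) with (2 * M * (2 * PI - 0)) by ring.
apply CInt_bound; [lra | now apply cont_circle_on | exact HM].
Qed.

Lemma Cmean_bound k M : cont_circle k r -> (forall u, Cmod u = r -> Cmod (k u) <= M) ->
  Cmod (Cmean k r) <= 2 * M.
Proof. intros Hk HM; apply Cmean_bound_circ; [exact Hk |]; intros t _; apply HM, Cmod_circ, Hr. Qed.

Lemma Cmean_conj k : cont_circle k r -> Cmean (fun u => Cconj (k u)) r = Cconj (Cmean k r).
Proof.
intros Hk; pose proof (cont_circle_on k Hk) as Hc; pose proof two_PI_pos as HP.
unfold Cmean, CInt, Cconj, Cmult, RtoC, Re, Im; cbn [fst snd].
replace (RInt (fun t => - snd (k (circ r t))) 0 (2 * PI))
  with (- RInt (fun t => snd (k (circ r t))) 0 (2 * PI)).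
- f_equal; ring.
- symmetry; apply (RInt_opp (V := R_CompleteNormedModule)).
  apply cont_on_Im; [lra | exact Hc].
Qed.

End Mean.

Lemma Cmean_0 k : Cmean k 0 = k (RtoC 0).
Proof.
rewrite <- (Cmean_const 0 (k (RtoC 0))); apply Cmean_ext; [lra |].
intros u Hu; apply Cmod_eq_0 in Hu; now rewrite Hu.
Qed.

(* In logarithmic coordinates the annulus is a rectangle whose two horizontal sides are
   glued together. *)
Lemma Cmean_annulus k r s : 0 < r <= s ->
  (forall u, r <= Cmod u <= s -> exists l, cderiv k u l) -> Cmean k r = Cmean k s.
Proof.
intros [Hr Hrs] Hk; pose proof two_PI_pos as HP.
assert (Hln : ln r <= ln s).
{ destruct (Req_dec r s) as [-> | N]; [lra | apply Rlt_le, ln_increasing; lra]. }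
pose proof (goursat (fun z => k (Cexp z)) (ln r) (ln s) 0 (2 * PI) Hln ltac:(lra)) as G.
unfold rect_int in G.
assert (E : forall u, 0 < u -> CInt (fun y => k (Cexp (ln u, y))) 0 (2 * PI)
                    = CInt (fun t => k (circ u t)) 0 (2 * PI)).
{ intros u Hu; apply CInt_ext; [lra |]; intros t _; now rewrite circ_exp. }
rewrite !E in G by lra.
rewrite (CInt_ext (fun x => k (Cexp (x, 2 * PI))) (fun x => k (Cexp (x, 0)))) in G; [| exact Hln |].
2:{ intros t _; f_equal; unfold Cexp; simpl; now rewrite cos_2PI, sin_2PI, cos_0, sin_0. }
unfold Cmean; f_equal.
assert (G' : (Ci * (CInt (fun t => k (circ s t)) 0 (2 * PI) - CInt (fun t => k (circ r t)) 0 (2 * PI)))%C = RtoC 0).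
{ rewrite <- G; [ring |].
  intros x y Hx Hy.
  destruct (Hk (Cexp (x, y))) as [l Hl].
  - rewrite Cmod_Cexp; simpl; rewrite <- (exp_ln r), <- (exp_ln s) by lra.
    split; apply exp_le_mono; lra.
  - exists (l * Cexp (x, y))%C; exact (cderiv_comp k Cexp _ _ _ (cderiv_Cexp _) Hl). }
apply (f_equal (fun c => Ci * c)%C) in G'.
rewrite Cmult_assoc, Ci_mult_Ci, Cmult_0_r in G'.
rewrite <- (Cplus_0_r (CInt (fun t => k (circ s t)) 0 (2 * PI))), <- G'; ring.
Qed.

(** * Cauchy's formula *)

Lemma Cmod_arbitrarily_small (z : C) : (forall eps, 0 < eps -> Cmod z <= eps) -> z = RtoC 0.
Proof.
intros H; apply Cmod_eq_0; apply Rle_antisym; [| apply Cmod_ge_0].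
apply le_epsilon; intros e He; rewrite Rplus_0_l; auto.
Qed.

(** Compactness of the angle interval makes the modulus of continuity in the radius uniform in t.
    The radius r0 = 0 is included, so that means over small circles converge to the value at the
    centre. *)
Lemma circle_equicontinuous (k : C -> C) (r0 : R) : 0 <= r0 -> cont_circle k r0 ->
  forall eps, 0 < eps -> exists d, 0 < d /\ forall r t, Rabs (r - r0) < d -> 0 <= t <= 2 * PI ->
    Cmod (k (circ r t) - k (circ r0 t)) <= eps.
Proof.
intros Hr Hk eps He; pose proof two_PI_pos as HP.
assert (L : forall t, exists d : posreal, forall r s, Rabs (r - r0) < d -> Rabs (s - t) < d ->
   Cmod (k (circ r s) - k (circ r0 t)) < eps / 2).
{ intros t.
  assert (He2 : 0 < eps / 2) by lra.
  destruct (proj1 (locally_Cmod _ _) (Hk (circ r0 t) (Cmod_circ r0 t Hr) _ He2)) as [d [Hd H]].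
  assert (Hd2 : 0 < d / 2) by lra.
  destruct (ccont_circ r0 t _ Hd2) as [e H'].
  assert (Hm : 0 < Rmin (d / 2) e) by (apply Rmin_glb_lt; [exact Hd2 | apply cond_pos]).
  exists (mkposreal _ Hm); simpl; intros r s A B.
  assert (A' := Rlt_le_trans _ _ _ A (Rmin_l _ _)).
  assert (B' := Rlt_le_trans _ _ _ B (Rmin_r _ _)).
  apply H.
  replace (circ r s - circ r0 t)%C with (RtoC (r - r0) * circ 1 s + (circ r0 s - circ r0 t))%C.
  - eapply Rle_lt_trans; [apply Cmod_triangle |].
    rewrite Cmod_mult, Cmod_R, Cmod_circ by lra.
    specialize (H' s B'); lra.
  - rewrite RtoC_minus, (circ_scal r s), (circ_scal r0 s); ring. }
set (delta := fun t => proj1_sig (constructive_indefinite_description _ (L t))).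
destruct (compactness_value_1d 0 (2 * PI) delta) as [d Hd].
exists d; split; [apply cond_pos |]; intros r t Hrr Ht.
(* The covering lemma yields its tagged point only under a double negation, so the inequality is
   proved by contradiction. *)
apply Rnot_lt_le; intros N; apply (Hd t Ht); intros [t0 [H0 [H1 H2]]].
unfold delta in H1, H2; destruct (constructive_indefinite_description _ (L t0)) as [d0 Hd0].
simpl in H1, H2.
pose proof (Hd0 r t ltac:(lra) H1) as A.
pose proof (Hd0 r0 t ltac:(rewrite Rminus_diag, Rabs_R0; apply cond_pos) H1) as B.
assert (T : Cmod (k (circ r t) - k (circ r0 t)) <=
  Cmod (k (circ r t) - k (circ r0 t0)) + Cmod (- (k (circ r0 t) - k (circ r0 t0)))).
{ replace (k (circ r t) - k (circ r0 t))%C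
    with ((k (circ r t) - k (circ r0 t0)) + - (k (circ r0 t) - k (circ r0 t0)))%C by ring.
  apply Cmod_triangle. }
rewrite Cmod_opp in T; lra.
Qed.

Lemma Cmean_continuous (k : C -> C) (r0 : R) : 0 <= r0 -> cont_circle k r0 ->
  forall eps, 0 < eps -> exists d, 0 < d /\ forall r, 0 <= r -> Rabs (r - r0) < d ->
    cont_circle k r -> Cmod (Cmean k r - Cmean k r0) <= eps.
Proof.
intros Hr Hk eps He; pose proof two_PI_pos as HP.
destruct (circle_equicontinuous k r0 Hr Hk (eps / 2) ltac:(lra)) as [d [Hd H]].
exists d; split; [exact Hd |]; intros r Hr' Hrr Hkr.
unfold Cmean.
replace (RtoC (/ (2 * PI)) * CInt (fun t => k (circ r t)) 0 (2 * PI) -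
   RtoC (/ (2 * PI)) * CInt (fun t => k (circ r0 t)) 0 (2 * PI))%C with
   (RtoC (/ (2 * PI)) * CInt (fun t => k (circ r t) - k (circ r0 t))%C 0 (2 * PI))%C.
2:{ rewrite CInt_minus; [ring | lra | |]; now apply cont_circle_on. }
rewrite Cmod_mult, Cmod_R, Rabs_pos_eq by (apply Rlt_le, Rinv_0_lt_compat, HP).
apply Rmult_le_reg_l with (2 * PI); [exact HP |].
rewrite <- Rmult_assoc, Rinv_r, Rmult_1_l by lra.
replace (2 * PI * eps) with (2 * (eps / 2) * (2 * PI - 0)) by field.
apply CInt_bound; [lra | | intros t Ht; now apply H].
intros t Ht; apply ccont_minus; now apply cont_circle_on.
Qed.

(* The circular mean is continuous in the radius, up to radius 0, and constant away from
   the circles through 0 and [p], so exceptional points do not matter. *)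
Theorem Cmean_value (k : C -> C) (p : C) (R0 r : R) : 0 <= r < R0 ->
  (forall u, Cmod u < R0 -> ccont (T := C_UniformSpace) k u) ->
  (forall u, Cmod u < R0 -> u <> RtoC 0 -> u <> p -> exists l, cderiv k u l) ->
  Cmean k r = k (RtoC 0).
Proof.
intros Hr Hc Hd.
assert (Hcc : forall s, s < R0 -> cont_circle k s) by (intros s Hs u Hu; apply Hc; lra).
assert (Hopen : forall a b, 0 < a <= b -> b < R0 -> b < Cmod p \/ Cmod p < a ->
   Cmean k a = Cmean k b).
{ intros a b Hab Hb Hp; apply Cmean_annulus; [exact Hab |].
  intros u Hu; apply Hd; [lra | |].
  - apply Cmod_gt_0; lra.
  - intros E; subst u; lra. }
(* Both radii are moved inwards by e, where [Hopen] applies, and continuity of the mean absorbs the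
   displacement. The end radii may thus be 0 or |p|. *)
assert (Hclosed : forall a b, 0 <= a <= b -> b < R0 -> b <= Cmod p \/ Cmod p <= a ->
   Cmean k a = Cmean k b).
{ intros a b Hab Hb Hp.
  destruct (Req_dec a b) as [-> | N]; [reflexivity |].
  assert (Z : (Cmean k a - Cmean k b)%C = RtoC 0).
  { apply Cmod_arbitrarily_small; intros eps He.
    destruct (Cmean_continuous k a ltac:(lra) (Hcc a ltac:(lra)) (eps / 2) ltac:(lra))
      as [d1 [P1 C1]].
    destruct (Cmean_continuous k b ltac:(lra) (Hcc b ltac:(lra)) (eps / 2) ltac:(lra))
      as [d2 [P2 C2]].
    set (e := Rmin (Rmin d1 d2) (b - a) / 2).
    assert (E0 : 0 < Rmin (Rmin d1 d2) (b - a))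
      by (apply Rmin_glb_lt; [apply Rmin_glb_lt; assumption | lra]).
    assert (E1 : Rmin (Rmin d1 d2) (b - a) <= d1) by (eapply Rle_trans; apply Rmin_l).
    assert (E2 : Rmin (Rmin d1 d2) (b - a) <= d2)
      by (eapply Rle_trans; [apply Rmin_l | apply Rmin_r]).
    assert (E3 : Rmin (Rmin d1 d2) (b - a) <= b - a) by apply Rmin_r.
    assert (He' : 0 < e /\ e < d1 /\ e < d2 /\ 2 * e <= b - a) by (unfold e; lra).
    clearbody e.
    specialize (C1 (a + e) ltac:(lra) ltac:(apply Rabs_def1; lra) (Hcc (a + e) ltac:(lra))).
    specialize (C2 (b - e) ltac:(lra) ltac:(apply Rabs_def1; lra) (Hcc (b - e) ltac:(lra))).
    rewrite (Hopen (a + e) (b - e)) in C1 by lra.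
    replace (Cmean k a - Cmean k b)%C
      with (- (Cmean k (b - e) - Cmean k a) + (Cmean k (b - e) - Cmean k b))%C by ring.
    eapply Rle_trans; [apply Cmod_triangle |]; rewrite Cmod_opp; lra. }
  apply (f_equal (fun c => c + Cmean k b)%C) in Z.
  rewrite Cplus_0_l in Z; rewrite <- Z; ring. }
rewrite <- Cmean_0.
pose proof (Cmod_ge_0 p).
destruct (Rle_dec r (Cmod p)) as [H1 | H1].
- symmetry; apply Hclosed; lra.
- transitivity (Cmean k (Cmod p)); symmetry; apply Hclosed; lra.
Qed.

Definition holo_disc (R0 : R) (h : C -> C) : Prop :=
  forall u, Cmod u < R0 -> exists l, cderiv h u l.

Lemma holo_disc_ccont R0 h u : holo_disc R0 h -> Cmod u < R0 -> ccont (T := C_UniformSpace) h u.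
Proof. intros H Hu; destruct (H u Hu) as [l Hl]; exact (cderiv_ccont _ _ _ Hl). Qed.

Lemma Cmean_holo (h : C -> C) (R0 r : R) : 0 <= r < R0 -> holo_disc R0 h ->
  Cmean h r = h (RtoC 0).
Proof.
intros Hr Hh; apply (Cmean_value h (RtoC 0) R0); [exact Hr | |].
- intros u Hu; exact (holo_disc_ccont R0 h u Hh Hu).
- intros u Hu _ _; exact (Hh u Hu).
Qed.

Lemma Cmod_minus_ge (a b : C) : Cmod a - Cmod b <= Cmod (a - b).
Proof.
assert (T : Cmod a <= Cmod (a - b) + Cmod b).
{ replace a with ((a - b) + b)%C at 1 by ring; apply Cmod_triangle. }
lra.
Qed.

Lemma Cminus_neq_0 (a b : C) : Cmod b < Cmod a -> (a - b)%C <> RtoC 0.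
Proof. intros H; apply Cmod_gt_0; pose proof (Cmod_minus_ge a b); lra. Qed.

Lemma cont_circle_kernel (z : C) (r : R) : Cmod z < r -> cont_circle (fun u => u / (u - z))%C r.
Proof.
intros Hz u Hu; apply ccont_div; [apply Cminus_neq_0; lra | apply ccont_id |].
apply ccont_minus; [apply ccont_id | apply ccont_const].
Qed.

(* On the circle [u^* = r^2 / u], so the kernel is the conjugate of the holomorphic
   function [r^2 / (r^2 - z^* u)]. *)
Lemma Cmean_kernel (z : C) (r : R) : Cmod z < r -> Cmean (fun u => u / (u - z))%C r = RtoC 1.
Proof.
intros Hz; pose proof (Cmod_ge_0 z) as Hz0.
set (m := fun u => (RtoC (r * r) / (RtoC (r * r) - Cconj z * u))%C).
(* The radius 2 r - |z| exceeds r, and |z| (2 r - |z|) = r^2 - (r - |z|)^2 < r^2 keeps the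
   denominator away from 0. Unlike r^2 / |z|, it also makes sense for z = 0. *)
assert (Hm0 : forall u, Cmod u < 2 * r - Cmod z -> (RtoC (r * r) - Cconj z * u)%C <> RtoC 0).
{ intros u Hu; apply Cminus_neq_0; rewrite Cmod_mult, Cmod_conj, Cmod_R, Rabs_pos_eq by nra.
  pose proof (Cmod_ge_0 u); nra. }
assert (Hm : holo_disc (2 * r - Cmod z) m).
{ intros u Hu; eexists; apply cderiv_div; [now apply Hm0 | apply cderiv_const |].
  apply cderiv_minus; [apply cderiv_const | apply cderiv_mult; [apply cderiv_const | apply cderiv_id]]. }
assert (Hcc : cont_circle m r).
{ intros u Hu; apply (holo_disc_ccont (2 * r - Cmod z)); [exact Hm | lra]. }
transitivity (Cmean (fun u => Cconj (m u)) r).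
- apply Cmean_ext; [lra |]; intros u Hu; unfold m.
  assert (Hu0 : u <> RtoC 0) by (apply Cmod_gt_0; lra).
  assert (Huz : (u - z)%C <> RtoC 0) by (apply Cminus_neq_0; lra).
  assert (E : RtoC (r * r) = (u * Cconj u)%C).
  { rewrite <- Cmod2_conj, Hu; f_equal; ring. }
  assert (Huc : (Cconj u - Cconj z)%C <> RtoC 0).
  { rewrite <- Cminus_conj; intros E0; apply Huz, Cmod_eq_0.
    rewrite <- Cmod_conj, E0; apply Cmod_0. }
  rewrite E; replace (u * Cconj u / (u * Cconj u - Cconj z * u))%C
    with (Cconj u / (Cconj u - Cconj z))%C.
  2:{ assert (Hp : (u * Cconj u - Cconj z * u)%C <> RtoC 0).
      { replace (u * Cconj u - Cconj z * u)%C with (u * (Cconj u - Cconj z))%C by ring.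
        now apply Cmult_neq_0. }
      field; repeat split; assumption. }
  rewrite <- Cminus_conj, <- Cdiv_conj, Cconj_conj by exact Huz; reflexivity.
- rewrite Cmean_conj, (Cmean_holo m (2 * r - Cmod z)); try assumption; try lra.
  unfold m; rewrite Cmult_0_r.
  assert (Hrr : RtoC (r * r) <> RtoC 0).
  { intros E; apply RtoC_inj in E; nra. }
  replace (RtoC (r * r) / (RtoC (r * r) - 0))%C with (RtoC 1) by (field; exact Hrr).
  unfold Cconj, RtoC; simpl; f_equal; ring.
Qed.

(** The slope phi of h at z is continuous, and holomorphic except at z, so u phi(u) has mean equal
    to its value 0 at the centre. As u phi(u) = (h(u) - h(z)) u / (u - z), this says that the mean
    of h(u) u / (u - z) is h(z) times the mean of the kernel, which is 1. *)
Theorem cauchy_formula (h : C -> C) (R0 r : R) (z : C) : Cmod z < r < R0 -> holo_disc R0 h ->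
  Cmean (fun u => h u * (u / (u - z)))%C r = h z.
Proof.
intros [Hz Hr] Hh; pose proof (Cmod_ge_0 z) as Hz0.
destruct (Hh z ltac:(lra)) as [l Hl].
apply cderiv_slope in Hl; destruct Hl as [phi [P1 [P2 P3]]].
assert (Ephi : forall u, u <> z -> phi u = ((h u - h z) / (u - z))%C).
{ intros u Hu; rewrite (P3 u); field; now apply Cdist_neq. }
assert (Dphi : forall u, Cmod u < R0 -> u <> z -> exists l, cderiv phi u l).
{ intros u Hu N; destruct (Hh u Hu) as [l' Hl']; eexists.
  apply cderiv_ext_loc with (fun u => (h u - h z) / (u - z))%C.
  - apply locally_Cmod; exists (Cmod (z - u)); split; [apply Cmod_gt_0, Cdist_neq; congruence |].
    intros y Hy; symmetry; apply Ephi; intros ->; lra.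
  - apply cderiv_div; [now apply Cdist_neq | |].
    + apply cderiv_minus; [exact Hl' | apply cderiv_const].
    + apply cderiv_minus; [apply cderiv_id | apply cderiv_const]. }
assert (Hmean : Cmean (fun u => u * phi u)%C r = RtoC 0).
{ rewrite (Cmean_value (fun u => u * phi u)%C z R0); [ring | lra | |].
  - intros u Hu; apply ccont_mult; [apply ccont_id |].
    destruct (Ceq_dec u z) as [-> | N]; [exact P1 |].
    destruct (Dphi u Hu N) as [l' Hl']; exact (cderiv_ccont _ _ _ Hl').
  - intros u Hu _ N; destruct (Dphi u Hu N) as [l' Hl']; eexists.
    apply cderiv_mult; [apply cderiv_id | exact Hl']. }
pose proof (cont_circle_kernel z r Hz) as Hker.
assert (Hhc : cont_circle h r) by (intros u Hu; apply (holo_disc_ccont R0); [exact Hh | lra]).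
rewrite (Cmean_ext r ltac:(lra) _ (fun u => h u * (u / (u - z)) - h z * (u / (u - z)))%C) in Hmean.
2:{ intros u Hu; rewrite Ephi by (intros ->; lra); unfold Cdiv; ring. }
rewrite Cmean_minus, Cmean_scal, Cmean_kernel in Hmean; try assumption; try lra.
- apply (f_equal (fun c => c + h z * 1)%C) in Hmean.
  rewrite Cplus_0_l, Cmult_1_r in Hmean; rewrite <- Hmean; ring.
- intros u Hu; apply ccont_mult; [now apply Hhc | now apply Hker].
- intros u Hu; apply ccont_mult; [apply ccont_const | now apply Hker].
Qed.

(** * Taylor coefficients *)

Lemma circle_bounded (h : C -> C) (r : R) : 0 <= r -> cont_circle h r ->
  exists M, 0 <= M /\ forall t, 0 <= t <= 2 * PI -> Cmod (h (circ r t)) <= M.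
Proof.
intros Hr Hh; pose proof two_PI_pos as HP.
destruct (continuity_ab_maj (fun t => Cmod (h (circ r t))) 0 (2 * PI)) as [tm [Ht _]]; [lra | |].
- intros t Ht; apply continuity_pt_filterlim.
  apply (ccont_Cmod (T := R_UniformSpace)); now apply cont_circle_on.
- exists (Cmod (h (circ r tm))); split; [apply Cmod_ge_0 | exact Ht].
Qed.

Definition taylor_coef (h : C -> C) (r : R) (k : nat) : C := Cmean (fun u => h u / u ^ k)%C r.

(** The remainder after the terms of order below n, divided by z^n; at n = 0 it is the Cauchy
    integral of h itself. *)
Definition taylor_rem (h : C -> C) (r : R) (z : C) (n : nat) : C :=
  Cmean (fun u => h u / u ^ n * (u / (u - z)))%C r.

Lemma Cmod_pos_neq (u : C) : 0 < Cmod u -> u <> RtoC 0.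
Proof. apply Cmod_gt_0. Qed.

Lemma cont_circle_quot_pow (h : C -> C) (r : R) (k : nat) : 0 < r -> cont_circle h r ->
  cont_circle (fun u => h u / u ^ k)%C r.
Proof.
intros Hr Hh u Hu; apply ccont_div; [| now apply Hh |].
- apply Cpow_nz, Cmod_pos_neq; lra.
- exact (ccont_pow (T := C_UniformSpace) (fun u => u) k u (ccont_id u)).
Qed.

Lemma taylor_expansion (h : C -> C) (R0 r : R) (z : C) (n : nat) :
  Cmod z < r < R0 -> holo_disc R0 h ->
  h z = (sum_n (fun k => z ^ k * taylor_coef h r k)%C n + z ^ S n * taylor_rem h r z (S n))%C.
Proof.
intros Hz Hh; pose proof (Cmod_ge_0 z) as Hz0.
assert (Hhc : cont_circle h r) by (intros u Hu; apply (holo_disc_ccont R0); [exact Hh | lra]).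
(* One step of the geometric series: u / (u - z) = 1 + (z / u) (u / (u - z)). *)
assert (Hstep : forall m, taylor_rem h r z m = (taylor_coef h r m + z * taylor_rem h r z (S m))%C).
{ intros m; unfold taylor_rem, taylor_coef.
  rewrite <- Cmean_scal, <- Cmean_plus; try lra.
  - apply Cmean_ext; [lra |]; intros u Hu.
    assert (u <> RtoC 0) by (apply Cmod_pos_neq; lra).
    assert ((u - z)%C <> RtoC 0) by (apply Cminus_neq_0; lra).
    simpl; field; repeat split; trivial; now apply Cpow_nz.
  - apply cont_circle_quot_pow; [lra | exact Hhc].
  - intros u Hu; apply ccont_mult; [apply ccont_const |].
    apply ccont_mult; [apply (cont_circle_quot_pow h r (S m)); [lra | exact Hhc | exact Hu] |].
    apply (cont_circle_kernel z r); [lra | exact Hu].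
  - intros u Hu; apply ccont_mult;
     [apply (cont_circle_quot_pow h r (S m)); [lra | exact Hhc | exact Hu] |].
    apply (cont_circle_kernel z r); [lra | exact Hu]. }
induction n as [| n IH].
- rewrite sum_O.
  replace (h z) with (taylor_rem h r z 0).
  + rewrite Hstep; simpl; ring.
  + rewrite <- (cauchy_formula h R0 r z Hz Hh); apply Cmean_ext; [lra |].
    intros u Hu; simpl; field; apply Cminus_neq_0; lra.
- rewrite sum_Sn, IH, (Hstep (S n)).
  change (plus ?a ?b) with (a + b)%C; simpl; ring.
Qed.

Lemma taylor_rem_bound (h : C -> C) (r : R) : 0 < r -> cont_circle h r ->
  exists M, 0 <= M /\ forall n z, Cmod z < r -> Cmod (taylor_rem h r z n) <= M / r ^ n * (r / (r - Cmod z)).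
Proof.
intros Hr Hh; destruct (circle_bounded h r (Rlt_le _ _ Hr) Hh) as [M [HM Hb]].
exists (2 * M); split; [lra |]; intros n z Hz; pose proof (Cmod_ge_0 z) as Hz0.
replace (2 * M / r ^ n * (r / (r - Cmod z))) with (2 * (M / r ^ n * (r / (r - Cmod z))))
  by (field; split; [lra | apply pow_nonzero; lra]).
apply Cmean_bound_circ; [lra | |].
- intros u Hu; apply ccont_mult; [apply (cont_circle_quot_pow h r n); assumption |].
  now apply (cont_circle_kernel z r).
- intros t Ht; set (u := circ r t).
  assert (Hu : Cmod u = r) by (apply Cmod_circ; lra).
  assert (u <> RtoC 0) by (apply Cmod_pos_neq; lra).
  assert ((u - z)%C <> RtoC 0) by (apply Cminus_neq_0; lra).
  rewrite Cmod_mult, !Cmod_div, Cmod_pow, Hu by (trivial; now apply Cpow_nz).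
  pose proof (Cmod_minus_ge u z).
  apply Rmult_le_compat.
  + apply Rdiv_le_0_compat; [apply Cmod_ge_0 | now apply pow_lt].
  + apply Rdiv_le_0_compat; lra.
  + apply Rmult_le_compat_r; [apply Rlt_le, Rinv_0_lt_compat, pow_lt, Hr | now apply Hb].
  + apply Rmult_le_compat_l; [lra |]; apply Rinv_le_contravar; lra.
Qed.

(** The derivative is the value at 0 of the slope, hence its mean over the circle. One factor 2 of
    the constant 4 comes from the bound on means, the other from |h(u) - h(0)| <= 2 M. *)
Lemma cauchy_estimate (h : C -> C) (R0 r M : R) (l : C) : 0 < r < R0 -> holo_disc R0 h ->
  cderiv h 0 l -> (forall u, Cmod u <= r -> Cmod (h u) <= M) -> Cmod l <= 4 * M / r.
Proof.
intros Hr Hh Hl HM.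
apply cderiv_slope in Hl; destruct Hl as [phi [P1 [P2 P3]]].
assert (Ephi : forall u, u <> RtoC 0 -> phi u = ((h u - h 0) / u)%C).
{ intros u Hu; rewrite (P3 u); field; exact Hu. }
assert (Dphi : forall u, Cmod u < R0 -> u <> RtoC 0 -> exists l, cderiv phi u l).
{ intros u Hu N; destruct (Hh u Hu) as [l' Hl']; eexists.
  apply cderiv_ext_loc with (fun u => (h u - h 0) / u)%C.
  - apply locally_Cmod; exists (Cmod u); split; [now apply Cmod_gt_0 |].
    intros y Hy; symmetry; apply Ephi; intros ->.
    replace (0 - u)%C with (- u)%C in Hy by ring; rewrite Cmod_opp in Hy; lra.
  - apply cderiv_div; [exact N | | apply cderiv_id].
    apply cderiv_minus; [exact Hl' | apply cderiv_const]. }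
assert (Hc : forall u, Cmod u < R0 -> ccont (T := C_UniformSpace) phi u).
{ intros u Hu; destruct (Ceq_dec u 0) as [-> | N]; [exact P1 |].
  destruct (Dphi u Hu N) as [l' Hl']; exact (cderiv_ccont _ _ _ Hl'). }
rewrite <- P2, <- (Cmean_value phi 0 R0 r); [| lra | exact Hc | intros u Hu N _; now apply Dphi].
replace (4 * M / r) with (2 * (2 * M / r)) by (field; lra).
apply Cmean_bound; [lra | intros u Hu; apply Hc; lra |].
intros u Hu; rewrite Ephi by (apply Cmod_pos_neq; lra).
rewrite Cmod_div, Hu by (apply Cmod_pos_neq; lra).
apply Rmult_le_compat_r; [apply Rlt_le, Rinv_0_lt_compat; lra |].
eapply Rle_trans; [apply Cmod_triangle |]; rewrite Cmod_opp.
pose proof (HM u ltac:(lra)); pose proof (HM 0 ltac:(rewrite Cmod_0; lra)); lra.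
Qed.

(** * Third-order expansions at 0 *)

Definition bounded_near0 (f : C -> C) : Prop :=
  exists K, locally (T := C_UniformSpace) (RtoC 0) (fun z => Cmod (f z) <= K).

Lemma bounded_near0_const c : bounded_near0 (fun _ => c).
Proof. exists (Cmod c); apply filter_forall; intros _; apply Rle_refl. Qed.

Lemma bounded_near0_id : bounded_near0 (fun z => z).
Proof.
exists 1; apply locally_Cmod; exists 1; split; [lra |]; intros y Hy.
replace (y - 0)%C with y in Hy by ring; lra.
Qed.

Lemma bounded_near0_plus f g : bounded_near0 f -> bounded_near0 g ->
  bounded_near0 (fun z => f z + g z)%C.
Proof.
intros [K HK] [L HL]; exists (K + L).
generalize (filter_and _ _ HK HL); apply filter_imp; intros z [A B].
eapply Rle_trans; [apply Cmod_triangle | lra].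
Qed.

Lemma bounded_near0_mult f g : bounded_near0 f -> bounded_near0 g ->
  bounded_near0 (fun z => f z * g z)%C.
Proof.
intros [K HK] [L HL]; exists (K * L).
generalize (filter_and _ _ HK HL); apply filter_imp; intros z [A B].
rewrite Cmod_mult; apply Rmult_le_compat; trivial; apply Cmod_ge_0.
Qed.

(** A 3-jet with an O(z^4) error. Writing the error as z^4 times a bounded function reduces the
    rules for sums, products and composites to polynomial identities with an explicit new
    remainder. *)
Definition T3 (f : C -> C) (a0 a1 a2 a3 : C) : Prop :=
  exists phi, bounded_near0 phi /\
    locally (T := C_UniformSpace) (RtoC 0)
      (fun z => f z = (a0 + a1 * z + a2 * z ^ 2 + a3 * z ^ 3 + z ^ 4 * phi z)%C).

Ltac cring := match goal with |- ?a = ?b => change (@eq C a b) end; ring.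

Ltac bounded := repeat first
  [ assumption | apply bounded_near0_plus | apply bounded_near0_mult
  | apply bounded_near0_id | apply bounded_near0_const ].

Lemma T3_eq f a0 a1 a2 a3 b0 b1 b2 b3 : T3 f a0 a1 a2 a3 ->
  a0 = b0 -> a1 = b1 -> a2 = b2 -> a3 = b3 -> T3 f b0 b1 b2 b3.
Proof. intros H -> -> -> ->; exact H. Qed.

Lemma T3_ext f g a0 a1 a2 a3 :
  locally (T := C_UniformSpace) (RtoC 0) (fun z => f z = g z) ->
  T3 f a0 a1 a2 a3 -> T3 g a0 a1 a2 a3.
Proof.
intros H [phi [B L]]; exists phi; split; [exact B |].
generalize (filter_and _ _ H L); apply filter_imp; intros z [<- E]; exact E.
Qed.

Lemma T3_poly a0 a1 a2 a3 : T3 (fun z => a0 + a1 * z + a2 * z ^ 2 + a3 * z ^ 3)%C a0 a1 a2 a3.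
Proof.
exists (fun _ => RtoC 0); split; [bounded |]; apply filter_forall; intros z; cring.
Qed.

Lemma T3_const c : T3 (fun _ => c) c 0 0 0.
Proof. exists (fun _ => RtoC 0); split; [bounded |]; apply filter_forall; intros z; cring. Qed.

Lemma T3_id : T3 (fun z => z) 0 1 0 0.
Proof. exists (fun _ => RtoC 0); split; [bounded |]; apply filter_forall; intros z; transitivity (0 + z)%C; [symmetry; apply Cplus_0_l | cring]. Qed.

Lemma T3_plus f g a0 a1 a2 a3 b0 b1 b2 b3 : T3 f a0 a1 a2 a3 -> T3 g b0 b1 b2 b3 ->
  T3 (fun z => f z + g z)%C (a0 + b0) (a1 + b1) (a2 + b2) (a3 + b3).
Proof.
intros [p [P L]] [q [Q M]]; exists (fun z => p z + q z)%C; split; [bounded |].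
generalize (filter_and _ _ L M); apply filter_imp; intros z [-> ->]; ring.
Qed.

Lemma T3_mult f g a0 a1 a2 a3 b0 b1 b2 b3 : T3 f a0 a1 a2 a3 -> T3 g b0 b1 b2 b3 ->
  T3 (fun z => f z * g z)%C (a0 * b0) (a0 * b1 + a1 * b0) (a0 * b2 + a1 * b1 + a2 * b0)
    (a0 * b3 + a1 * b2 + a2 * b1 + a3 * b0).
Proof.
intros [p [P L]] [q [Q M]].
exists (fun z => (a1 * b3 + a2 * b2 + a3 * b1) + (a2 * b3 + a3 * b2) * z + a3 * b3 * (z * z)
  + p z * (b0 + b1 * z + b2 * (z * z) + b3 * (z * (z * z)))
  + (a0 + a1 * z + a2 * (z * z) + a3 * (z * (z * z))) * q z
  + z * (z * (z * z)) * (p z * q z))%C; split; [bounded |].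
generalize (filter_and _ _ L M); apply filter_imp; intros z [-> ->]; ring.
Qed.

(** As g has no constant term, g = z G with G bounded near 0. Thus g(z) tends to 0, which pulls
    neighbourhoods of 0 back along g, and the remainder g^4 p(g) of f becomes z^4 G^4 p(g). *)
Lemma T3_comp f g a0 a1 a2 a3 b1 b2 b3 : T3 f a0 a1 a2 a3 -> T3 g 0 b1 b2 b3 ->
  T3 (fun z => f (g z)) a0 (a1 * b1) (a1 * b2 + a2 * (b1 * b1))
    (a1 * b3 + 2 * a2 * (b1 * b2) + a3 * (b1 * b1 * b1)).
Proof.
intros [p [[K HK] L]] [q [Q M]].
set (G := fun z => (b1 + b2 * z + b3 * (z * z) + z * (z * z) * q z)%C).
assert (BG : bounded_near0 G) by (unfold G; bounded).
assert (EG : locally (T := C_UniformSpace) (RtoC 0) (fun z => g z = z * G z)%C).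
{ revert M; apply filter_imp; intros z ->; unfold G; ring. }
assert (Lim : forall P : C -> Prop, locally (T := C_UniformSpace) (RtoC 0) P ->
   locally (T := C_UniformSpace) (RtoC 0) (fun z => P (g z))).
{ intros P HP; apply locally_Cmod in HP; destruct HP as [d [Hd HP]].
  destruct BG as [N HN].
  assert (S : locally (T := C_UniformSpace) (RtoC 0) (fun z => Cmod z < d / (1 + Rabs N))).
  { apply locally_Cmod; exists (d / (1 + Rabs N)); split.
    - apply Rdiv_lt_0_compat; [exact Hd | pose proof (Rabs_pos N); lra].
    - intros y; replace (y - 0)%C with y by ring; trivial. }
  generalize (filter_and _ _ EG (filter_and _ _ HN S)); apply filter_imp.
  intros z [E [A B]]; apply HP; replace (g z - 0)%C with (g z) by ring.
  rewrite E, Cmod_mult.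
  pose proof (Rabs_pos N); pose proof (Rle_abs N); pose proof (Cmod_ge_0 z).
  apply Rle_lt_trans with (Cmod z * (1 + Rabs N)); [apply Rmult_le_compat_l; lra |].
  apply Rmult_lt_reg_r with (/ (1 + Rabs N)); [apply Rinv_0_lt_compat; lra |].
  rewrite Rmult_assoc, Rinv_r, Rmult_1_r by lra; exact B. }
assert (BP : bounded_near0 (fun z => p (g z))) by (exists K; exact (Lim _ HK)).
set (s := fun z => (b2 + b3 * z + z * z * q z)%C).
assert (BS : bounded_near0 s) by (unfold s; bounded).
(* With G = b1 + z s, these are the parts of order at least 4 of a1 g, a2 g^2 and a3 g^3, divided by
   z^4, followed by the remainder of f. *)
exists (fun z => a1 * q z + a2 * (s z * s z + 2 * b1 * (b3 + z * q z))
  + a3 * (s z * (3 * (b1 * b1) + 3 * b1 * (z * s z) + z * z * (s z * s z)))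
  + G z * (G z * (G z * G z)) * p (g z))%C; split; [bounded |].
generalize (filter_and _ _ (Lim _ L) (filter_and _ _ M EG)); apply filter_imp.
intros z [E1 [E2 E3]]; rewrite E1.
replace (g z ^ 4 * p (g z))%C with (z ^ 4 * (G z * (G z * (G z * G z))) * p (g z))%C
  by (rewrite E3; ring).
generalize (p (g z)); intros pg; rewrite E2; unfold s; ring.
Qed.

(** Small positive real z already give |c| = |z f(z)| <= eps. The relation is asked for off 0 only,
    because each higher coefficient is reached after cancelling a factor z. *)
Lemma vanishing_const (c : C) (f : C -> C) : bounded_near0 f ->
  locally (T := C_UniformSpace) (RtoC 0) (fun z => z <> RtoC 0 -> (c + z * f z)%C = RtoC 0) ->
  c = RtoC 0.
Proof.
intros [K HK] H; apply Cmod_arbitrarily_small; intros eps He.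
destruct (proj1 (locally_Cmod _ _) (filter_and _ _ HK H)) as [d [Hd L]].
pose proof (Rabs_pos K) as HK0; pose proof (Rle_abs K) as HK1.
set (x := Rmin (d / 2) (eps / (1 + Rabs K))).
assert (Hx : 0 < x) by (apply Rmin_glb_lt; [lra | apply Rdiv_lt_0_compat; lra]).
assert (Hx1 : x <= d / 2) by apply Rmin_l.
assert (Hx2 : x * (1 + Rabs K) <= eps).
{ apply Rle_trans with (eps / (1 + Rabs K) * (1 + Rabs K)).
  - apply Rmult_le_compat_r; [lra | apply Rmin_r].
  - right; field; lra. }
destruct (L (RtoC x)) as [A B].
{ replace (RtoC x - 0)%C with (RtoC x) by ring; rewrite Cmod_R, Rabs_pos_eq; lra. }
assert (E : c = (- (RtoC x * f (RtoC x)))%C).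
{ assert (N : RtoC x <> RtoC 0) by (intros E; apply RtoC_inj in E; lra).
  specialize (B N); apply (f_equal (fun y => y - RtoC x * f (RtoC x))%C) in B.
  transitivity (c + x * f x - x * f x)%C; [ring | rewrite B; ring]. }
rewrite E, Cmod_opp, Cmod_mult, Cmod_R, Rabs_pos_eq by lra.
assert (x * Cmod (f x) <= x * (1 + Rabs K)) by (apply Rmult_le_compat_l; lra); lra.
Qed.

Lemma T3_unique f a0 a1 a2 a3 b0 b1 b2 b3 : T3 f a0 a1 a2 a3 -> T3 f b0 b1 b2 b3 ->
  a0 = b0 /\ a1 = b1 /\ a2 = b2 /\ a3 = b3.
Proof.
intros [p [P L]] [q [Q M]].
(* Horner form, so that the differences of coefficients are peeled off one at a time. *)
assert (H : locally (T := C_UniformSpace) (RtoC 0) (fun z =>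
  (a0 - b0) + z * ((a1 - b1) + z * ((a2 - b2) + z * ((a3 - b3) + z * (p z + - (1) * q z)))) = 0)%C).
{ generalize (filter_and _ _ L M); apply filter_imp; intros z [E1 E2].
  transitivity (f z - f z)%C; [rewrite E1 at 1; rewrite E2; ring | ring]. }
assert (Hz : forall z c d : C, z <> RtoC 0 -> c = RtoC 0 -> (c + z * d)%C = RtoC 0 -> d = RtoC 0).
{ intros z c d Hz -> E; replace d with (/ z * (0 + z * d))%C by (field; exact Hz).
  rewrite E; ring. }
assert (H0 : (a0 - b0)%C = RtoC 0).
{ eapply vanishing_const; [| refine (filter_imp _ _ _ H); intros z E _; exact E].
  unfold Cminus; bounded. }
assert (H1 : (a1 - b1)%C = RtoC 0).
{ eapply vanishing_const; [| refine (filter_imp _ _ _ H); intros z E N; exact (Hz z _ _ N H0 E)].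
  unfold Cminus; bounded. }
assert (H2 : (a2 - b2)%C = RtoC 0).
{ eapply vanishing_const; [| refine (filter_imp _ _ _ H); intros z E N;
    exact (Hz z _ _ N H1 (Hz z _ _ N H0 E))].
  unfold Cminus; bounded. }
assert (H3 : (a3 - b3)%C = RtoC 0).
{ eapply vanishing_const; [| refine (filter_imp _ _ _ H); intros z E N;
    exact (Hz z _ _ N H2 (Hz z _ _ N H1 (Hz z _ _ N H0 E)))].
  bounded. }
assert (Heq : forall a b : C, (a - b)%C = RtoC 0 -> a = b).
{ intros a b E; replace a with (a - b + b)%C by ring; rewrite E; ring. }
auto.
Qed.

Lemma T3_at_0 f a0 a1 a2 a3 : T3 f a0 a1 a2 a3 -> f (RtoC 0) = a0.
Proof. intros [p [_ L]]; rewrite (locally_singleton _ _ L); ring. Qed.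

Lemma T3_holo (h : C -> C) (R0 r : R) : 0 < r < R0 -> holo_disc R0 h ->
  T3 h (taylor_coef h r 0) (taylor_coef h r 1) (taylor_coef h r 2) (taylor_coef h r 3).
Proof.
intros Hr Hh.
assert (Hhc : cont_circle h r) by (intros u Hu; apply (holo_disc_ccont R0); [exact Hh | lra]).
destruct (taylor_rem_bound h r ltac:(lra) Hhc) as [M [HM HB]].
exists (fun z => taylor_rem h r z 4); split.
- exists (M / r ^ 4 * 2); apply locally_Cmod; exists (r / 2); split; [lra |].
  intros z; replace (z - 0)%C with z by ring; intros Hz.
  eapply Rle_trans; [apply HB; lra |].
  apply Rmult_le_compat_l; [apply Rdiv_le_0_compat; [exact HM | apply pow_lt; lra] |].
  apply Rmult_le_reg_r with (r - Cmod z); [lra |].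
  unfold Rdiv; rewrite Rmult_assoc, Rinv_l by lra; lra.
- apply locally_Cmod; exists r; split; [lra |].
  intros z; replace (z - 0)%C with z by ring; intros Hz.
  rewrite (taylor_expansion h R0 r z 3) by (assumption || lra).
  rewrite !sum_Sn, sum_O.
  repeat match goal with |- context [plus ?a ?b] => change (plus a b) with (a + b)%C end.
  simpl; ring.
Qed.

(* The remainder is O(z^4) on a disc, so by the Cauchy estimate on |u - w| = |w| its
   derivative is O(w^3). *)
Lemma T3_deriv (h dh : C -> C) (R0 : R) a0 a1 a2 a3 : 0 < R0 ->
  (forall z, Cmod z < R0 -> cderiv h z (dh z)) -> T3 h a0 a1 a2 a3 ->
  T3 (fun z => z * dh z)%C 0 a1 (2 * a2) (3 * a3).
Proof.
intros HR Hh [phi [[K HK] L]].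
destruct (proj1 (locally_Cmod _ _) (filter_and _ _ HK L)) as [d [Hd H]].
set (P := fun z => (a0 + a1 * z + a2 * z ^ 2 + a3 * z ^ 3)%C).
set (dP := fun z => (a1 + 2 * a2 * z + 3 * a3 * z ^ 2)%C).
assert (HP : forall z, cderiv P z (dP z)).
{ intros z; eapply cderiv_eq.
  - apply cderiv_plus; [apply cderiv_plus; [apply cderiv_plus; [apply cderiv_const |] |] |];
      (apply cderiv_mult; [apply cderiv_const |]).
    + apply cderiv_id.
    + apply (cderiv_pow 2).
    + apply (cderiv_pow 3).
  - unfold dP; rewrite !S_INR; simpl INR; rewrite !RtoC_plus; ring. }
set (Rm := fun z => (h z - P z)%C).
assert (HRm : forall z, Cmod z < R0 -> cderiv Rm z (dh z - dP z)).
{ intros z Hz; apply cderiv_minus; [now apply Hh | apply HP]. }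
(* Halved so that w + u stays where both the derivative and the expansion are available when |w| and
   |u| are below e. *)
set (e := Rmin R0 d / 2).
assert (He : 0 < e /\ 2 * e <= R0 /\ 2 * e <= d).
{ assert (0 < Rmin R0 d) by (apply Rmin_glb_lt; lra).
  pose proof (Rmin_l R0 d); pose proof (Rmin_r R0 d); unfold e; lra. }
clearbody e.
assert (HK0 : 0 <= K).
{ destruct (H 0) as [A _]; [replace (0 - 0)%C with (RtoC 0) by ring; rewrite Cmod_0; lra |].
  pose proof (Cmod_ge_0 (phi 0)); lra. }
assert (Hb : forall w, w <> RtoC 0 -> Cmod w < e -> Cmod (dh w - dP w) <= 64 * K * Cmod w ^ 3).
{ intros w Hw Hwe; apply Cmod_gt_0 in Hw.
  assert (HMw : 0 <= Cmod w) by lra.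
  (* For |u| <= |w| the remainder at w + u is at most K (2 |w|)^4; [cauchy_estimate] on a circle of
     radius |w| multiplies this by 4 / |w|, whence 64 = 4 * 16. *)
  replace (64 * K * Cmod w ^ 3) with (4 * (K * (2 * Cmod w) ^ 4) / Cmod w) by (field; lra).
  apply (cauchy_estimate (fun u => Rm (w + u)%C) e); [lra | | |].
  - intros u Hu; eexists; apply cderiv_shift, HRm.
    eapply Rle_lt_trans; [apply Cmod_triangle | lra].
  - apply cderiv_shift; replace (w + 0)%C with w by ring; apply HRm; lra.
  - intros u Hu.
    assert (Hwu : Cmod (w + u) <= 2 * Cmod w)
      by (eapply Rle_trans; [apply Cmod_triangle | lra]).
    destruct (H (w + u)%C) as [A B]; [replace (w + u - 0)%C with (w + u)%C by ring; lra |].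
    unfold Rm; rewrite B; unfold P.
    replace (_ - _)%C with ((w + u) ^ 4 * phi (w + u))%C by ring.
    rewrite Cmod_mult, Cmod_pow, Rmult_comm.
    apply Rmult_le_compat; [apply Cmod_ge_0 | apply pow_le, Cmod_ge_0 | exact A |].
    apply pow_incr; split; [apply Cmod_ge_0 | exact Hwu]. }
exists (fun z => if Ceq_dec z 0 then RtoC 0 else ((dh z - dP z) / z ^ 3)%C); split.
- exists (64 * K); apply locally_Cmod; exists e; split; [lra |].
  intros z; replace (z - 0)%C with z by ring; intros Hz.
  destruct (Ceq_dec z 0) as [E | N]; [rewrite Cmod_0; lra |].
  rewrite Cmod_div, Cmod_pow by now apply Cpow_nz.
  specialize (Hb z N Hz); apply Cmod_gt_0 in N.
  apply Rmult_le_reg_r with (Cmod z ^ 3); [now apply pow_lt |].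
  unfold Rdiv; rewrite Rmult_assoc, Rinv_l, Rmult_1_r by (apply pow_nonzero; lra); exact Hb.
- apply filter_forall; intros z; destruct (Ceq_dec z 0) as [-> | N]; [ring |].
  unfold dP; field; exact N.
Qed.

(** * Coefficients of Schwarz functions *)

(** Positivity passes to the mean without any constant, whereas [Cmean_bound] would lose a factor 2
    and with it the sharp coefficient bound. *)
Lemma Cmean_Re_nonneg (k : C -> C) (r : R) : 0 <= r -> cont_circle k r ->
  (forall u, Cmod u = r -> 0 <= Re (k u)) -> 0 <= Re (Cmean k r).
Proof.
intros Hr Hk Hp; pose proof two_PI_pos as HP.
unfold Cmean, CInt, Cmult, RtoC, Re at 1; cbn [fst snd].
rewrite Rmult_0_l, Rminus_0_r.
apply Rmult_le_pos; [apply Rlt_le, Rinv_0_lt_compat, HP |].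
apply RInt_ge_0; [lra | |].
- apply cont_on_Re; [lra | now apply cont_circle_on].
- intros t _; apply Hp, Cmod_circ, Hr.
Qed.

Lemma taylor_coef_radius (h : C -> C) (R0 r s : R) (k : nat) : 0 < r <= s -> s < R0 ->
  holo_disc R0 h -> taylor_coef h r k = taylor_coef h s k.
Proof.
intros Hr Hs Hh; apply Cmean_annulus; [exact Hr |].
intros u Hu; destruct (Hh u ltac:(lra)) as [l Hl]; eexists.
apply cderiv_div; [apply Cpow_nz, Cmod_pos_neq; lra | exact Hl | apply cderiv_pow].
Qed.

Lemma Re_RtoC_mult (x : R) (z : C) : Re (RtoC x * z) = x * Re z.
Proof. unfold Re, RtoC, Cmult; simpl; ring. Qed.

Lemma Cmod_sqr_plus_1 (w : C) : Cmod (1 + w) ^ 2 = 1 + Cmod w ^ 2 + 2 * Re w.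
Proof. rewrite !Cmod2_alt; unfold Re, Im, RtoC, Cplus; simpl; ring. Qed.

(* With [v = delta (u/r)^k], |v| = 1, the kernel [P = (1 + a^* v)^2 / v] satisfies
   |P| = 1 + |a|^2 + 2 Re (a^* v), while the mean of [P om(u) r / u] is
   2 |a|^2 + delta^* b. *)
Lemma schwarz_coef_circle (om : C -> C) (r : R) (m : nat) : 0 < r < 1 ->
  holo_disc 1 om -> om (RtoC 0) = RtoC 0 -> (forall u, Cmod u < 1 -> Cmod (om u) < 1) ->
  r ^ S (S m) * Cmod (taylor_coef om r (S (S m))) + r ^ 2 * Cmod (taylor_coef om r 1) ^ 2 <= 1.
Proof.
intros Hr Hom H0 H1.
set (c1 := taylor_coef om r 1); set (ck := taylor_coef om r (S (S m))).
set (a := (RtoC r * c1)%C); set (b := (RtoC (r ^ S (S m)) * ck)%C).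
(* A unimodular factor turning b into |b|, so that the real part of the mean sees the full
   modulus. *)
assert (Hdelta : exists delta, Cmod delta = 1 /\ (Cconj delta * b)%C = RtoC (Cmod b)).
{ destruct (Ceq_dec b 0) as [-> | N].
  - exists (RtoC 1); rewrite Cmod_1, Cmod_0; split; [reflexivity | ring].
  - pose proof N as N'; apply Cmod_gt_0 in N.
    exists (b * RtoC (/ Cmod b))%C; split.
    + rewrite Cmod_mult, Cmod_R, Rabs_pos_eq by (apply Rlt_le, Rinv_0_lt_compat, N).
      field; lra.
    + rewrite Cmult_conj.
      replace (Cconj b * Cconj (/ Cmod b)%R * b)%C with ((b * Cconj b) * Cconj (/ Cmod b)%R)%C by ring.
      rewrite <- Cmod2_conj.
      replace (Cconj (/ Cmod b)%R) with (RtoC (/ Cmod b))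
        by (unfold Cconj, RtoC; simpl; f_equal; ring).
      rewrite <- RtoC_mult; f_equal; field; lra. }
destruct Hdelta as [delta [D1 D2]].
set (ab := Cconj a) in *.
assert (Hdd : (delta * Cconj delta)%C = RtoC 1).
{ rewrite <- Cmod2_conj, D1; f_equal; ring. }
assert (Haa : (a * ab)%C = RtoC (Cmod a ^ 2)) by (unfold ab; now rewrite <- Cmod2_conj).
assert (Hrk : forall n, RtoC (r ^ n) <> RtoC 0).
{ intros n E; apply RtoC_inj in E; apply (pow_nonzero r n) in E; [trivial | lra]. }
set (rk := RtoC (r ^ S m)).
assert (Hhc : cont_circle om r) by (intros u Hu; apply (holo_disc_ccont 1); [exact Hom | lra]).
(* W is 1 + |a|^2 + 2 conj(a) v - h P with h = r om(u) / u and |h| <= 1. Its first terms have real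
   part |P|, so Re W >= 0. Expanded in u, the terms with u^(m+1) and om(u) u^m are holomorphic and
   vanish at 0; the other means give 1 + |a|^2 - 2 |a|^2 - |b|. *)
set (W := fun u => ((RtoC (1 + Cmod a ^ 2) + (2 * ab * delta / rk) * u ^ S m)
   - (((2 * ab * RtoC r) * (om u / u ^ 1) + (Cconj delta * RtoC (r ^ S (S m))) * (om u / u ^ S (S m)))
      + (ab * ab * delta * RtoC r / rk) * (om u * u ^ m)))%C).
assert (Hcp : forall n, cont_circle (fun u => u ^ n)%C r).
{ intros n u _; exact (ccont_pow (T := C_UniformSpace) (fun u => u) n u (ccont_id u)). }
assert (Hcomp : cont_circle (fun u => om u * u ^ m)%C r).
{ intros u Hu; apply ccont_mult; [now apply Hhc | now apply Hcp]. }
assert (Hcs : forall c k, cont_circle k r -> cont_circle (fun u => c * k u)%C r).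
{ intros c k Hk u Hu; apply ccont_mult; [apply ccont_const | now apply Hk]. }
assert (Hcpl : forall k l, cont_circle k r -> cont_circle l r -> cont_circle (fun u => k u + l u)%C r).
{ intros k l Hk Hl u Hu; apply ccont_plus; [now apply Hk | now apply Hl]. }
assert (Hcq := fun n => cont_circle_quot_pow om r n (proj1 Hr) Hhc).
assert (Hcc : forall c, cont_circle (fun _ => c) r) by (intros c u _; apply ccont_const).
assert (HcW : cont_circle W r).
{ intros u Hu; apply ccont_minus; [apply Hcpl; auto | apply Hcpl; auto]. }
assert (Hpow : holo_disc 1 (fun u => u ^ S m)%C).
{ intros u Hu; eexists; apply cderiv_pow. }
assert (Homp : holo_disc 1 (fun u => om u * u ^ m)%C).
{ intros u Hu; destruct (Hom u Hu) as [l Hl]; eexists.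
  apply cderiv_mult; [exact Hl | apply cderiv_pow]. }
assert (HmW : Cmean W r = RtoC (1 - Cmod a ^ 2 - Cmod b)).
{ unfold W; rewrite Cmean_minus by (auto 6 || lra).
  rewrite (Cmean_plus r ltac:(lra) (fun _ => RtoC (1 + Cmod a ^ 2))) by auto.
  rewrite Cmean_const by lra.
  rewrite (Cmean_plus r ltac:(lra) (fun u => (2 * ab * RtoC r) * (om u / u ^ 1)
     + (Cconj delta * RtoC (r ^ S (S m))) * (om u / u ^ S (S m)))%C) by auto.
  rewrite (Cmean_plus r ltac:(lra) (fun u => (2 * ab * RtoC r) * (om u / u ^ 1))%C) by auto.
  rewrite !Cmean_scal by (auto || lra).
  rewrite (Cmean_holo _ 1 r ltac:(lra) Hpow), (Cmean_holo _ 1 r ltac:(lra) Homp), H0.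
  change (Cmean (fun u => om u / u ^ 1)%C r) with c1.
  change (Cmean (fun u => om u / u ^ S (S m))%C r) with ck.
  replace (0 ^ S m)%C with (RtoC 0) by (simpl; ring).
  rewrite !RtoC_minus, RtoC_plus, <- D2, <- Haa; unfold b, a; ring. }
assert (HRW : 0 <= Re (Cmean W r)).
{ apply Cmean_Re_nonneg; [lra | exact HcW |]; intros u Hu.
  assert (Hu0 : u <> RtoC 0) by (apply Cmod_pos_neq; lra).
  set (v := (delta * u ^ S m / rk)%C).
  assert (Hv : Cmod v = 1).
  { unfold v, rk; rewrite Cmod_div, Cmod_mult, Cmod_pow, Hu, D1, Cmod_R, Rabs_pos_eq;
      [field; apply pow_nonzero; lra | apply pow_le; lra | apply Hrk]. }
  set (h := (RtoC r * om u / u)%C).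
  assert (Hh : Cmod h <= 1).
  { unfold h; rewrite Cmod_div, Cmod_mult, Cmod_R, Hu, Rabs_pos_eq by (trivial; lra).
    specialize (H1 u ltac:(lra)).
    replace (r * Cmod (om u) / r) with (Cmod (om u)) by (field; lra); lra. }
  assert (Hd0 : delta <> RtoC 0) by (apply Cmod_pos_neq; lra).
  assert (Hv0 : v <> RtoC 0) by (apply Cmod_pos_neq; lra).
  assert (EW : W u = (RtoC (1 + Cmod a ^ 2) + 2 * (ab * v) - h * ((1 + ab * v) * (1 + ab * v) / v))%C).
  { replace (h * ((1 + ab * v) * (1 + ab * v) / v))%C
      with (2 * ab * h + h / v + h * ab * ab * v)%C by (field; exact Hv0).
    unfold W, v, h.
    assert (Hrk0 : rk <> RtoC 0) by apply Hrk.
    assert (Hum : (u ^ m)%C <> RtoC 0) by now apply Cpow_nz.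
    replace (Cconj delta) with (/ delta)%C
      by (replace (Cconj delta) with (/ delta * (delta * Cconj delta))%C
            by (field; exact Hd0); rewrite Hdd; ring).
    replace (RtoC (r ^ S (S m))) with (RtoC r * rk)%C
      by (unfold rk; rewrite <- RtoC_mult; reflexivity).
    simpl; field; repeat split; assumption. }
  assert (Ha : Cmod (ab * v) = Cmod a) by (unfold ab; rewrite Cmod_mult, Hv, Cmod_conj; ring).
  pose proof (Cmod_sqr_plus_1 (ab * v)) as E; rewrite Ha in E.
  assert (HP : Re (h * ((1 + ab * v) * (1 + ab * v) / v)) <= Cmod (1 + ab * v) ^ 2).
  { eapply Rle_trans; [apply Rle_abs |]; eapply Rle_trans; [apply re_le_Cmod |].
    rewrite Cmod_mult, Cmod_div, Cmod_mult, Hv by exact Hv0.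
    pose proof (Cmod_ge_0 (1 + ab * v)) as Hp.
    replace (Cmod (1 + ab * v) * Cmod (1 + ab * v) / 1) with (Cmod (1 + ab * v) ^ 2) by field.
    pose proof (pow_le _ 2 Hp); nra. }
  rewrite EW; unfold Cminus; rewrite !re_plus, re_opp, Re_RtoC_mult, re_RtoC; lra. }
rewrite HmW, re_RtoC in HRW; unfold a, b in HRW.
rewrite !Cmod_mult, !Cmod_R, !Rabs_pos_eq in HRW by (try apply pow_le; lra).
rewrite Rpow_mult_distr in HRW; lra.
Qed.

(** The limit r -> 1. If X > 1, continuity of r^n at 1 with tolerance (X - 1)/X = 1 - 1/X supplies
    an r for which r^n X > 1. *)
Lemma le_1_of_pow_mult_le_1 (X : R) (n : nat) :
  (forall r, / 2 <= r < 1 -> r ^ n * X <= 1) -> X <= 1.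
Proof.
intros H; apply Rnot_lt_le; intros HX.
assert (C1 : continuity_pt (fun r => r ^ n) 1)
  by (apply derivable_continuous_pt, derivable_pt_pow).
destruct (C1 ((X - 1) / X)) as [d [Hd L]]; [apply Rdiv_lt_0_compat; lra |].
set (e := Rmin d 1 / 2).
assert (He : 0 < e /\ e < d /\ e <= / 2).
{ assert (0 < Rmin d 1) by (apply Rmin_glb_lt; lra).
  pose proof (Rmin_l d 1); pose proof (Rmin_r d 1); unfold e; lra. }
clearbody e.
specialize (L (1 - e)); simpl in L; unfold Rdist, D_x, no_cond in L.
rewrite pow1 in L; specialize (H (1 - e) ltac:(lra)).
assert (A : Rabs ((1 - e) ^ n - 1) < (X - 1) / X).
{ apply L; split; [split; [trivial | lra] |].
  replace (1 - e - 1) with (- e) by ring; rewrite Rabs_Ropp, Rabs_pos_eq; lra. }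
apply Rabs_def2 in A.
assert (B : (X - 1) / X * X = X - 1) by (field; lra).
nra.
Qed.

Theorem schwarz_coef_bound (om : C -> C) (m : nat) :
  holo_disc 1 om -> om (RtoC 0) = RtoC 0 -> (forall u, Cmod u < 1 -> Cmod (om u) < 1) ->
  Cmod (taylor_coef om (/ 2) (S (S m))) <= 1 - Cmod (taylor_coef om (/ 2) 1) ^ 2.
Proof.
intros Hom H0 H1.
assert (X : Cmod (taylor_coef om (/ 2) (S (S m))) + Cmod (taylor_coef om (/ 2) 1) ^ 2 <= 1);
  [| lra].
apply (le_1_of_pow_mult_le_1 _ (S (S m))); intros r Hr.
rewrite !(taylor_coef_radius om 1 (/ 2) r) by (trivial; lra).
eapply Rle_trans; [| apply (schwarz_coef_circle om r m); trivial; lra].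
(* The factor r^2 of |c1|^2 is weakened to r^(m+2), so that a single power multiplies the whole sum
   and the limit can be taken. *)
rewrite Rmult_plus_distr_l; apply Rplus_le_compat_l.
apply Rmult_le_compat_r; [apply pow2_ge_0 |].
replace (r ^ S (S m)) with (r ^ 2 * r ^ m) by (simpl; ring).
assert (r ^ m <= 1) by (rewrite <- (pow1 m); apply pow_incr; lra).
pose proof (pow2_ge_0 r); nra.
Qed.

(** * The function psi *)

Lemma RtoC_neq_0 (x : R) : x <> 0 -> RtoC x <> RtoC 0.
Proof. intros H E; apply RtoC_inj in E; contradiction. Qed.

Ltac cfield := field; repeat split; try assumption; try (apply RtoC_neq_0; lra).

Lemma Csqrt_Re_pos (z : C) : 0 < Re z -> 0 < Re (Csqrt z).
Proof.
intros H; unfold Csqrt; simpl; apply sqrt_lt_R0.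
pose proof (Cmod_ge_0 z); lra.
Qed.

Lemma Csqrt_1 : Csqrt 1 = RtoC 1.
Proof.
unfold Csqrt; rewrite Cmod_1; unfold RtoC; simpl.
replace ((1 + 1) / 2) with 1 by field; replace ((1 - 1) / 2) with 0 by field.
rewrite sqrt_1, sqrt_0; destruct (Rle_dec 0 0); f_equal; ring.
Qed.

(** From (sqrt y - sqrt z)(sqrt y + sqrt z) = y - z the slope is 1 / (sqrt y + sqrt z). Its
    denominator has real part at least Re (sqrt z) > 0 for every y, since the principal root has
    nonnegative real part, so the two sides of the cut need no separate treatment. *)
Lemma cderiv_Csqrt (z : C) : 0 < Re z -> cderiv Csqrt z (/ (2 * Csqrt z)).
Proof.
intros Hz; pose proof (Csqrt_Re_pos z Hz) as HS.
assert (Hlow : forall y, Re (Csqrt z) <= Cmod (Csqrt y + Csqrt z)).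
{ intros y; eapply Rle_trans; [| apply re_le_Cmod]; rewrite re_plus, Rabs_pos_eq;
    pose proof (Csqrt_Re y); lra. }
assert (Hn : forall y, (Csqrt y + Csqrt z)%C <> RtoC 0).
{ intros y; apply Cmod_pos_neq; specialize (Hlow y); lra. }
assert (E : forall y, Csqrt y = (Csqrt z + / (Csqrt y + Csqrt z) * (y - z))%C).
{ intros y; specialize (Hn y).
  transitivity (Csqrt z + / (Csqrt y + Csqrt z) * (Csqrt y * Csqrt y - Csqrt z * Csqrt z))%C.
  - field; exact Hn.
  - now rewrite !Csqrt_sqr. }
apply cderiv_slope; exists (fun y => / (Csqrt y + Csqrt z))%C; split; [| split].
- apply ccont_inv; [apply Hn |]; apply ccont_plus; [| apply ccont_const].
  intros e He; apply locally_Cmod; exists (e * Re (Csqrt z)); split; [now apply Rmult_lt_0_compat |].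
  intros y Hy; rewrite (E y).
  replace (Csqrt z + / (Csqrt y + Csqrt z) * (y - z) - Csqrt z)%C
    with ((y - z) / (Csqrt y + Csqrt z))%C by (unfold Cdiv; ring).
  rewrite Cmod_div by apply Hn; specialize (Hlow y).
  apply Rmult_lt_reg_r with (Cmod (Csqrt y + Csqrt z)); [lra |].
  unfold Rdiv; rewrite Rmult_assoc, Rinv_l, Rmult_1_r by lra; nra.
- f_equal; ring.
- exact E.
Qed.

Lemma Re_1_plus_pos (z : C) : Cmod z < 1 -> 0 < Re (1 + z).
Proof.
intros Hz; pose proof (re_le_Cmod z) as H; rewrite re_plus, re_RtoC.
pose proof (Rle_abs (- Re z)); rewrite Rabs_Ropp in *; lra.
Qed.

Lemma one_plus_neq_0 (z : C) : Cmod z < 1 -> (1 + z)%C <> RtoC 0.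
Proof. intros Hz E; pose proof (Re_1_plus_pos z Hz) as H; rewrite E, re_RtoC in H; lra. Qed.

Definition dpsi_AP (z : C) : C := (psi_AP z * (1 + / (2 * (1 + z))))%C.


Lemma cderiv_psi_AP (z : C) : Cmod z < 1 -> cderiv psi_AP z (dpsi_AP z).
Proof.
intros Hz; pose proof (Re_1_plus_pos z Hz) as HR.
assert (Hs : Csqrt (1 + z) <> RtoC 0).
{ intros E; pose proof (Csqrt_Re_pos _ HR) as H; rewrite E, re_RtoC in H; lra. }
pose proof (one_plus_neq_0 z Hz) as H1.
eapply cderiv_eq.
- apply cderiv_mult; [apply cderiv_Cexp |].
  apply (cderiv_shift Csqrt 1); apply cderiv_Csqrt, HR.
- unfold dpsi_AP, psi_AP; pose proof (Csqrt_sqr (1 + z)) as E; revert Hs E.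
  generalize (Csqrt (1 + z)); intros s Hs E; rewrite <- E.
  cfield.
Qed.

Lemma psi_AP_0 : psi_AP 0 = RtoC 1.
Proof. unfold psi_AP; rewrite Cplus_0_r, Cexp_0, Csqrt_1; ring. Qed.

Lemma psi_AP_neq_0 (z : C) : Cmod z < 1 -> psi_AP z <> RtoC 0.
Proof.
intros Hz; apply Cmult_neq_0; [apply Cexp_neq_0 |].
intros E; pose proof (Csqrt_Re_pos _ (Re_1_plus_pos z Hz)) as H; rewrite E, re_RtoC in H; lra.
Qed.

Lemma psi_AP_holo : holo_disc 1 psi_AP.
Proof. intros z Hz; exists (dpsi_AP z); now apply cderiv_psi_AP. Qed.

Lemma Cmult_eq_reg_l (c x y : C) : c <> RtoC 0 -> (c * x)%C = (c * y)%C -> x = y.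
Proof.
intros Hc E; replace x with (/ c * (c * x))%C by (field; exact Hc).
rewrite E; field; exact Hc.
Qed.


(** Expanding both sides of z exp'(z) = z exp(z) gives k e_k = e_(k-1), which determines the
    coefficients from e_0 = 1. *)
Lemma T3_Cexp : T3 Cexp 1 1 (1 / 2) (1 / 6).
Proof.
assert (Hh : holo_disc 1 Cexp) by (intros z _; eexists; apply cderiv_Cexp).
pose proof (T3_holo Cexp 1 (/ 2) ltac:(lra) Hh) as T.
set (e0 := taylor_coef Cexp (/ 2) 0) in T; set (e1 := taylor_coef Cexp (/ 2) 1) in T.
set (e2 := taylor_coef Cexp (/ 2) 2) in T; set (e3 := taylor_coef Cexp (/ 2) 3) in T.
clearbody e0 e1 e2 e3.
pose proof (T3_at_0 _ _ _ _ _ T) as E0; rewrite Cexp_0 in E0.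
pose proof (T3_deriv Cexp Cexp 1 _ _ _ _ Rlt_0_1 (fun z _ => cderiv_Cexp z) T) as T'.
pose proof (T3_mult _ _ _ _ _ _ _ _ _ _ T3_id T) as T''.
destruct (T3_unique _ _ _ _ _ _ _ _ _ T' T'') as [_ [E1 [E2 E3]]].
assert (F1 : e1 = RtoC 1) by (rewrite E1, <- E0; ring).
assert (F2 : e2 = (1 / 2)%C).
{ apply (Cmult_eq_reg_l 2); [apply RtoC_neq_0; lra |]; rewrite E2, F1; cfield. }
assert (F3 : e3 = (1 / 6)%C).
{ apply (Cmult_eq_reg_l 3); [apply RtoC_neq_0; lra |]; rewrite E3, F2; cfield. }
eapply T3_eq; [exact T | now symmetry | exact F1 | exact F2 | exact F3].
Qed.

(* The coefficients come from the differential equation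
   2 (1 + z) psi' = (3 + 2 z) psi. *)
Lemma T3_psi_AP : T3 psi_AP 1 (3 / 2) (7 / 8) (17 / 48).
Proof.
pose proof (T3_holo psi_AP 1 (/ 2) ltac:(lra) psi_AP_holo) as T.
set (e0 := taylor_coef psi_AP (/ 2) 0) in T; set (e1 := taylor_coef psi_AP (/ 2) 1) in T.
set (e2 := taylor_coef psi_AP (/ 2) 2) in T; set (e3 := taylor_coef psi_AP (/ 2) 3) in T.
clearbody e0 e1 e2 e3.
pose proof (T3_at_0 _ _ _ _ _ T) as E0; rewrite psi_AP_0 in E0.
pose proof (T3_deriv psi_AP dpsi_AP 1 _ _ _ _ Rlt_0_1 cderiv_psi_AP T) as T'.
pose proof (T3_mult _ _ _ _ _ _ _ _ _ _ (T3_poly 2 2 0 0) T') as L.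
pose proof (T3_mult _ _ _ _ _ _ _ _ _ _ (T3_poly 0 3 2 0) T) as Rr.
assert (L' : T3 (fun z => (0 + 3 * z + 2 * z ^ 2 + 0 * z ^ 3) * psi_AP z)%C
   (2 * 0) (2 * e1 + 2 * 0) (2 * (2 * e2) + 2 * e1 + 0 * 0)
   (2 * (3 * e3) + 2 * (2 * e2) + 0 * e1 + 0 * 0)).
{ eapply T3_ext; [| exact L].
  apply locally_Cmod; exists 1; split; [lra |]; intros z; replace (z - 0)%C with z by ring.
  intros Hz; unfold dpsi_AP; pose proof (one_plus_neq_0 z Hz); cfield. }
destruct (T3_unique _ _ _ _ _ _ _ _ _ L' Rr) as [_ [E1 [E2 E3]]].
clear L L' Rr T'.
assert (F1 : e1 = (3 / 2)%C).
{ apply (Cmult_eq_reg_l 2); [apply RtoC_neq_0; lra |].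
  transitivity (2 * e1 + 2 * 0)%C; [ring |]; rewrite E1, <- E0; cfield. }
assert (F2 : e2 = (7 / 8)%C).
{ apply (Cmult_eq_reg_l 4); [apply RtoC_neq_0; lra |].
  transitivity (2 * (2 * e2) + 2 * e1 + 0 * 0 - 2 * e1)%C; [ring |].
  rewrite E2, <- E0, F1; cfield. }
assert (F3 : e3 = (17 / 48)%C).
{ apply (Cmult_eq_reg_l 6); [apply RtoC_neq_0; lra |].
  transitivity (2 * (3 * e3) + 2 * (2 * e2) + 0 * e1 + 0 * 0 - 4 * e2)%C; [ring |].
  rewrite E3, <- E0, F2, F1; cfield. }
eapply T3_eq; [exact T | now symmetry | exact F1 | exact F2 | exact F3].
Qed.

(** * Holomorphic functions and power series *)

Lemma holo_disc_iff (R0 : R) (f : C -> C) : holo_disc R0 f <-> analytic_disc R0 f.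
Proof.
split; intros H z Hz; destruct (H z Hz) as [l Hl]; exists l; now apply cderiv_is_derive.
Qed.

Lemma cderiv_C_derive (R0 : R) (f : C -> C) (z : C) :
  holo_disc R0 f -> Cmod z < R0 -> cderiv f z (C_derive f z).
Proof.
intros Hf Hz; destruct (Hf z Hz) as [l Hl].
pose proof Hl as Hl'; apply cderiv_is_derive, is_C_derive_unique in Hl'; now rewrite Hl'.
Qed.

Lemma is_series_Cmod (a : nat -> C) (l : C) :
  is_series (K := C_AbsRing) (V := C_NormedModule) a l <->
  forall eps, 0 < eps -> exists N, forall n, (N <= n)%nat -> Cmod (sum_n a n - l)%C < eps.
Proof.
split.
- intros H eps He.
  assert (L : locally (T := C_UniformSpace) l (fun y => Cmod (y - l) < eps))
    by (apply locally_Cmod; exists eps; auto).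
  destruct (H _ L) as [N HN]; exists N; exact HN.
- intros H P HP; apply (locally_Cmod l) in HP; destruct HP as [d [Hd HP]].
  destruct (H d Hd) as [N HN]; exists N; intros n Hn; apply HP, HN, Hn.
Qed.

Lemma pow_n_Cpow (z : C) (n : nat) : pow_n (K := C_AbsRing) z n = (z ^ n)%C.
Proof. induction n as [| n IH]; [reflexivity |]; simpl; now rewrite IH. Qed.

Lemma series_terms_bounded (a : nat -> C) (l : C) :
  is_series (K := C_AbsRing) (V := C_NormedModule) a l -> exists B, forall n, Cmod (a n) <= B.
Proof.
intros H; destruct (proj1 (is_series_Cmod a l) H 1 Rlt_0_1) as [N HN].
assert (Hfin : forall M, exists B, forall n, (n <= M)%nat -> Cmod (a n) <= B).
{ induction M as [| M [B HB]].
  - exists (Cmod (a O)); intros n Hn; replace n with O by lia; lra.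
  - exists (Rmax B (Cmod (a (S M)))); intros n Hn.
    destruct (Nat.eq_dec n (S M)) as [-> | Hne]; [apply Rmax_r |].
    eapply Rle_trans; [apply HB; lia | apply Rmax_l]. }
destruct (Hfin N) as [B HB]; exists (Rmax B 2); intros n.
destruct (Nat.le_gt_cases n N) as [Hn | Hn]; [eapply Rle_trans; [now apply HB | apply Rmax_l] |].
eapply Rle_trans; [| apply Rmax_r].
destruct n as [| n]; [lia |].
pose proof (HN n ltac:(lia)) as A; pose proof (HN (S n) ltac:(lia)) as A'.
rewrite sum_Sn in A'; change (plus ?x ?y) with (x + y)%C in A'.
replace (a (S n)) with ((sum_n a n + a (S n) - l) + - (sum_n a n - l))%C by ring.
eapply Rle_trans; [apply Cmod_triangle |]; rewrite Cmod_opp; lra.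
Qed.

(** Convergence at the single point s = r / 2 bounds the terms, |a_k| s^k <= B. For |w| <= s / 2 the
    terms from order 4 on are then dominated by a geometric series of ratio at most 1/2, so the tail
    is at most 2 B (|w| / s)^4. *)
Lemma T3_pseries (a : nat -> C) (F : C -> C) (r : R) : 0 < r ->
  (forall w, Cmod w < r -> is_pseries (K := C_AbsRing) (V := C_NormedModule) a w (F w)) ->
  T3 F (a 0%nat) (a 1%nat) (a 2%nat) (a 3%nat).
Proof.
intros Hr H.
set (t := fun w k => (w ^ k * a k)%C).
assert (Ht : forall w, Cmod w < r -> is_series (K := C_AbsRing) (V := C_NormedModule) (t w) (F w)).
{ intros w Hw; specialize (H w Hw); unfold is_pseries in H.
  eapply is_series_ext; [| exact H]; intros n; simpl; now rewrite pow_n_Cpow. }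
set (s := r / 2).
assert (Hs : 0 < s < r) by (unfold s; lra).
destruct (series_terms_bounded _ _ (Ht (RtoC s) ltac:(rewrite Cmod_R, Rabs_pos_eq; lra))) as [B HB].
assert (HB' : forall k, Cmod (a k) * s ^ k <= B).
{ intros k; specialize (HB k); unfold t in HB.
  rewrite Cmod_mult, Cmod_pow, Cmod_R, Rabs_pos_eq in HB by lra; lra. }
assert (HB0 : 0 <= B) by (eapply Rle_trans; [apply Cmod_ge_0 | apply (HB O)]).
set (S3 := fun w => sum_n (t w) 3).
assert (Htail : forall w, Cmod w <= s / 2 -> Cmod (F w - S3 w) <= 2 * B / s ^ 4 * Cmod w ^ 4).
{ intros w Hw; pose proof (Cmod_ge_0 w) as Hw0.
  set (x := Cmod w / s).
  assert (Hx : 0 <= x <= / 2).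
  { unfold x; split; [apply Rdiv_le_0_compat; lra |].
    apply Rmult_le_reg_r with s; [lra |]; unfold Rdiv; rewrite Rmult_assoc, Rinv_l by lra; lra. }
  assert (Hterm : forall k, Cmod (t w k) <= B * x ^ k).
  { intros k; unfold t; rewrite Cmod_mult, Cmod_pow.
    replace (Cmod w) with (x * s) by (unfold x; field; lra).
    rewrite Rpow_mult_distr.
    replace (x ^ k * s ^ k * Cmod (a k)) with (x ^ k * (Cmod (a k) * s ^ k)) by ring.
    rewrite (Rmult_comm B); apply Rmult_le_compat_l; [apply pow_le; lra | apply HB']. }
  assert (Hx4 : 0 <= x ^ 4) by (apply pow_le; lra).
  (* The factor 2 - 2^(-n) is the geometric sum 1 + 1/2 + ... + 2^(-n), a form that the induction
     can carry. *)
  assert (Hpart : forall n, Cmod (sum_n (t w) (4 + n) - S3 w) <= B * x ^ 4 * (2 - (/ 2) ^ n)).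
  { induction n as [| n IH].
    - rewrite Nat.add_0_r, sum_Sn; change (plus ?p ?q) with (p + q)%C; fold (S3 w).
      replace (S3 w + t w 4%nat - S3 w)%C with (t w 4%nat) by ring.
      pose proof (Hterm 4%nat); simpl ((/ 2) ^ 0); lra.
    - rewrite Nat.add_succ_r, sum_Sn; change (plus ?p ?q) with (p + q)%C.
      replace (sum_n (t w) (4 + n) + t w (S (4 + n)) - S3 w)%C
        with ((sum_n (t w) (4 + n) - S3 w) + t w (S (4 + n)))%C by ring.
      eapply Rle_trans; [apply Cmod_triangle |].
      pose proof (Hterm (S (4 + n))) as A.
      assert (E : x ^ S (4 + n) <= x ^ 4 * (/ 2) ^ S n).
      { replace (S (4 + n)) with (4 + S n)%nat by lia; rewrite pow_add.
        apply Rmult_le_compat_l; [exact Hx4 | apply pow_incr; lra]. }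
      assert (E' : B * x ^ S (4 + n) <= B * x ^ 4 * (/ 2) ^ S n)
        by (rewrite Rmult_assoc; apply Rmult_le_compat_l; assumption).
      simpl ((/ 2) ^ S n) in *; lra. }
  replace (2 * B / s ^ 4 * Cmod w ^ 4) with (2 * B * x ^ 4)
    by (unfold x; field; lra).
  apply le_epsilon; intros e He.
  destruct (proj1 (is_series_Cmod _ _) (Ht w ltac:(lra)) e He) as [N HN].
  specialize (HN (4 + N)%nat ltac:(lia)).
  replace (F w - S3 w)%C with (- (sum_n (t w) (4 + N) - F w) + (sum_n (t w) (4 + N) - S3 w))%C by ring.
  eapply Rle_trans; [apply Cmod_triangle |]; rewrite Cmod_opp.
  specialize (Hpart N).
  assert (0 <= (/ 2) ^ N) by (apply pow_le; lra).
  assert (0 <= B * x ^ 4) by (apply Rmult_le_pos; assumption).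
  nra. }
assert (ES3 : forall w, S3 w = (a 0%nat + a 1%nat * w + a 2%nat * w ^ 2 + a 3%nat * w ^ 3)%C).
{ intros w; unfold S3; rewrite !sum_Sn, sum_O.
  repeat match goal with |- context [plus ?p ?q] => change (plus p q) with (p + q)%C end.
  unfold t; simpl; ring. }
exists (fun w => if Ceq_dec w 0 then RtoC 0 else ((F w - S3 w) / w ^ 4)%C); split.
- exists (2 * B / s ^ 4); apply locally_Cmod; exists (s / 2); split; [lra |].
  intros w; replace (w - 0)%C with w by ring; intros Hw.
  assert (Hs4 : 0 < s ^ 4) by (apply pow_lt; lra).
  destruct (Ceq_dec w 0) as [E | N]; [rewrite Cmod_0; apply Rdiv_le_0_compat; lra |].
  rewrite Cmod_div, Cmod_pow by now apply Cpow_nz.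
  specialize (Htail w ltac:(lra)); apply Cmod_gt_0 in N.
  apply Rmult_le_reg_r with (Cmod w ^ 4); [now apply pow_lt |].
  unfold Rdiv at 1; rewrite Rmult_assoc, Rinv_l, Rmult_1_r by (apply pow_nonzero; lra); exact Htail.
- apply locally_Cmod; exists s; split; [lra |].
  intros w; replace (w - 0)%C with w by ring; intros Hw.
  (* At w = 0 the factor w^4 leaves no freedom in the remainder, so F(0) = a_0 is needed; the tail
     estimate at 0 supplies it. *)
  destruct (Ceq_dec w 0) as [-> | N].
  + pose proof (Htail 0 ltac:(rewrite Cmod_0; lra)) as A; rewrite Cmod_0 in A.
    assert (Z : (F 0 - S3 0)%C = RtoC 0).
    { apply Cmod_eq_0, Rle_antisym; [| apply Cmod_ge_0]; simpl in A; lra. }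
    replace (F 0) with (F 0 - S3 0 + S3 0)%C by ring; rewrite Z, ES3; ring.
  + rewrite ES3; field; exact N.
Qed.

(** * The upper bound *)

Lemma locally_disc (R0 : R) (z : C) : Cmod z < R0 ->
  locally (T := C_UniformSpace) z (fun y => Cmod y < R0).
Proof.
intros Hz; apply locally_Cmod; exists (R0 - Cmod z); split; [lra |].
intros y Hy; pose proof (Cmod_minus_ge y z); lra.
Qed.

(** At the point g(w) the starlike quotient is g f'(g) / w = exp(F) f'(g), and the chain rule makes
    its product with 1 + w F' equal to 1. So only the value of f' at g(w) occurs, and no expansion
    of f or f' has to be related to one of the inverse. *)
Lemma subordination_identity (f om g F : C -> C) (r : R) :
  class_A f -> (forall z, Cmod z < 1 -> starlike_quotient f z = psi_AP (om z)) ->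
  is_inverse_disc r f g -> is_log_quotient_disc r g F ->
  forall w, Cmod w < r ->
    (psi_AP (om (w * Cexp (F w))) * (1 + w * C_derive F w))%C = RtoC 1.
Proof.
intros [Hf [Hf0 Hf1]] Hom [Hg [Hg0 Hfg]] [HF [HF0 HE]] w Hw.
apply holo_disc_iff in Hf; apply holo_disc_iff in HF.
assert (EG : forall v, Cmod v < r -> g v = (v * Cexp (F v))%C).
{ intros v Hv; destruct (Ceq_dec v 0) as [-> | N]; [rewrite Hg0; ring |].
  rewrite HE by assumption; field; exact N. }
rewrite <- EG by exact Hw.
destruct (Hfg w Hw) as [Hgw Efg].
assert (DE : cderiv (fun v => v * Cexp (F v))%C w (Cexp (F w) * (1 + w * C_derive F w))%C).
{ eapply cderiv_eq.
  - apply cderiv_mult; [apply cderiv_id |].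
    apply (cderiv_comp Cexp F); [apply (cderiv_C_derive r); assumption | apply cderiv_Cexp].
  - cbv beta; ring. }
assert (Dg : cderiv g w (Cexp (F w) * (1 + w * C_derive F w))%C).
{ revert DE; apply cderiv_ext_loc.
  generalize (locally_disc r w Hw); apply filter_imp; intros v Hv; symmetry; now apply EG. }
pose proof (cderiv_comp f g w _ _ Dg (cderiv_C_derive 1 f (g w) Hf Hgw)) as Dfg.
assert (D1 : cderiv (fun v => f (g v)) w 1).
{ apply cderiv_ext_loc with (fun v => v); [| apply cderiv_id].
  generalize (locally_disc r w Hw); apply filter_imp; intros v Hv.
  symmetry; now apply Hfg. }
pose proof (cderiv_unique _ _ _ _ Dfg D1) as E.
rewrite <- Hom by exact Hgw; unfold starlike_quotient.
destruct (Ceq_dec (g w) 0) as [Z | N].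
- assert (Hw0 : w = RtoC 0) by (rewrite <- Efg, Z; exact Hf0).
  rewrite Hw0; ring.
- assert (Hw0 : w <> RtoC 0) by (intros ->; now apply N).
  rewrite Efg; transitivity (C_derive f (g w) * (Cexp (F w) * (1 + w * C_derive F w)))%C;
    [| exact E].
  rewrite (EG w Hw); field; exact Hw0.
Qed.

Lemma hankel21_schwarz_coefs (f om : C -> C) (Gam : nat -> C) (c1 c2 c3 : C) :
  class_A f -> (forall z, Cmod z < 1 -> starlike_quotient f z = psi_AP (om z)) ->
  inverse_log_coeffs f Gam -> T3 om 0 c1 c2 c3 ->
  hankel21 Gam = (3 / 16 * (c1 * c3) - 47 / 128 * (c1 * c1 * c2)
                  + 1177 / 3072 * (c1 * c1 * c1 * c1) - 9 / 64 * (c2 * c2))%C.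
Proof.
intros Hf Hom [r [g [F [Hr [Hg [HF Hs]]]]]] Tom.
pose proof (T3_pseries _ F r Hr Hs) as TF; cbv beta iota in TF.
set (G1 := Gam 1%nat) in *; set (G2 := Gam 2%nat) in *; set (G3 := Gam 3%nat) in *.
assert (HFh : holo_disc r F) by (apply holo_disc_iff, HF).
pose proof (T3_deriv F (C_derive F) r _ _ _ _ Hr
              (fun z Hz => cderiv_C_derive r F z HFh Hz) TF) as TdF.
pose proof (T3_comp _ _ _ _ _ _ _ _ _ T3_Cexp TF) as TE.
pose proof (T3_mult _ _ _ _ _ _ _ _ _ _ T3_id TE) as TG.
assert (TG' : T3 (fun w => w * Cexp (F w))%C 0 1 (2 * G1) (2 * G2 + 2 * (G1 * G1))).
{ eapply T3_eq; [exact TG | ring | ring | ring | cfield]. }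
pose proof (T3_comp _ _ _ _ _ _ _ _ _ Tom TG') as To.
set (d1 := (c1 * 1)%C) in To.
set (d2 := (c1 * (2 * G1) + c2 * (1 * 1))%C) in To.
set (d3 := (c1 * (2 * G2 + 2 * (G1 * G1)) + 2 * c2 * (1 * (2 * G1)) + c3 * (1 * 1 * 1))%C) in To.
pose proof (T3_comp _ _ _ _ _ _ _ _ _ T3_psi_AP To) as Tp.
pose proof (T3_plus _ _ _ _ _ _ _ _ _ _ (T3_const 1) TdF) as Td.
pose proof (T3_mult _ _ _ _ _ _ _ _ _ _ Tp Td) as TT.
assert (T1 : T3 (fun w => psi_AP (om (w * Cexp (F w))) * (1 + w * C_derive F w))%C 1 0 0 0).
{ eapply T3_ext; [| apply (T3_const 1)].
  apply locally_Cmod; exists r; split; [exact Hr |].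
  intros w; replace (w - 0)%C with w by ring; intros Hw; symmetry.
  exact (subordination_identity f om g F r Hf Hom Hg HF w Hw). }
destruct (T3_unique _ _ _ _ _ _ _ _ _ TT T1) as [_ [E1 [E2 E3]]].
clear TT T1 Tp Td To TG TG' TE TdF TF.
(* The system is triangular: [w * C_derive F w] contributes 2, 4, 6 times the new unknown, and the
   composite with psi involves only the earlier ones. Hence the cancelled factors 2, 4 and 6. *)
assert (X1 : G1 = (- (3 / 4) * c1)%C).
{ apply (Cmult_eq_reg_l 2); [apply RtoC_neq_0; lra |].
  transitivity (0 - 3 / 2 * c1)%C; [rewrite <- E1; unfold d1; ring | cfield]. }
assert (X2 : G2 = (- (3 / 8) * c2 + 29 / 32 * (c1 * c1))%C).
{ apply (Cmult_eq_reg_l 4); [apply RtoC_neq_0; lra |].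
  transitivity (4 * G2 - 0)%C; [ring | rewrite <- E2].
  unfold d1, d2; rewrite X1; cfield. }
assert (X3 : G3 = (- (1 / 4) * c3 + 67 / 48 * (c1 * c2) - 925 / 576 * (c1 * c1 * c1))%C).
{ apply (Cmult_eq_reg_l 6); [apply RtoC_neq_0; lra |].
  transitivity (6 * G3 - 0)%C; [ring | rewrite <- E3].
  unfold d1, d2, d3; rewrite X1, X2; cfield. }
unfold hankel21; fold G1 G2 G3; rewrite X1, X2, X3; cfield.
Qed.

Lemma hankel21_polynomial_bound (c1 c2 c3 : C) :
  Cmod c2 <= 1 - Cmod c1 ^ 2 -> Cmod c3 <= 1 - Cmod c1 ^ 2 ->
  Cmod (3 / 16 * (c1 * c3) - 47 / 128 * (c1 * c1 * c2)
        + 1177 / 3072 * (c1 * c1 * c1 * c1) - 9 / 64 * (c2 * c2)) <= 1177 / 3072.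
Proof.
intros H2 H3.
pose proof (Cmod_ge_0 c1) as P1; pose proof (Cmod_ge_0 c2) as P2; pose proof (Cmod_ge_0 c3) as P3.
assert (E : forall (a b : R) (z : C), 0 <= a -> 0 < b -> Cmod (RtoC a / RtoC b * z) = a / b * Cmod z).
{ intros a b z Ha Hb; rewrite Cmod_mult, Cmod_div, !Cmod_R, !Rabs_pos_eq;
    try lra; apply RtoC_neq_0; lra. }
unfold Cminus; eapply Rle_trans; [apply Cmod_triangle |].
rewrite Cmod_opp.
eapply Rle_trans; [apply Rplus_le_compat_r, Cmod_triangle |].
eapply Rle_trans; [apply Rplus_le_compat_r, Rplus_le_compat_r, Cmod_triangle |].
rewrite Cmod_opp, !E, !Cmod_mult by lra.
set (x := Cmod c1) in *; set (y := Cmod c2) in *; set (w := Cmod c3) in *.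
assert (Hx1 : x ^ 2 <= 1) by lra.
assert (A : x * w <= x * (1 - x ^ 2)) by (apply Rmult_le_compat_l; lra).
assert (B : x * x * y <= x * x * (1 - x ^ 2)) by (apply Rmult_le_compat_l; nra).
assert (D : y * y <= (1 - x ^ 2) * (1 - x ^ 2)) by (apply Rmult_le_compat; lra).
(* This is 3072 times the gap left after inserting [A], [B] and [D]. The quadratic is positive:
   576^2 < 4 * 745 * 481. *)
assert (K : 0 <= (1 - x ^ 2) * (745 + 481 * x ^ 2 - 576 * x)).
{ apply Rmult_le_pos; [lra |]; nra. }
nra.
Qed.

Theorem hankel21_bound (f : C -> C) (Gam : nat -> C) :
  class_S_AP f -> inverse_log_coeffs f Gam -> Cmod (hankel21 Gam) <= 1177 / 3072.
Proof.
intros [HA [_ [om [[Hom [Hom0 Hom1]] Hsub]]]] HG.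
apply holo_disc_iff in Hom.
pose proof (T3_holo om 1 (/ 2) ltac:(lra) Hom) as T.
pose proof (T3_at_0 _ _ _ _ _ T) as E0; rewrite Hom0 in E0; rewrite <- E0 in T.
rewrite (hankel21_schwarz_coefs f om Gam _ _ _ HA Hsub HG T).
apply hankel21_polynomial_bound; now apply schwarz_coef_bound.
Qed.

(** * Primitives *)

(** Unordered endpoints, because the paths defining a primitive run from 0 to coordinates of either
    sign. *)
Definition cont_seg (f : R -> C) (a b : R) : Prop :=
  forall t, Rmin a b <= t <= Rmax a b -> ccont (T := R_UniformSpace) f t.

Lemma cont_seg_le f a b : a <= b -> cont_seg f a b <-> cont_on f a b.
Proof.
intros H; unfold cont_seg; rewrite Rmin_left, Rmax_right by exact H; reflexivity.
Qed.

Lemma cont_seg_sym f a b : cont_seg f a b -> cont_seg f b a.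
Proof. unfold cont_seg; now rewrite Rmin_comm, Rmax_comm. Qed.

Lemma cont_seg_Re f a b : cont_seg f a b -> ex_RInt (fun t => Re (f t)) a b.
Proof.
intros H; apply (ex_RInt_continuous (V := R_CompleteNormedModule)); intros t Ht.
now apply (ccont_Re (T := R_UniformSpace)), H.
Qed.

Lemma cont_seg_Im f a b : cont_seg f a b -> ex_RInt (fun t => Im (f t)) a b.
Proof.
intros H; apply (ex_RInt_continuous (V := R_CompleteNormedModule)); intros t Ht.
now apply (ccont_Im (T := R_UniformSpace)), H.
Qed.

Lemma CInt_swap f a b : cont_seg f a b -> CInt f b a = (- CInt f a b)%C.
Proof.
intros H; unfold CInt, Copp; simpl; f_equal; symmetry;
  apply (opp_RInt_swap (V := R_CompleteNormedModule)); [now apply cont_seg_Re | now apply cont_seg_Im].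
Qed.

Lemma CInt_minus_seg f g a b : cont_seg f a b -> cont_seg g a b ->
  CInt (fun t => f t - g t)%C a b = (CInt f a b - CInt g a b)%C.
Proof.
intros Hf Hg; destruct (Rle_dec a b) as [H | H].
- apply CInt_minus; trivial; now apply cont_seg_le.
- assert (H' : b <= a) by lra; apply cont_seg_sym in Hf; apply cont_seg_sym in Hg.
  rewrite (CInt_swap (fun t => f t - g t)%C b a), (CInt_swap f b a), (CInt_swap g b a), CInt_minus;
    try assumption; try (now apply cont_seg_le); [ring |].
  intros t Ht; apply ccont_minus; [now apply Hf | now apply Hg].
Qed.

Lemma CInt_bound_seg f a b M : cont_seg f a b ->
  (forall t, Rmin a b <= t <= Rmax a b -> Cmod (f t) <= M) ->
  Cmod (CInt f a b) <= 2 * M * Rabs (b - a).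
Proof.
intros Hf HM; destruct (Rle_dec a b) as [H | H].
- rewrite Rmin_left, Rmax_right in HM by exact H.
  rewrite Rabs_pos_eq by lra; apply CInt_bound; trivial; now apply cont_seg_le.
- rewrite Rmin_right, Rmax_left in HM by lra.
  apply cont_seg_sym in Hf.
  rewrite CInt_swap, Cmod_opp, Rabs_left by (assumption || lra).
  replace (- (b - a)) with (a - b) by ring; apply CInt_bound; trivial; [lra |].
  apply cont_seg_le; [lra | assumption].
Qed.

Lemma CInt_Chasles_seg f a b c : cont_seg f a b -> cont_seg f b c ->
  (CInt f a b + CInt f b c)%C = CInt f a c.
Proof.
intros H1 H2; unfold CInt, Cplus; cbn [fst snd]; apply (f_equal2 pair).
- exact (RInt_Chasles (V := R_CompleteNormedModule) (fun t => Re (f t)) a b c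
           (cont_seg_Re f a b H1) (cont_seg_Re f b c H2)).
- exact (RInt_Chasles (V := R_CompleteNormedModule) (fun t => Im (f t)) a b c
           (cont_seg_Im f a b H1) (cont_seg_Im f b c H2)).
Qed.

Lemma goursat_seg (G : C -> C) (a b c d : R) :
  (forall x y, Rmin a b <= x <= Rmax a b -> Rmin c d <= y <= Rmax c d ->
     exists l, cderiv G (x, y) l) ->
  rect_int G a b c d = RtoC 0.
Proof.
intros H.
assert (Hh : forall y, Rmin c d <= y <= Rmax c d -> cont_seg (fun x => G (x, y)) a b).
{ intros y Hy x Hx; destruct (H x y Hx Hy) as [l Hl].
  exact (ccont_horizontal G x y (cderiv_ccont _ _ _ Hl)). }
assert (Hv : forall x, Rmin a b <= x <= Rmax a b -> cont_seg (fun y => G (x, y)) c d).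
{ intros x Hx y Hy; destruct (H x y Hx Hy) as [l Hl].
  exact (ccont_vertical G x y (cderiv_ccont _ _ _ Hl)). }
assert (Sh : rect_int G b a c d = (- rect_int G a b c d)%C).
{ unfold rect_int.
  rewrite (CInt_swap _ a b) by (apply Hh; unfold Rmin, Rmax; destruct Rle_dec; lra).
  rewrite (CInt_swap _ a b) by (apply Hh; unfold Rmin, Rmax; destruct Rle_dec; lra); ring. }
assert (Sv : rect_int G a b d c = (- rect_int G a b c d)%C).
{ unfold rect_int.
  rewrite (CInt_swap _ c d) by (apply Hv; unfold Rmin, Rmax; destruct Rle_dec; lra).
  rewrite (CInt_swap _ c d) by (apply Hv; unfold Rmin, Rmax; destruct Rle_dec; lra); ring. }
assert (Svh : rect_int G b a d c = (- rect_int G b a c d)%C).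
{ unfold rect_int.
  rewrite (CInt_swap _ c d) by (apply Hv; unfold Rmin, Rmax; destruct Rle_dec; lra).
  rewrite (CInt_swap _ c d) by (apply Hv; unfold Rmin, Rmax; destruct Rle_dec; lra); ring. }
assert (N : forall z : C, (- z)%C = RtoC 0 -> z = RtoC 0).
{ intros z Ez; replace z with (- - z)%C by ring; rewrite Ez; ring. }
destruct (Rle_dec a b) as [Hab | Hab], (Rle_dec c d) as [Hcd | Hcd].
- rewrite !Rmin_left, !Rmax_right in H by assumption; now apply goursat.
- rewrite (Rmin_left a b), (Rmax_right a b), (Rmin_right c d), (Rmax_left c d) in H by lra.
  apply N; rewrite <- Sv; apply goursat; [lra | lra | exact H].
- rewrite (Rmin_right a b), (Rmax_left a b), (Rmin_left c d), (Rmax_right c d) in H by lra.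
  apply N; rewrite <- Sh; apply goursat; [lra | lra | exact H].
- rewrite !Rmin_right, !Rmax_left in H by lra.
  apply N; rewrite <- Sh; apply N; rewrite <- Svh; apply goursat; [lra | lra | exact H].
Qed.

Lemma Rabs_between (a b t : R) : Rmin a b <= t <= Rmax a b -> Rabs t <= Rmax (Rabs a) (Rabs b).
Proof. intros [H1 H2]; unfold Rmin, Rmax, Rabs in *; repeat destruct Rle_dec; repeat destruct Rcase_abs; lra. Qed.

Lemma Cmod_le_of_abs (x y x' y' : R) : Rabs x <= Rabs x' -> Rabs y <= Rabs y' ->
  Cmod (x, y) <= Cmod (x', y').
Proof.
intros Hx Hy; unfold Cmod; simpl; apply sqrt_le_1_alt.
rewrite !Rmult_1_r.
assert (x * x <= x' * x') by (apply Rsqr_le_abs_1; exact Hx).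
assert (y * y <= y' * y') by (apply Rsqr_le_abs_1; exact Hy).
lra.
Qed.

(** The modulus increases with |x| and |y|, and both are largest at one of the corners. *)
Lemma Cmod_rect (a b c d x y R0 : R) :
  Rmin a b <= x <= Rmax a b -> Rmin c d <= y <= Rmax c d ->
  Cmod (a, c) < R0 -> Cmod (a, d) < R0 -> Cmod (b, c) < R0 -> Cmod (b, d) < R0 ->
  Cmod (x, y) < R0.
Proof.
intros Hx Hy H1 H2 H3 H4.
apply Rabs_between in Hx; apply Rabs_between in Hy.
unfold Rmax in Hx, Hy; destruct (Rle_dec (Rabs a) (Rabs b)), (Rle_dec (Rabs c) (Rabs d));
  (eapply Rle_lt_trans; [apply Cmod_le_of_abs; eassumption | assumption]).
Qed.

Theorem holo_disc_primitive (R0 : R) (k : C -> C) : holo_disc R0 k ->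
  exists P : C -> C, P (RtoC 0) = RtoC 0 /\ forall z, Cmod z < R0 -> cderiv P z (k z).
Proof.
intros Hk.
(* The integral of k dz along the path from 0 to Re z on the real axis and then vertically up to
   z. *)
exists (fun z => (CInt (fun t => k (t, 0)) 0 (Re z) + Ci * CInt (fun t => k (Re z, t)) 0 (Im z))%C).
split.
{ assert (Hp : forall f a, CInt f a a = RtoC 0).
  { intros f a; unfold CInt, RtoC; now rewrite !RInt_point. }
  simpl; rewrite !Hp; ring. }
assert (Hkc : forall x y, Cmod (x, y) < R0 -> ccont (T := C_UniformSpace) k (x, y)).
{ intros x y H; now apply (holo_disc_ccont R0). }
intros [x y] Hz eps He.
destruct (proj1 (locally_Cmod _ _) (Hkc x y Hz (eps / 4) ltac:(lra))) as [d [Hd Hcont]].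
set (e := Rmin d (R0 - Cmod (x, y))).
assert (He' : 0 < e) by (apply Rmin_glb_lt; lra).
assert (Hed : e <= d) by apply Rmin_l.
assert (HeR : e <= R0 - Cmod (x, y)) by apply Rmin_r.
clearbody e.
apply locally_Cmod; exists e; split; [exact He' |].
intros [x' y'] Hw; cbn [Re Im fst snd].
set (h := ((x', y') - (x, y))%C) in *.
assert (Hbox : forall s t, Rabs (s - x) <= Rabs (x' - x) -> Rabs (t - y) <= Rabs (y' - y) ->
   Cmod ((s, t) - (x, y)) <= Cmod h).
{ intros s t Hs Ht; unfold h, Cminus, Cplus, Copp; simpl; apply Cmod_le_of_abs; assumption. }
assert (Hbox' : forall s t, Rabs (s - x) <= Rabs (x' - x) -> Rabs (t - y) <= Rabs (y' - y) ->
   Cmod (s, t) < R0).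
{ intros s t Hs Ht; specialize (Hbox s t Hs Ht).
  pose proof (Cmod_minus_ge (s, t) (x, y)); lra. }
assert (Z : forall a, Rabs (a - a) = 0) by (intros a; rewrite Rminus_diag; apply Rabs_R0).
assert (H1 : Cmod (x, 0) < R0).
{ eapply Rle_lt_trans; [| exact Hz]; apply Cmod_le_of_abs; [lra |]; rewrite Rabs_R0; apply Rabs_pos. }
assert (H2 : Cmod (x', y) < R0) by (apply Hbox'; [lra | rewrite Z; apply Rabs_pos]).
assert (H3 : Cmod (x', 0) < R0).
{ eapply Rle_lt_trans; [| exact H2]; apply Cmod_le_of_abs; [lra |]; rewrite Rabs_R0; apply Rabs_pos. }
assert (H4 : Cmod (x', y') < R0) by (apply Hbox'; lra).
assert (H5 : Cmod (0, 0) < R0).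
{ eapply Rle_lt_trans; [| exact H1]; apply Cmod_le_of_abs; [| lra]; rewrite Rabs_R0; apply Rabs_pos. }
assert (Sh : forall a b t, Cmod (a, t) < R0 -> Cmod (b, t) < R0 -> cont_seg (fun s => k (s, t)) a b).
{ intros a b t Ha Hb s Hs; apply ccont_horizontal, Hkc.
  apply (Cmod_rect a b t t); trivial; unfold Rmin, Rmax; destruct Rle_dec; lra. }
assert (Sv : forall a b s, Cmod (s, a) < R0 -> Cmod (s, b) < R0 -> cont_seg (fun t => k (s, t)) a b).
{ intros a b s Ha Hb t Ht; apply ccont_vertical, Hkc.
  apply (Cmod_rect s s a b); trivial; unfold Rmin, Rmax; destruct Rle_dec; lra. }
(* Goursat on this rectangle trades the change of path at the real axis for the segment from (x, y)
   to (x', y). The increment of the primitive is then an integral along two short sides close to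
   z. *)
assert (Gz : rect_int k x x' 0 y = RtoC 0).
{ apply goursat_seg; intros s t Hs Ht; apply Hk; apply (Cmod_rect x x' 0 y); trivial. }
unfold rect_int in Gz.
rewrite <- (CInt_Chasles_seg (fun t => k (t, 0)) 0 x x') by (apply Sh; assumption).
rewrite <- (CInt_Chasles_seg (fun t => k (x', t)) 0 y y') by (apply Sv; assumption).
set (kz := k (x, y)).
assert (E1 : CInt (fun t => k (t, y) - kz)%C x x' = (CInt (fun t => k (t, y)) x x' - kz * RtoC (x' - x))%C).
{ rewrite CInt_minus_seg, CInt_const; [reflexivity | now apply Sh | intros t _; apply ccont_const]. }
assert (E2 : CInt (fun t => k (x', t) - kz)%C y y' = (CInt (fun t => k (x', t)) y y' - kz * RtoC (y' - y))%C).
{ rewrite CInt_minus_seg, CInt_const; [reflexivity | now apply Sv | intros t _; apply ccont_const]. }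
assert (Eh : h = (RtoC (x' - x) + Ci * RtoC (y' - y))%C).
{ unfold h; rewrite !pair_C, !RtoC_minus; ring. }
replace (_ - _ - _)%C with
  (CInt (fun t => k (t, y) - kz)%C x x' + Ci * CInt (fun t => k (x', t) - kz)%C y y')%C.
2:{ rewrite E1, E2, Eh, <- (Cplus_0_r (CInt (fun t => k (t, y)) x x' - _)%C), <- Gz; ring. }
(* Each side costs 2 (eps / 4) times its length, and each length is at most |h|; together this is
   eps |h|. *)
assert (B1 : Cmod (CInt (fun t => k (t, y) - kz)%C x x') <= 2 * (eps / 4) * Rabs (x' - x)).
{ apply CInt_bound_seg.
  - intros t Ht; apply ccont_minus; [now apply (Sh x x' y) | apply ccont_const].
  - intros t Ht; apply Rlt_le, Hcont.
    eapply Rle_lt_trans; [apply Hbox; [| rewrite Z; apply Rabs_pos] | lra].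
    revert Ht; unfold Rmin, Rmax, Rabs; destruct Rle_dec; repeat destruct Rcase_abs; lra. }
assert (B2 : Cmod (CInt (fun t => k (x', t) - kz)%C y y') <= 2 * (eps / 4) * Rabs (y' - y)).
{ apply CInt_bound_seg.
  - intros t Ht; apply ccont_minus; [now apply (Sv y y' x') | apply ccont_const].
  - intros t Ht; apply Rlt_le, Hcont.
    eapply Rle_lt_trans; [apply Hbox; [lra |] | lra].
    revert Ht; unfold Rmin, Rmax, Rabs; destruct Rle_dec; repeat destruct Rcase_abs; lra. }
assert (Hx : Rabs (x' - x) <= Cmod h) by (exact (re_le_Cmod h)).
assert (Hy : Rabs (y' - y) <= Cmod h) by (exact (im_le_Cmod h)).
eapply Rle_trans; [apply Cmod_triangle |]; rewrite Cmod_mult, Cmod_Ci.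
nra.
Qed.

(** * The extremal function *)

Lemma taylor_series (h : C -> C) (R0 r : R) (z : C) : Cmod z < r < R0 -> holo_disc R0 h ->
  is_pseries (K := C_AbsRing) (V := C_NormedModule) (taylor_coef h r) z (h z).
Proof.
intros Hz Hh; pose proof (Cmod_ge_0 z) as Hz0.
assert (Hhc : cont_circle h r) by (intros u Hu; apply (holo_disc_ccont R0); [exact Hh | lra]).
destruct (taylor_rem_bound h r ltac:(lra) Hhc) as [M [HM HB]].
apply is_series_ext with (fun k => z ^ k * taylor_coef h r k)%C.
{ intros n; exact (f_equal (fun p => p * taylor_coef h r n)%C (eq_sym (pow_n_Cpow z n))). }
apply is_series_Cmod; intros eps He.
set (x := Cmod z / r).
assert (Hx : 0 <= x < 1).
{ unfold x; split; [apply Rdiv_le_0_compat; lra |].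
  apply Rmult_lt_reg_r with r; [lra |]; unfold Rdiv; rewrite Rmult_assoc, Rinv_l by lra; lra. }
set (K := M * (r / (r - Cmod z))).
assert (HK : 0 <= K) by (apply Rmult_le_pos; [exact HM | apply Rdiv_le_0_compat; lra]).
destruct (pow_lt_1_zero x ltac:(rewrite Rabs_pos_eq; lra) (eps / (1 + K))) as [N HN].
{ apply Rdiv_lt_0_compat; lra. }
exists N; intros n Hn.
rewrite (taylor_expansion h R0 r z n Hz Hh).
set (Sn := sum_n _ n).
replace (Sn - (Sn + z ^ S n * taylor_rem h r z (S n)))%C
  with (- (z ^ S n * taylor_rem h r z (S n)))%C by ring.
rewrite Cmod_opp, Cmod_mult, Cmod_pow.
specialize (HN (S n) ltac:(lia)); rewrite Rabs_pos_eq in HN by (apply pow_le; lra).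
apply Rle_lt_trans with (x ^ S n * K).
- replace (x ^ S n * K) with (Cmod z ^ S n * (M / r ^ S n * (r / (r - Cmod z)))).
  + apply Rmult_le_compat_l; [now apply pow_le | apply HB; lra].
  + unfold K, x, Rdiv; rewrite Rpow_mult_distr, pow_inv; ring.
- assert (HxS : 0 <= x ^ S n) by (apply pow_le; lra).
  assert (E : x ^ S n * (1 + K) < eps).
  { apply Rmult_lt_reg_r with (/ (1 + K)); [apply Rinv_0_lt_compat; lra |].
    rewrite Rmult_assoc, Rinv_r, Rmult_1_r by lra; exact HN. }
  lra.
Qed.

Lemma cderiv_of_quadratic_remainder (f chi : C -> C) (a b : C) : bounded_near0 chi ->
  locally (T := C_UniformSpace) (RtoC 0) (fun z => f z = (a + b * z + z * (z * chi z))%C) ->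
  cderiv f 0 b.
Proof.
intros [K HK] H.
apply cderiv_ext_loc with (fun z => a + b * z + z * (z * chi z))%C.
{ revert H; apply filter_imp; intros z ->; reflexivity. }
apply cderiv_slope; exists (fun z => b + z * chi z)%C; split; [| split; [ring | intros y; ring]].
apply ccont_plus; [apply ccont_const |].
intros eps He; pose proof (Rabs_pos K); pose proof (Rle_abs K).
assert (S : locally (T := C_UniformSpace) (RtoC 0) (fun z => Cmod z < eps / (1 + Rabs K))).
{ apply locally_Cmod; exists (eps / (1 + Rabs K)); split; [apply Rdiv_lt_0_compat; lra |].
  intros y; replace (y - 0)%C with y by ring; trivial. }
generalize (filter_and _ _ HK S); apply filter_imp; intros z [A B].
replace (z * chi z - 0 * chi 0)%C with (z * chi z)%C by ring.
rewrite Cmod_mult; pose proof (Cmod_ge_0 z).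
apply Rle_lt_trans with (Cmod z * (1 + Rabs K)); [apply Rmult_le_compat_l; lra |].
apply Rmult_lt_reg_r with (/ (1 + Rabs K)); [apply Rinv_0_lt_compat; lra |].
rewrite Rmult_assoc, Rinv_r, Rmult_1_r by lra; exact B.
Qed.

(** Filled in with a1, the quotient equals a1 + a2 z + O(z^2) at 0 by the expansion of h, so it has
    derivative a2 there; elsewhere the quotient rule applies. *)
Lemma removable_slope (h : C -> C) (R0 : R) a1 a2 a3 : holo_disc R0 h -> T3 h (h 0) a1 a2 a3 ->
  exists k, holo_disc R0 k /\ forall z, h z = (h 0 + z * k z)%C.
Proof.
intros Hh [phi [B L]].
set (k := fun z => if Ceq_dec z 0 then a1 else ((h z - h 0) / z)%C).
assert (Ek : forall z, z <> RtoC 0 -> k z = ((h z - h 0) / z)%C).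
{ intros z N; unfold k; destruct (Ceq_dec z 0); [contradiction | reflexivity]. }
exists k; split.
- intros z Hz; destruct (Ceq_dec z 0) as [-> | N].
  + exists a2; apply (cderiv_of_quadratic_remainder k (fun z => a3 + z * phi z)%C a1); [bounded |].
    revert L; apply filter_imp; intros z E; unfold k.
    destruct (Ceq_dec z 0) as [-> | N]; [ring |]; rewrite E; field; exact N.
  + destruct (Hh z Hz) as [l Hl]; eexists.
    apply cderiv_ext_loc with (fun z => (h z - h 0) / z)%C.
    * apply locally_Cmod; exists (Cmod z); split; [now apply Cmod_gt_0 |].
      intros y Hy; symmetry; apply Ek; intros ->.
      replace (0 - z)%C with (- z)%C in Hy by ring; rewrite Cmod_opp in Hy; lra.
    * apply cderiv_div; [exact N | | apply cderiv_id].
      apply cderiv_minus; [exact Hl | apply cderiv_const].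
- intros z; destruct (Ceq_dec z 0) as [-> | N]; [ring |]; rewrite (Ek z N); field; exact N.
Qed.

(** The Cauchy kernels at z and z' differ by u (z - z') / ((u - z)(u - z')), so a bound for q on one
    circle yields a Lipschitz constant on the smaller disc. *)
Lemma holo_disc_lipschitz (q : C -> C) : holo_disc 1 q ->
  exists L, 0 <= L /\ forall z z', Cmod z <= / 2 -> Cmod z' <= / 2 ->
    Cmod (q z - q z') <= L * Cmod (z - z').
Proof.
intros Hq; set (r := 3 / 4).
assert (Hr : r = 3 / 4) by reflexivity; clearbody r.
assert (Hqc : cont_circle q r) by (intros u Hu; apply (holo_disc_ccont 1); [exact Hq | lra]).
destruct (circle_bounded q r ltac:(lra) Hqc) as [M [HM Hb]].
(* On |u| = 3/4 both |u - z| and |u - z'| are at least 1/4, so the kernels differ by at most (3/4)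
   16 |z - z'| = 12 |z - z'|; the bound on means doubles this. *)
exists (24 * M); split; [lra |]; intros z z' Hz Hz'.
assert (Hker : forall y, Cmod y <= / 2 -> cont_circle (fun u => q u * (u / (u - y)))%C r).
{ intros y Hy u Hu; apply ccont_mult; [now apply Hqc |].
  apply (cont_circle_kernel y r); [lra | exact Hu]. }
rewrite <- (cauchy_formula q 1 r z), <- (cauchy_formula q 1 r z') by (trivial; lra).
rewrite <- Cmean_minus by (trivial; try lra; now apply Hker).
replace (24 * M * Cmod (z - z')) with (2 * (M * (12 * Cmod (z - z')))) by ring.
apply Cmean_bound_circ; [lra | |].
- intros u Hu; apply ccont_minus; now apply Hker.
- intros t Ht; set (u := circ r t).
  assert (Hu : Cmod u = r) by (apply Cmod_circ; lra).
  assert (N1 : (u - z)%C <> RtoC 0) by (apply Cminus_neq_0; lra).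
  assert (N2 : (u - z')%C <> RtoC 0) by (apply Cminus_neq_0; lra).
  replace (q u * (u / (u - z)) - q u * (u / (u - z')))%C
    with (q u * (u * (z - z') / ((u - z) * (u - z'))))%C by (field; split; assumption).
  rewrite Cmod_mult; apply Rmult_le_compat; try apply Cmod_ge_0; [now apply Hb |].
  rewrite Cmod_div, !Cmod_mult, Hu by now apply Cmult_neq_0.
  pose proof (Cmod_minus_ge u z); pose proof (Cmod_minus_ge u z').
  pose proof (Cmod_ge_0 (z - z')).
  assert (D : / 16 <= Cmod (u - z) * Cmod (u - z')) by nra.
  apply Rmult_le_reg_r with (Cmod (u - z) * Cmod (u - z')); [lra |].
  unfold Rdiv; rewrite Rmult_assoc, Rinv_l, Rmult_1_r by lra; nra.
Qed.

Lemma contraction_fixed_point (T : C -> C) (rho : R) : 0 <= rho ->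
  (forall z, Cmod z <= rho -> Cmod (T z) <= rho) ->
  (forall z z', Cmod z <= rho -> Cmod z' <= rho -> Cmod (T z - T z') <= / 2 * Cmod (z - z')) ->
  exists z, Cmod z <= rho /\ T z = z.
Proof.
intros Hrho Hmap Hlip.
set (x := fix x n := match n with O => RtoC 0 | S m => T (x m) end).
assert (Hx : forall n, Cmod (x n) <= rho).
{ induction n as [| n IH]; [simpl; rewrite Cmod_0; exact Hrho | now apply Hmap]. }
(* The iterates become partial sums of a series dominated by a geometric one, whose limit exists by
   completeness. Starting from 0 makes the sum of d_0, ..., d_n equal to x_(n+1). *)
set (d := fun n => (x (S n) - x n)%C).
assert (Hd : forall n, Cmod (d n) <= rho * (/ 2) ^ n).
{ induction n as [| n IH].
  - unfold d; replace (x 1%nat - x 0%nat)%C with (x 1%nat) by (simpl; ring).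
    simpl; rewrite Rmult_1_r; apply (Hx 1%nat).
  - pose proof (Hlip _ _ (Hx (S n)) (Hx n)) as A; unfold d in *; simpl in *; lra. }
assert (Hex : ex_series (K := C_AbsRing) (V := C_CompleteNormedModule) d).
{ apply (ex_series_le (K := C_AbsRing) (V := C_CompleteNormedModule) d (fun n => rho * (/ 2) ^ n)).
  - exact Hd.
  - apply (ex_series_scal_l (V := R_NormedModule)).
    exists (/ (1 - / 2)); apply is_series_geom; rewrite Rabs_pos_eq; lra. }
destruct Hex as [l Hl].
assert (Hlim : forall eps, 0 < eps -> exists N, forall n, (N <= n)%nat -> Cmod (x (S n) - l) < eps).
{ intros eps He; destruct (proj1 (is_series_Cmod d l) Hl eps He) as [N HN].
  exists N; intros n Hn; specialize (HN n Hn).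
  assert (E : sum_n d n = x (S n)).
  { clear; induction n as [| n IH].
    - rewrite sum_O; unfold d; simpl; ring.
    - rewrite sum_Sn, IH; change (plus ?a ?b) with (a + b)%C; unfold d; simpl; ring. }
  rewrite E in HN; exact HN. }
assert (Hlr : Cmod l <= rho).
{ apply le_epsilon; intros e He; destruct (Hlim e He) as [N HN]; specialize (HN N (le_n N)).
  replace l with (x (S N) + - (x (S N) - l))%C by ring.
  eapply Rle_trans; [apply Cmod_triangle |]; rewrite Cmod_opp; pose proof (Hx (S N)); lra. }
exists l; split; [exact Hlr |].
assert (Z : (T l - l)%C = RtoC 0).
{ apply Cmod_arbitrarily_small; intros e He.
  destruct (Hlim (e / 2) ltac:(lra)) as [N HN].
  pose proof (HN N (le_n N)) as A; pose proof (HN (S N) ltac:(lia)) as B.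
  pose proof (Hlip _ _ (Hx (S N)) Hlr) as D.
  replace (T l - l)%C with (- (T (x (S N)) - T l) + (x (S (S N)) - l))%C by (simpl; ring).
  eapply Rle_trans; [apply Cmod_triangle |]; rewrite Cmod_opp; lra. }
replace (T l) with (T l - l + l)%C by ring; rewrite Z; ring.
Qed.

(** P is a primitive of the slope k of psi at 0, so 1 + z P' = 1 + z k = psi. In the form exp(P) psi
    the derivative visibly has no zero in the disc, which the inversion needs. *)
Lemma extremal_function :
  exists P : C -> C, holo_disc 1 P /\ P (RtoC 0) = RtoC 0 /\
    forall z, Cmod z < 1 -> cderiv (fun z => z * Cexp (P z))%C z (Cexp (P z) * psi_AP z).
Proof.
pose proof T3_psi_AP as T; rewrite <- psi_AP_0 in T at 1.
destruct (removable_slope psi_AP 1 _ _ _ psi_AP_holo T) as [k [Hk Ek]].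
destruct (holo_disc_primitive 1 k Hk) as [P [P0 HP]].
exists P; split; [intros z Hz; exists (k z); now apply HP |].
split; [exact P0 |]; intros z Hz; eapply cderiv_eq.
- apply cderiv_mult; [apply cderiv_id |].
  apply (cderiv_comp Cexp P); [now apply HP | apply cderiv_Cexp].
- rewrite (Ek z), psi_AP_0; cbv beta; ring.
Qed.

Lemma Cexp_mult_opp (z : C) : (Cexp z * Cexp (- z))%C = RtoC 1.
Proof. rewrite <- Cexp_plus; replace (z + - z)%C with (RtoC 0) by ring; apply Cexp_0. Qed.

Theorem hankel21_sharp :
  exists (f : C -> C) (Gam : nat -> C),
    class_S_AP f /\ inverse_log_coeffs f Gam /\ Cmod (hankel21 Gam) = 1177 / 3072.
Proof.
destruct extremal_function as [P [HP [P0 HfD]]].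
set (f := fun z => (z * Cexp (P z))%C) in HfD.
assert (Hf : holo_disc 1 f) by (intros z Hz; eexists; now apply HfD).
assert (HA : class_A f).
{ split; [now apply holo_disc_iff | split; [unfold f; ring |]].
  assert (D : cderiv f 0 (Cexp (P 0) * psi_AP 0)) by (apply HfD; rewrite Cmod_0; lra).
  apply cderiv_is_derive, is_C_derive_unique in D.
  rewrite D, P0, Cexp_0, psi_AP_0; ring. }
assert (Hsub : forall z, Cmod z < 1 -> starlike_quotient f z = psi_AP z).
{ intros z Hz; unfold starlike_quotient; destruct (Ceq_dec z 0) as [-> | N].
  - now rewrite psi_AP_0.
  - pose proof (HfD z Hz) as D; apply cderiv_is_derive, is_C_derive_unique in D.
    rewrite D; unfold f; field; split; [apply Cexp_neq_0 | exact N]. }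
assert (HS : class_S_AP f).
{ split; [exact HA | split].
  - intros z Hz N; apply Cmult_neq_0; [exact N | apply Cexp_neq_0].
  - exists (fun z => z); split; [| exact Hsub].
    split; [| split; [reflexivity | trivial]].
    apply holo_disc_iff; intros z _; eexists; apply cderiv_id. }
(* With this q, f(z) = w is equivalent to w q(z) = z, a fixed-point equation in z. *)
set (q := fun z => Cexp (- P z)).
assert (Hq : holo_disc 1 q).
{ intros z Hz; destruct (HP z Hz) as [l Hl]; eexists.
  apply (cderiv_comp Cexp (fun z => - P z)%C); [now apply cderiv_opp, Hl | apply cderiv_Cexp]. }
destruct (holo_disc_lipschitz q Hq) as [L [HL0 HL]].
set (M := Cmod (q 0) + L / 2).
assert (HM0 : 0 <= M) by (pose proof (Cmod_ge_0 (q 0)); unfold M; lra).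
assert (HM : forall z, Cmod z <= / 2 -> Cmod (q z) <= M).
{ intros z Hz; replace (q z) with (q 0 + (q z - q 0))%C by ring.
  eapply Rle_trans; [apply Cmod_triangle |].
  pose proof (HL z 0 Hz ltac:(rewrite Cmod_0; lra)) as A.
  replace (z - 0)%C with z in A by ring; unfold M; nra. }
(* Makes r M and r L at most 1/2: for |w| < r the map z -> w q(z) then preserves the disc of radius
   1/2 and contracts by 1/2. *)
set (r := / (2 * (M + L + 1))).
assert (Hr : 0 < r) by (apply Rinv_0_lt_compat; lra).
assert (HrML : r * (M + L + 1) = / 2) by (unfold r; field; lra).
clearbody M r.
(* The condition on w sits under the existential, so that choice delivers a function g on all of
   C. *)
assert (Hg : forall w, exists z, Cmod w < r -> Cmod z <= / 2 /\ (w * q z)%C = z).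
{ intros w; destruct (Rlt_dec (Cmod w) r) as [Hw | Hw]; [| now exists (RtoC 0)].
  pose proof (Cmod_ge_0 w) as Hw0.
  destruct (contraction_fixed_point (fun z => w * q z)%C (/ 2)) as [z Hz]; [lra | | | now exists z].
  - intros z Hz; rewrite Cmod_mult; specialize (HM z Hz); pose proof (Cmod_ge_0 (q z)); nra.
  - intros z z' Hz Hz'; specialize (HL z z' Hz Hz').
    replace (w * q z - w * q z')%C with (w * (q z - q z'))%C by ring.
    rewrite Cmod_mult; pose proof (Cmod_ge_0 (z - z')).
    apply Rle_trans with (Cmod w * (L * Cmod (z - z'))); [now apply Rmult_le_compat_l |].
    rewrite <- Rmult_assoc; apply Rmult_le_compat_r; [assumption | nra]. }
set (g := fun w => proj1_sig (constructive_indefinite_description _ (Hg w))).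
assert (Hgs : forall w, Cmod w < r -> Cmod (g w) <= / 2 /\ (w * q (g w))%C = g w).
{ intros w; unfold g; destruct (constructive_indefinite_description _ (Hg w)) as [z Hz]; exact Hz. }
clearbody g; clear Hg.
assert (Hfg : forall w, Cmod w < r -> f (g w) = w).
{ intros w Hw; destruct (Hgs w Hw) as [_ E]; unfold f.
  transitivity (w * (Cexp (P (g w)) * q (g w)))%C.
  - rewrite <- E at 1; ring.
  - unfold q; rewrite Cexp_mult_opp; ring. }
assert (Hglip : forall w w', Cmod w < r -> Cmod w' < r ->
   Cmod (g w' - g w) <= 2 * M * Cmod (w' - w)).
{ intros w w' Hw Hw'; destruct (Hgs w Hw) as [A E]; destruct (Hgs w' Hw') as [A' E'].
  assert (EQ : (g w' - g w)%C = ((w' - w) * q (g w') + w * (q (g w') - q (g w)))%C).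
  { rewrite <- E at 1; rewrite <- E' at 1; ring. }
  assert (B : Cmod (g w' - g w) <= Cmod (w' - w) * M + Cmod w * (L * Cmod (g w' - g w))).
  { rewrite EQ at 1; eapply Rle_trans; [apply Cmod_triangle |]; rewrite !Cmod_mult.
    apply Rplus_le_compat; apply Rmult_le_compat_l; try apply Cmod_ge_0; auto. }
  pose proof (Cmod_ge_0 w); pose proof (Cmod_ge_0 (g w' - g w)).
  (* The second term of [B] is thus at most half of the left side and is absorbed there, leaving the
     factor 2 M. *)
  assert (D : Cmod w * L <= / 2) by nra.
  assert (Cmod w * (L * Cmod (g w' - g w)) <= / 2 * Cmod (g w' - g w))
    by (rewrite <- Rmult_assoc; apply Rmult_le_compat_r; assumption).
  lra. }
assert (Hgc : forall w, Cmod w < r -> ccont (T := C_UniformSpace) g w).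
{ intros w Hw eps He.
  assert (S : locally (T := C_UniformSpace) w (fun y => Cmod (y - w) < eps / (1 + 2 * M))).
  { apply locally_Cmod; eexists; split; [| intros y Hy; exact Hy].
    apply Rdiv_lt_0_compat; lra. }
  generalize (filter_and _ _ (locally_disc r w Hw) S); apply filter_imp; intros y [A B].
  specialize (Hglip w y Hw A); pose proof (Cmod_ge_0 (y - w)).
  assert (E : Cmod (y - w) * (1 + 2 * M) < eps).
  { apply Rmult_lt_reg_r with (/ (1 + 2 * M)); [apply Rinv_0_lt_compat; lra |].
    rewrite Rmult_assoc, Rinv_r, Rmult_1_r by lra; exact B. }
  nra. }
assert (Hgh : holo_disc r g).
{ intros w Hw; destruct (Hgs w Hw) as [A _].
  pose proof (HfD (g w) ltac:(lra)) as D; apply cderiv_slope in D.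
  destruct D as [phi [P1 [P2 P3]]].
  (* The slope of f at g(w) is nonzero there, hence nonzero near w after composing with the
     continuous g. Its reciprocal is the slope of g, because f(g(y)) - f(g(w)) = y - w. *)
  assert (N : phi (g w) <> RtoC 0).
  { rewrite P2; apply Cmult_neq_0; [apply Cexp_neq_0 | apply psi_AP_neq_0; lra]. }
  assert (Cphi : ccont (T := C_UniformSpace) (fun y => phi (g y)) w)
    by exact (ccont_comp phi (T := C_UniformSpace) g w (Hgc w Hw) P1).
  exists (/ phi (g w))%C.
  apply cderiv_ext_loc with (fun y => g w + / phi (g y) * (y - w))%C.
  - apply Cmod_gt_0 in N.
    generalize (filter_and _ _ (locally_disc r w Hw) (Cphi _ N)); apply filter_imp.
    intros y [Hy B].
    assert (Ny : phi (g y) <> RtoC 0).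
    { intros E; rewrite E in B; replace (0 - phi (g w))%C with (- phi (g w))%C in B by ring.
      rewrite Cmod_opp in B; lra. }
    pose proof (P3 (g y)) as E; rewrite (Hfg y Hy), (Hfg w Hw) in E.
    assert (Ey : (y - w)%C = (phi (g y) * (g y - g w))%C).
    { transitivity (w + phi (g y) * (g y - g w) - w)%C; [now rewrite <- E | ring]. }
    rewrite Ey; field; exact Ny.
  - apply cderiv_slope; exists (fun y => / phi (g y))%C; split; [| split].
    + now apply ccont_inv.
    + reflexivity.
    + intros y; ring. }
assert (Hg0 : g (RtoC 0) = RtoC 0).
{ destruct (Hgs 0 ltac:(rewrite Cmod_0; exact Hr)) as [_ E]; rewrite <- E; ring. }
(* The fixed-point equation gives g(w) / w = q(g(w)) = exp(-P(g(w))), so the logarithm is available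
   without choosing a branch. *)
set (F := fun w => (- P (g w))%C).
assert (HF : holo_disc r F).
{ intros w Hw; destruct (Hgs w Hw) as [A _]; destruct (Hgh w Hw) as [l Hl].
  destruct (HP (g w) ltac:(lra)) as [m Hm]; eexists.
  apply cderiv_opp, (cderiv_comp P g); [exact Hl | exact Hm]. }
assert (HF0 : F (RtoC 0) = RtoC 0) by (unfold F; rewrite Hg0, P0; ring).
set (s := r / 2).
assert (Hs : 0 < s < r) by (unfold s; lra).
set (Gam := fun n => (taylor_coef F s n / 2)%C).
assert (HG : inverse_log_coeffs f Gam).
{ exists s, g, F; split; [lra | split; [| split]].
  - split; [apply holo_disc_iff; intros w Hw; apply Hgh; lra | split; [exact Hg0 |]].
    intros w Hw; destruct (Hgs w ltac:(lra)) as [A _]; split; [lra | apply Hfg; lra].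
  - split; [apply holo_disc_iff; intros w Hw; apply HF; lra | split; [exact HF0 |]].
    intros w Hw N; destruct (Hgs w ltac:(lra)) as [_ E].
    change (Cexp (F w)) with (q (g w)); rewrite <- E at 2; field; exact N.
  - intros w Hw.
    apply (is_pseries_ext (K := C_AbsRing) (V := C_NormedModule) (taylor_coef F s)).
    (* The constant term of the prescribed series is 0, and so is that of F because F(0) = 0. *)
    + intros [| n].
      * rewrite <- HF0; symmetry; exact (T3_at_0 _ _ _ _ _ (T3_holo F r s Hs HF)).
      * change (taylor_coef F s (S n) = 2 * (taylor_coef F s (S n) / 2))%C; cfield.
    + apply (taylor_series F r); [lra | exact HF]. }
exists f, Gam; split; [exact HS | split; [exact HG |]].
rewrite (hankel21_schwarz_coefs f (fun z => z) Gam 1 0 0 HA Hsub HG T3_id).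
replace (3 / 16 * (1 * 0) - 47 / 128 * (1 * 1 * 0) + 1177 / 3072 * (1 * 1 * 1 * 1) -
   9 / 64 * (0 * 0))%C with (RtoC (1177 / 3072)).
- rewrite Cmod_R, Rabs_pos_eq; lra.
- rewrite RtoC_div by lra; ring.
Qed.

Theorem theorem5p1 :
  (forall (f : C -> C) (Gam : nat -> C),
     class_S_AP f -> inverse_log_coeffs f Gam ->
     Cmod (hankel21 Gam) <= 1177 / 3072) /\
  (exists (f : C -> C) (Gam : nat -> C),
     class_S_AP f /\ inverse_log_coeffs f Gam /\
     Cmod (hankel21 Gam) = 1177 / 3072).
Proof. split; [exact hankel21_bound | exact hankel21_sharp]. Qed.
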